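(* Let $u\ge 0$ be an integer and $k\ge 2$ an even integer. Let $a_1,\dots,a_u\in\{1,2,4,8\}$ and $c_1,\dots,c_k\in\{1,2,3,4,6\}$, and put $\mathbf{h}=c_1+\cdots+c_k$. Let $$\psi_{l,t}(\tau)=\prod_{i=1}^u\mathcal{F}(a_i\tau)\prod_{j=1}^k\Psi(c_j\tau)$$ be the generating function of the mixed form $\mathcal{M}_{l,t}(\mathbf{x},\mathbf{z})$ in $2u+k$ variables. If $\mathbf{h}$ is a multiple of $8$, then $q^{\mathbf{h}/8}\psi_{l,t}(\tau)$ is a modular form in $M_{u+k/2}(\Gamma_0(L),\chi')$, where $$L=\mathrm{lcm}\big[3\,\mathrm{lcm}[a_1,\dots,a_u],\;2\,\mathrm{lcm}[c_1,\dots,c_k]\big],$$ $\chi'=\chi$ if $u$ is even, $\chi'=\left(\frac{\cdot}{3}\right)\chi$ if $u$ is odd, and $\chi=\left(\frac{(-1)^{k/2}4c_1c_2\cdots c_k}{\cdot}\right)$.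
   Context: Here $q=e^{2\pi i\tau}$ with $\tau$ in the upper half-plane. $\mathcal{F}(\tau)=\sum_{m,n\in\mathbb{Z}}q^{m^2+mn+n^2}$ and $\Psi(\tau)=\sum_{n\ge 0}q^{n(n+1)/2}$. With $T_z=\frac{z(z+1)}{2}$, the mixed form is $\mathcal{M}_{l,t}(\mathbf{x},\mathbf{z})=\sum_{i=1}^u a_i(x_{2i-1}^2+x_{2i-1}x_{2i}+x_{2i}^2)+\sum_{i=1}^k c_iT_{z_i}$ for $\mathbf{x}\in\mathbb{Z}^{2u}$, $\mathbf{z}\in\mathbb{Z}_{\ge 0}^k$. $M_w(\Gamma_0(N),\psi)$ is the space of (holomorphic) modular forms of weight $w$, level $N$ and character $\psi$. The symbols $\left(\frac{m}{\cdot}\right)$ and $\left(\frac{\cdot}{3}\right)$ are Kronecker/Legendre symbols. The lcm of an empty list is $1$. *)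

(* Defs.v *)
From mathcomp Require Import all_boot all_order all_algebra.
From mathcomp Require Import all_classical all_reals all_analysis.
From mathcomp.analysis Require summability.
From mathcomp Require Import complex.

Set Implicit Arguments.
Unset Strict Implicit.
Unset Printing Implicit Defensive.

Import Order.TTheory GRing.Theory Num.Theory.
Import numFieldNormedType.Exports.

Local Open Scope classical_set_scope.
Local Open Scope ring_scope.

(* Legendre symbol (m / p) for an odd prime p. *)
Definition legendre (m : int) (p : nat) : int :=
  if (p%:Z %| m)%Z then 0
  else if [exists x : 'I_p, ((x : nat)%:Z ^+ 2 == m %[mod p%:Z])%Z] then 1
  else -1.

(* Kronecker symbol (m / p) for a prime p. *)
Definition kronecker_prime (m : int) (p : nat) : int :=
  if p == 2%N then
    if (2 %| m)%Z then 0
    else if ((m %% 8)%Z == 1) || ((m %% 8)%Z == 7) then 1 else -1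
  else legendre m p.

(* Kronecker symbol (m / n) for arbitrary integers, with the usual conventions
   (m / 0) = 1 if m = 1 or m = -1, (m / 0) = 0 otherwise, and
   (m / -1) = -1 if m < 0, (m / -1) = 1 otherwise. *)
Definition kronecker (m n : int) : int :=
  if n == 0 then (`|m| == 1)%:R
  else (if (n < 0) && (m < 0) then -1 else 1) *
       \prod_(pe <- prime_decomp `|n|%N) kronecker_prime m pe.1 ^+ pe.2.

Definition SL2Z : set 'M[int]_2 := [set g | \det g = 1].

Definition Gamma0 (N : nat) : set 'M[int]_2 :=
  [set g : 'M[int]_2 | \det g = 1 /\ (N%:Z %| (g 1 0)%R)%Z].

(* The topology on the complex numbers R[i] is the one carried by the alias
   R[i]^o (the numField R[i] as a normed module over itself); derivability
   along 1 over R[i] is therefore complex differentiability. *)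
Section ModularForms.
Context {R : realType}.
Local Notation C := R[i].

Definition upper_half_plane : set C := [set tau | 0 < complex.Im tau].

Definition cexp (z : C) : C :=
  Complex (expR (complex.Re z) * cos (complex.Im z))
          (expR (complex.Re z) * sin (complex.Im z)).

(* q = e^(2 pi i tau). *)
Definition q (tau : C) : C := cexp (Complex 0 (2 * pi) * tau).

Definition automorphy (g : 'M[int]_2) (tau : C) : C :=
  (g 1 0)%:~R * tau + (g 1 1)%:~R.

Definition mobius (g : 'M[int]_2) (tau : C) : C :=
  ((g 0 0)%:~R * tau + (g 0 1)%:~R) / automorphy g tau.

Definition slash (w : nat) (f : C -> C) (g : 'M[int]_2) (tau : C) : C :=
  automorphy g tau ^- w * f (mobius g tau).

Definition holomorphic_upper (f : C -> C) : Prop :=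
  forall tau, upper_half_plane tau -> derivable (f : C^o -> C^o) tau 1.

(* f has an expansion sum_(n >= 0) b_n e^(2 pi i n tau / r) for some width r. *)
Definition holomorphic_at_infinity (f : C -> C) : Prop :=
  exists r : nat, (0 < r)%N /\ exists b : nat -> C,
    forall tau, upper_half_plane tau ->
      series (fun n => b n * q (tau / r%:R) ^+ n : C^o) n @[n --> \oo]
        --> (f tau : C^o).

(* psi induces a Dirichlet character modulo N; its values at integers not
   prime to N play no role in modularity for Gamma0(N). *)
Definition dirichlet_character (N : nat) (psi : int -> C) : Prop :=
  [/\ psi 1 = 1,
      forall m n, coprimez m N%:Z -> coprimez n N%:Z ->
        psi (m * n) = psi m * psi n
    & forall m n, coprimez m N%:Z -> coprimez n N%:Z ->
        (m = n %[mod N%:Z])%Z -> psi m = psi n].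

(* M_w(Gamma0(N), psi). Functions are total on C, but only their restrictions
   to the upper half-plane matter. *)
Definition modular_forms (w N : nat) (psi : int -> C) : set (C -> C) :=
  [set f | [/\ dirichlet_character N psi,
               holomorphic_upper f,
               forall g, Gamma0 N g -> forall tau, upper_half_plane tau ->
                 f (mobius g tau) = psi (g 1 1) * automorphy g tau ^+ w * f tau
             & forall g, SL2Z g -> holomorphic_at_infinity (slash w f g)]].

(* Unordered sum over Z^2 (limit over the finite subsets). *)
Definition calF (tau : C) : C :=
  summability.sum
    (fun p : int * int =>
       q tau ^ (p.1 ^+ 2 + p.1 * p.2 + p.2 ^+ 2) : C^o).

Definition Psi (tau : C) : C :=
  limn (series (fun n => q tau ^+ (n * n.+1)./2 : C^o)).

Definition psi_lt (u k : nat) (a : 'I_u -> nat) (c : 'I_k -> nat) (tau : C) : C :=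
  (\prod_(i < u) calF ((a i)%:R * tau)) * \prod_(j < k) Psi ((c j)%:R * tau).

End ModularForms.

Definition chi (k : nat) (c : 'I_k -> nat) (d : int) : int :=
  kronecker ((-1) ^+ k./2 * 4 * (\prod_(j < k) c j)%N%:Z) d.

Definition chi' (u k : nat) (c : 'I_k -> nat) (d : int) : int :=
  if odd u then legendre d 3 * chi c d else chi c d.

Definition level (u k : nat) (a : 'I_u -> nat) (c : 'I_k -> nat) : nat :=
  lcmn (3 * \big[lcmn/1%N]_(i < u) a i) (2 * \big[lcmn/1%N]_(j < k) c j).

(* Main.v *)
Require Import Defs.
From mathcomp Require Import all_boot all_order all_algebra.
From mathcomp Require Import all_classical all_reals all_analysis.
From mathcomp Require Import complex.
From mathcomp Require Import finmap ring lra zify.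
From mathcomp Require finfield.
From mathcomp.analysis Require summability.

Set Implicit Arguments.
Unset Strict Implicit.
Unset Printing Implicit Defensive.

Import Order.TTheory GRing.Theory Num.Theory.
Import numFieldNormedType.Exports.

Local Open Scope classical_set_scope.
Local Open Scope ring_scope.

(** Put th2(t) = sum exp(pi i t (n+1/2)^2), th3(t) = sum exp(pi i t n^2),
    th4(t) = sum (-1)^n exp(pi i t n^2). Then th2(t) = 2 exp(pi i t/4) Psi(t) and
    calF(t) = th3(2t) th3(6t) + th2(2t) th2(6t), so that the form is
    2^-k prod_i calF(a_i t) prod_j th2(c_j t). The weight one forms th2(t)^2,
    th2(t) th2(2t), th2(t) th2(3t) and calF(t) transform under Gamma0(2), Gamma0(4),
    Gamma0(6), Gamma0(3) with explicit multipliers: by theta inversion this only has to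
    be checked on generators. Since theta constants vanish nowhere on the upper
    half-plane, dividing these laws expresses th2(c_j g t) / th2(c_j t) through
    th2(g t) / th2(t). As k is even only the square of the latter occurs, and 8 | h
    cancels the dependence on the upper right entry of g; the remaining function of
    d is identified with the Kronecker symbol by the values of (-1/p), (2/p), (-3/p).
    At the cusps, for every g in SL2(Z) all factors are, up to one common s(t) with
    s(t)^2 = const * (ct + d), combinations of theta series with rational
    characteristics, hence power series in a root of q. *)

(** * Absolutely summable families of complex numbers *)

(** A law for a single theta constant would involve a branch of sqrt(ct + d) and an eighth root of
    unity, so laws are proved only for products of two, and half-integral weight never appears. The
    pairs of scales are (1,1), (1,2), (1,3), then (2,4) and (2,6), rescalings of the two preceding
    ones; each pair reaches a new scale from one already known. The descent on generators covers the
    levels 2, 3 and 4. Level 6 is obtained differently, from 3 th2(2t) th2(6t) = 2 (calF(t) -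
    calF(4t)), which expresses the symmetry of the hexagonal form modulo 2. Theta inversion rests on
    Poisson summation, proved without integrals: Fourier inversion over Z/N on the mesh 1/N is
    exact, and Riemann sums on that mesh are compared by telescoping finite differences with errors
    uniform in N. Hence the many explicit Gaussian bounds with a free step size. *)

Section Modulus.
Context {R : realType}.
Local Notation C := R[i].
Implicit Types (x y z : C).

(* The modulus as a real number: MathComp's [`|z|] lies in [R[i]]. *)
Definition cm z : R := ComplexField.Normc.normc z.
Arguments cm : simpl never.

Lemma cmE z : `|z| = (cm z)%:C%C.
Proof. by case: z. Qed.

Lemma cm_def z : cm z = Num.sqrt (complex.Re z ^+ 2 + complex.Im z ^+ 2).
Proof. by case: z. Qed.

Lemma cm_ge0 z : 0 <= cm z.
Proof. by rewrite cm_def sqrtr_ge0. Qed.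

Lemma cm0 : cm 0 = 0. Proof. exact: ComplexField.Normc.normc0. Qed.
Lemma cm1 : cm 1 = 1. Proof. exact: ComplexField.Normc.normc1. Qed.

Lemma cm_eq0 z : (cm z == 0) = (z == 0).
Proof.
apply/eqP/eqP => [/ComplexField.Normc.eq0_normc //|->]; exact: cm0.
Qed.

Lemma cmM x y : cm (x * y) = cm x * cm y.
Proof. exact: ComplexField.Normc.normcM. Qed.

Lemma cmV x : cm x^-1 = (cm x)^-1.
Proof. exact: ComplexField.Normc.normcV. Qed.

Lemma cmN x : cm (- x) = cm x.
Proof. by case: x => a b; rewrite /cm /= !sqrrN. Qed.

Lemma cmD x y : cm (x + y) <= cm x + cm y.
Proof. by have := ler_normD x y; rewrite !cmE -rmorphD /= lecR. Qed.

Lemma cmB x y : cm (x - y) <= cm x + cm y.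
Proof. by rewrite -(cmN y) cmD. Qed.

Lemma cm_real (a : R) : cm a%:C%C = `|a|.
Proof. by rewrite cm_def /= expr0n addr0 sqrtr_sqr. Qed.

Lemma cm_nat n : cm n%:R = n%:R.
Proof. by have := cm_real n%:R; rewrite rmorph_nat normr_nat. Qed.

Lemma cmX z n : cm (z ^+ n) = cm z ^+ n.
Proof. by elim: n => [|n IH]; rewrite ?expr0 ?cm1 // !exprS cmM IH. Qed.

Lemma cm_Re z : `|complex.Re z| <= cm z.
Proof. by rewrite cm_def -sqrtr_sqr ler_sqrt ?addr_ge0 ?sqr_ge0 // lerDl sqr_ge0. Qed.

Lemma cm_Im z : `|complex.Im z| <= cm z.
Proof. by rewrite cm_def -sqrtr_sqr ler_sqrt ?addr_ge0 ?sqr_ge0 // lerDr sqr_ge0. Qed.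

Lemma cm_ReIm z : cm z <= `|complex.Re z| + `|complex.Im z|.
Proof.
case: z => a b; have -> : Complex a b = a%:C%C + Complex 0 b.
  by apply/eqP; rewrite eq_complex /= addr0 add0r !eqxx.
apply: (le_trans (cmD _ _)) => /=; rewrite !cm_def /= addr0 add0r.
by rewrite expr0n /= addr0 add0r !sqrtr_sqr.
Qed.

Lemma cm_sum (I : Type) (r : seq I) (P : pred I) (f : I -> C) :
  cm (\sum_(i <- r | P i) f i) <= \sum_(i <- r | P i) cm (f i).
Proof.
elim/big_rec2: _ => [|i u v _ h]; first by rewrite cm0.
by rewrite (le_trans (cmD _ _)) // lerD2l.
Qed.

End Modulus.

Section Sums.
Context {R : realType} {I : choiceType}.
Local Notation C := R[i].
Implicit Types (f g : I -> C) (h k : I -> R) (A B : {fset I}).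

(** Meant for nonnegative [h], where bounded finite partial sums amount to summability. *)
Definition bsum_by h (M : R) := forall A, \sum_(i <- A) h i <= M.
Definition bsum h := exists M, bsum_by h M.
Definition asum f := bsum (fun i => cm (f i)).

Definition hasum f (s : C) := forall e : R, 0 < e ->
  exists A, forall B, (A `<=` B)%fset -> cm (s - \sum_(i <- B) f i) < e.

(* Junk value 0 when [f] is not summable. *)
Definition csum f : C := xget 0 [set s | hasum f s]%classic.

Lemma hasum_uniq f s t : hasum f s -> hasum f t -> s = t.
Proof.
move=> hs ht; apply/eqP; rewrite -subr_eq0 -cm_eq0; apply/negPn/negP => n0.
have e0 : 0 < cm (s - t) / 2 by rewrite divr_gt0 // lt_def n0 cm_ge0.
have [A hA] := hs _ e0; have [B hB] := ht _ e0.
have h1 := hA _ (fsubsetUl A B); have h2 := hB _ (fsubsetUr A B).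
set S := \sum_(i <- _) _ in h1 h2.
have : cm (s - t) <= cm (s - S) + cm (t - S).
  have -> : s - t = (s - S) - (t - S) by ring.
  exact: cmB.
lra.
Qed.

Lemma csumE f s : hasum f s -> csum f = s.
Proof. move=> h; apply: (hasum_uniq _ h); exact: (@xgetPex _ 0 [set s | hasum f s]%classic) (ex_intro _ s h). Qed.

Lemma hasumD f g s t : hasum f s -> hasum g t -> hasum (fun i => f i + g i) (s + t).
Proof.
move=> hs ht e e0; have e2 : 0 < e / 2 by rewrite divr_gt0.
have [A hA] := hs _ e2; have [B hB] := ht _ e2.
exists (A `|` B)%fset => D; rewrite fsubUset => /andP[/hA h1 /hB h2].
rewrite big_split /=; set S := \sum_(i <- _) _ in h1 *; set T := \sum_(i <- _) _ in h2 *.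
have -> : s + t - (S + T) = (s - S) + (t - T) by ring.
by apply: le_lt_trans (cmD _ _) _; lra.
Qed.

Lemma hasumZ c f s : hasum f s -> hasum (fun i => c * f i) (c * s).
Proof.
move=> hs e e0; have c1 : 0 < cm c + 1 by rewrite ltr_wpDl ?cm_ge0.
have [A hA] := hs _ (divr_gt0 e0 c1); exists A => B /hA h.
rewrite -mulr_sumr -mulrBr cmM; move: h; rewrite ltr_pdivlMr // => h.
apply: le_lt_trans h; rewrite mulrC ler_wpM2l ?cm_ge0 //; lra.
Qed.

(** The sum is the supremum of the finite partial sums; enlarging a nearly optimal finite set only
    moves closer to it. *)
Lemma hasum_real h : (forall i, 0 <= h i) -> bsum h ->
  exists s, hasum (fun i => (h i)%:C%C) s.
Proof.
move=> h0 [M hM]; pose E := [set \sum_(i <- A) h i | A in [set: {fset I}]]%classic.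
have supE : has_sup E.
  split; first by exists (\sum_(i <- fset0%fset) h i); exists fset0%fset.
  by exists M => _ [A _ <-]; exact: hM.
exists (sup E)%:C%C => e e0.
have [_ [A _ <-] hA] := sup_adherent e0 supE.
exists A => B AB; rewrite -rmorph_sum -rmorphB cm_real.
have hB : \sum_(i <- B) h i <= sup E.
  by apply: sup_upper_bound => //; exists B.
have hAB : \sum_(i <- A) h i <= \sum_(i <- B) h i.
  rewrite (big_fsetID _ (mem A) B) /=.
  have -> : [fset x in B | x \in A]%fset = A.
    by apply/fsetP => x; rewrite !inE /= andbC; case: (boolP (x \in A)) => // /(fsubsetP AB) ->.
  by rewrite lerDl; apply: sumr_ge0.
by rewrite ger0_norm ?subr_ge0 //; lra.
Qed.

Lemma bsum_le h k : (forall i, h i <= k i) -> bsum k -> bsum h.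
Proof.
by move=> hk [M hM]; exists M => A; apply: le_trans (hM A); apply: ler_sum => i _.
Qed.

Lemma bsumD h k : bsum h -> bsum k -> bsum (fun i => h i + k i).
Proof.
move=> [M hM] [N hN]; exists (M + N) => A; rewrite big_split /=; exact: lerD.
Qed.

Lemma bsumZ (c : R) h : 0 <= c -> bsum h -> bsum (fun i => c * h i).
Proof.
by move=> c0 [M hM]; exists (c * M) => A; rewrite -mulr_sumr ler_wpM2l.
Qed.

Lemma asum_le f h : (forall i, cm (f i) <= h i) -> bsum h -> asum f.
Proof. exact: bsum_le. Qed.

Lemma asumD f g : asum f -> asum g -> asum (fun i => f i + g i).
Proof. by move=> hf hg; apply: (asum_le _ (bsumD hf hg)) => i; exact: cmD. Qed.

Lemma asumZ c f : asum f -> asum (fun i => c * f i).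
Proof. by move=> hf; apply: (asum_le _ (bsumZ (cm_ge0 c) hf)) => i; rewrite cmM. Qed.

(** Real and imaginary parts are split as [(|p| + p) / 2] minus [(|p| - p) / 2], two nonnegative
    families dominated by the moduli, which reduces to the real case. *)
Lemma asum_hasum f : asum f -> hasum f (csum f).
Proof.
move=> hf; suff [s hs] : exists s, hasum f s by rewrite (csumE hs).
have pos (p : I -> R) : (forall i, `|p i| <= cm (f i)) -> exists s, hasum (fun i => (p i)%:C%C) s.
  move=> pf.
  have [||s hs] := @hasum_real (fun i => (`|p i| + p i) / 2).
  - by move=> i; have := ler_norm (- p i); rewrite normrN; lra.
  - by apply: bsum_le hf => i; apply: le_trans (pf i); have := ler_norm (p i); lra.
  have [||t ht] := @hasum_real (fun i => (`|p i| - p i) / 2).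
  - by move=> i; have := ler_norm (p i); lra.
  - by apply: bsum_le hf => i; apply: le_trans (pf i); have := ler_norm (- p i); rewrite normrN; lra.
  exists (s + (-1) * t).
  have := hasumD hs (hasumZ (-1) ht); congr (hasum _ _); apply/funext => i.
  by rewrite mulN1r -rmorphB /=; congr (_%:C%C); lra.
have [s hs] := pos _ (fun i => cm_Re (f i)).
have [t ht] := pos _ (fun i => cm_Im (f i)).
exists (s + Complex 0 1 * t); have := hasumD hs (hasumZ (Complex 0 1) ht).
congr (hasum _ _); apply/funext => i; exact/esym/complexE.
Qed.

Lemma csumD f g : asum f -> asum g -> csum (fun i => f i + g i) = csum f + csum g.
Proof. by move=> hf hg; apply/csumE/hasumD; exact: asum_hasum. Qed.

Lemma csumZ c f : asum f -> csum (fun i => c * f i) = c * csum f.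
Proof. by move=> hf; apply/csumE/hasumZ; exact: asum_hasum. Qed.

Lemma csumB f g : asum f -> asum g -> csum (fun i => f i - g i) = csum f - csum g.
Proof.
move=> hf hg; rewrite -mulN1r -csumZ // -csumD //; last exact: asumZ.
by congr csum; apply/funext => i; rewrite mulN1r.
Qed.

Lemma asumB f g : asum f -> asum g -> asum (fun i => f i - g i).
Proof.
move=> hf hg; have := asumD hf (asumZ (-1) hg).
by congr asum; apply/funext => i; rewrite mulN1r.
Qed.

Lemma csum_norm f M : bsum_by (fun i => cm (f i)) M -> cm (csum f) <= M.
Proof.
move=> hM; apply/ler_addgt0Pr => e e0.
have [A /(_ A (fsubset_refl A)) hA] := asum_hasum (ex_intro _ M hM) e0.
have -> : csum f = (csum f - \sum_(i <- A) f i) + \sum_(i <- A) f i by ring.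
apply: le_trans (cmD _ _) _; have := cm_sum (enum_fset A) predT f.
have := hM A; lra.
Qed.

Lemma hasum_fin f A : (forall i, i \notin A -> f i = 0) -> hasum f (\sum_(i <- A) f i).
Proof.
move=> f0 e e0; exists A => B AB; rewrite (big_fsetID _ (mem A) B) /=.
have -> : [fset x in B | x \in A]%fset = A.
  by apply/fsetP => x; rewrite !inE /= andbC; case: (boolP (x \in A)) => // /(fsubsetP AB) ->.
rewrite [X in _ - (_ + X)]big1_fset ?addr0 ?subrr ?cm0 // => i.
by rewrite !inE /= => /andP[_ /f0].
Qed.

(** Take [A] with partial sum within [e] of the supremum: a disjoint [B] adding more than [e] would
    exceed it. *)
Lemma bsum_tail h : (forall i, 0 <= h i) -> bsum h -> forall e : R, 0 < e ->
  exists A, forall B, (forall i, i \in B -> i \notin A) -> \sum_(i <- B) h i <= e.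
Proof.
move=> h0 [M hM] e e0; pose E := [set \sum_(i <- A) h i | A in [set: {fset I}]]%classic.
have supE : has_sup E.
  split; first by exists (\sum_(i <- fset0%fset) h i); exists fset0%fset.
  by exists M => _ [A _ <-]; exact: hM.
have [_ [A _ <-] hA] := sup_adherent e0 supE.
exists A => B AB.
have hB : \sum_(i <- (A `|` B)%fset) h i <= sup E.
  by apply: sup_upper_bound => //; exists (A `|` B)%fset.
rewrite (big_fsetID _ (mem A) _) /= in hB.
have e1 : [fset x in (A `|` B)%fset | x \in A]%fset = A.
  by apply/fsetP => x; rewrite !inE /=; case: (x \in A); rewrite ?andbF.
have e2 : [fset x in (A `|` B)%fset | x \notin A]%fset = B.
  apply/fsetP => x; rewrite !inE /=; case: (boolP (x \in A)) => xA /=; rewrite ?andbT ?andbF //.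
  by apply/esym/negP => /AB; rewrite xA.
rewrite e1 e2 in hB; lra.
Qed.

Lemma asum_fin f A : (forall i, i \notin A -> f i = 0) -> asum f.
Proof.
move=> f0; exists (\sum_(i <- A) cm (f i)) => B.
rewrite (big_fsetID _ (mem A) B) /= [X in _ + X]big1_fset ?addr0; last first.
  by move=> i; rewrite !inE /= => /andP[_ /f0 ->]; rewrite cm0.
rewrite [leRHS](big_fsetID _ (mem B) A) /=.
have -> : [fset x in A | x \in B]%fset = [fset x in B | x \in A]%fset.
  by apply/fsetP => x; rewrite !inE /= andbC.
by rewrite lerDl; apply: sumr_ge0 => i _; exact: cm_ge0.
Qed.

Lemma csum_fin f A : (forall i, i \notin A -> f i = 0) -> csum f = \sum_(i <- A) f i.
Proof. by move=> f0; apply/csumE/hasum_fin. Qed.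

Lemma asum0 : asum (fun _ => 0).
Proof. by exists 0 => A; rewrite big1 // => i _; rewrite cm0. Qed.

Lemma csum0 : csum (fun _ => 0) = 0.
Proof. by rewrite (@csum_fin _ fset0%fset) ?big_seq_fset0 //= big_nil. Qed.

End Sums.

Section Tails.
Context {R : realType} {I : choiceType}.
Local Notation C := R[i].
Implicit Types (f g : I -> C) (h : I -> R) (A B : {fset I}).

Lemma csum_tail f h (A : {fset I}) (e : R) :
  (forall i, i \in A -> f i = 0) -> (forall i, cm (f i) <= h i) ->
  (forall B : {fset I}, (forall i, i \in B -> i \notin A) -> \sum_(i <- B) h i <= e) ->
  cm (csum f) <= e.
Proof.
move=> f0 fh hA; apply: csum_norm => B; rewrite (big_fsetID _ (mem A) B) /=.
rewrite [X in X + _]big1_fset ?add0r => [|i]; last first.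
  by rewrite !inE /= => /andP[_ /f0 ->]; rewrite cm0.
apply: (@le_trans _ _ (\sum_(i <- [fset x in B | x \notin A]%fset) h i)); first exact: ler_sum.
by apply: hA => i; rewrite !inE /= => /andP[].
Qed.

(** Dominated convergence for sums. Off a finite set the tail of [h] bounds all [f n] at once; on it
    finitely many terms tend to 0. *)
Lemma tannery (f : nat -> I -> C) h :
  bsum h -> (forall n i, cm (f n i) <= h i) ->
  (forall i (e : R), 0 < e -> exists N, forall n, (N <= n)%N -> cm (f n i) <= e) ->
  forall e : R, 0 < e -> exists N, forall n, (N <= n)%N -> cm (csum (f n)) <= e.
Proof.
move=> hb fh f0 e e0; have e2 : 0 < e / 2 by rewrite divr_gt0.
have h0 i : 0 <= h i by apply: le_trans (fh 0%N i); exact: cm_ge0.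
have [A hA] := bsum_tail h0 hb e2.
have hs n : asum (f n) by exact: asum_le hb.
have [N hN] : exists N, forall n, (N <= n)%N -> cm (\sum_(i <- A) f n i) <= e / 2.
  (* The successor keeps the denominator positive when [A] is empty. *)
  pose d := e / 2 / (size (enum_fset A)).+1%:R.
  have d0 : 0 < d by rewrite divr_gt0.
  have [N hN] : exists N, forall n i, (N <= n)%N -> i \in enum_fset A -> cm (f n i) <= d.
    elim: (enum_fset A) => [|i r [N hN]]; first by exists 0%N.
    have [N' hN'] := f0 i _ d0; exists (maxn N N') => n j.
    rewrite geq_max => /andP[n1 n2]; rewrite inE => /orP[/eqP ->|jr]; first exact: hN'.
    exact: hN.
  exists N => n Nn; apply: le_trans (cm_sum _ _ _) _.
  apply: (@le_trans _ _ (\sum_(i <- enum_fset A) d)).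
    by rewrite big_seq [leRHS]big_seq; apply: ler_sum => i iA; exact: hN.
  rewrite big_const_seq count_predT iter_addr_0 -mulr_natr.
  have : d * (size (enum_fset A)).+1%:R = e / 2 by rewrite mulfVK // pnatr_eq0.
  rewrite -natr1 mulrDr mulr1; lra.
exists N => n Nn.
have ha : asum (fun i => if i \in A then f n i else 0).
  by apply: (@asum_fin _ _ _ A) => i /negbTE ->.
have -> : csum (f n) = csum (fun i => if i \in A then f n i else 0) +
    csum (fun i => if i \in A then 0 else f n i).
  rewrite -csumD //; first by congr csum; apply/funext => i; case: ifP; rewrite ?addr0 ?add0r.
  by apply: (asum_le _ (hs n)) => i; case: ifP => // _; rewrite cm0 cm_ge0.
apply: le_trans (cmD _ _) _.
have h1 : cm (csum (fun i => if i \in A then f n i else 0)) <= e / 2.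
  rewrite (@csum_fin _ _ _ A) => [|i /negbTE -> //].
  rewrite (_ : \sum_(i <- A) _ = \sum_(i <- A) f n i) ?hN //.
  by apply: eq_big_seq => i ->.
have h2 : cm (csum (fun i => if i \in A then 0 else f n i)) <= e / 2.
  apply: (@csum_tail _ h A _ _ _ hA) => [i ->|i] //.
  by case: ifP => _ //; rewrite cm0.
lra.
Qed.

End Tails.

(** * Regrouping a sum along the fibres of a map *)

Section Fibres.
Context {R : realType}.
Local Notation C := R[i].

Lemma asum_sum (I : choiceType) (J : Type) (r : seq J) (g : J -> I -> C) :
  (forall j, asum (g j)) -> asum (fun i => \sum_(j <- r) g j i).
Proof.
move=> hg; elim: r => [|j r IH].
  by under [X in asum X]funext do rewrite big_nil; exact: asum0.
by under [X in asum X]funext do rewrite big_cons; exact: asumD.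
Qed.

Lemma csum_sum (I : choiceType) (J : Type) (r : seq J) (g : J -> I -> C) :
  (forall j, asum (g j)) ->
  csum (fun i => \sum_(j <- r) g j i) = \sum_(j <- r) csum (g j).
Proof.
move=> hg; elim: r => [|j r IH].
  by under [X in csum X]funext do rewrite big_nil; rewrite big_nil csum0.
under [X in csum X]funext do rewrite big_cons.
by rewrite csumD ?IH ?big_cons //; exact: asum_sum.
Qed.

Variables (I J : choiceType) (e : I -> J) (f : I -> C).
Hypothesis hf : asum f.
Let F j := csum (fun i => if e i == j then f i else 0).

Let hF j (c : J -> C) : asum (fun i => if e i == j then c j * f i else 0).
Proof.
apply: (asum_le _ (asumZ (c j) hf)) => i.
by case: ifP => // _; rewrite cm0 cm_ge0.
Qed.

Let F_comb (B : {fset J}) (c : J -> C) :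
  \sum_(j <- B) c j * F j = csum (fun i => if e i \in B then c (e i) * f i else 0).
Proof.
transitivity (\sum_(j <- B) csum (fun i => if e i == j then c j * f i else 0)).
  apply: eq_bigr => j _; rewrite -csumZ.
    by congr csum; apply/funext => i; case: ifP; rewrite ?mulr0.
  have := hF j (fun=> 1); congr asum; apply/funext => i; by rewrite mul1r.
rewrite -csum_sum; last by move=> j; exact: hF.
congr csum; apply/funext => i; case: ifP => [iB|iB].
  rewrite (big_fsetD1 (e i)) //= eqxx big1_fset ?addr0 // => j.
  by rewrite !inE eq_sym => /andP[/negbTE ->].
rewrite big1_fset // => j jB _; case: eqP => // E; by rewrite E jB in iB.
Qed.

(** Rotating each [F j] to its modulus turns a finite sum of moduli into a single sum of [f] with
    weights of modulus at most 1. *)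
Lemma asum_fibre : asum F.
Proof.
have [M hM] := hf; exists M => B.
pose u j := (cm (F j))%:C%C / F j.
have u1 j : cm (u j) <= 1.
  rewrite cmM cmV cm_real ger0_norm ?cm_ge0 //.
  by have [->|n0] := eqVneq (cm (F j)) 0; rewrite ?mul0r // divff.
have uF j : u j * F j = (cm (F j))%:C%C.
  have [->|n0] := eqVneq (F j) 0; first by rewrite cm0 mulr0.
  by rewrite /u mulfVK.
have : cm (csum (fun i => if e i \in B then u (e i) * f i else 0)) <= M.
  apply: csum_norm => A; apply: le_trans (hM A); apply: ler_sum => i _.
  case: ifP => _; last by rewrite cm0 cm_ge0.
  by rewrite cmM ler_piMl ?cm_ge0.
rewrite -F_comb; under eq_bigr do rewrite uF.
by rewrite -rmorph_sum cm_real; apply: le_trans; exact: ler_norm.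
Qed.

(** Once [B] contains the images of a finite set [A] carrying nearly all of [f], the missing fibres
    only involve indices outside [A]. *)
Lemma csum_fibre : csum F = csum f.
Proof.
apply: csumE => d d0; have d2 : 0 < d / 2 by rewrite divr_gt0.
have [A hA] := bsum_tail (fun i => cm_ge0 (f i)) hf d2.
exists [fset e i | i in A]%fset => B AB.
have -> : \sum_(j <- B) F j = csum (fun i => if e i \in B then f i else 0).
  have := F_comb B (fun=> 1); under eq_bigr do rewrite mul1r.
  by move=> ->; congr csum; apply/funext => i; rewrite mul1r.
rewrite -csumB //; last first.
  by apply: (asum_le _ hf) => i; case: ifP; rewrite // cm0 cm_ge0.
apply: (@le_lt_trans _ _ (d / 2)); last by lra.
apply: (@csum_tail _ _ _ (fun i => cm (f i)) A) => // i.
  move=> iA; rewrite ifT ?subrr //; apply: (fsubsetP AB); apply/imfsetP.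
  by exists i.
by case: ifP => _; rewrite ?subr0 // subrr cm0 cm_ge0.
Qed.

End Fibres.

(** * Reindexing and products of sums *)

Section Reindex.
Context {R : realType}.
Local Notation C := R[i].

Lemma csum_delta (I : choiceType) (i0 : I) (f : I -> C) :
  csum (fun i => if i == i0 then f i else 0) = f i0.
Proof.
rewrite (@csum_fin _ _ _ [fset i0]%fset) ?big_seq_fset1 ?eqxx // => i.
by rewrite inE => /negbTE ->.
Qed.

Lemma bsum_inj (I J : choiceType) (h : J -> I) (g : I -> R) :
  injective h -> bsum g -> bsum (fun j => g (h j)).
Proof.
move=> hi [M hM]; exists M => A.
apply: le_trans (hM [fset h j | j in A]%fset); rewrite big_imfset //=.
by move=> i j _ _; exact: hi.
Qed.

Lemma asum_inj (I J : choiceType) (h : J -> I) (f : I -> C) :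
  injective h -> asum f -> asum (fun j => f (h j)).
Proof. exact: bsum_inj. Qed.

(** Regrouping along [h]: its fibres have at most one element, and the empty ones lie where [f]
    vanishes. *)
Lemma csum_inj (I J : choiceType) (h : J -> I) (f : I -> C) :
  injective h -> asum f -> (forall i, (forall j, h j <> i) -> f i = 0) ->
  csum (fun j => f (h j)) = csum f.
Proof.
move=> hi hf f0; rewrite -(csum_fibre h (asum_inj hi hf)); congr csum; apply/funext => i.
have [[j hj]|nj] := pselect (exists j, h j = i).
  rewrite -hj -[RHS](csum_delta j (fun j => f (h j))); congr csum; apply/funext => j'.
  by rewrite (inj_eq hi).
rewrite f0 => [|j hj]; last by apply: nj; exists j.
rewrite -[RHS](@csum0 R J); congr csum; apply/funext => j; case: eqP => // hj.
by case: nj; exists j.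
Qed.

Lemma csum_bij (I J : choiceType) (h : J -> I) (h' : I -> J) (f : I -> C) :
  cancel h h' -> cancel h' h -> asum f -> csum (fun j => f (h j)) = csum f.
Proof. by move=> k1 k2 hf; apply: csum_inj (can_inj k1) hf _ => i /(_ (h' i)); rewrite k2. Qed.

Lemma bsum_prod (I J : choiceType) (g : I -> R) (h : J -> R) :
  (forall i, 0 <= g i) -> (forall j, 0 <= h j) ->
  bsum g -> bsum h -> bsum (fun p : I * J => g p.1 * h p.2).
Proof.
move=> g0 h0 [M hM] [N hN]; exists (M * N) => A.
pose A1 := [fset p.1 | p in A]%fset; pose A2 := [fset p.2 | p in A]%fset.
apply: (@le_trans _ _ (\sum_(p <- (A1 `*` A2)%fset) g p.1 * h p.2)).
  have sub : (A `<=` A1 `*` A2)%fset.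
    apply/fsubsetP => p pA; rewrite in_fsetM; apply/andP; split; apply/imfsetP; by exists p.
  rewrite [leRHS](big_fsetID _ (mem A)) /=.
  have -> : [fset x in (A1 `*` A2)%fset | x \in A]%fset = A.
    by apply/fsetP => x; rewrite !inE /= andbC; case: (boolP (x \in A)) => // /(fsubsetP sub); rewrite in_fsetM.
  by rewrite lerDl; apply: sumr_ge0 => p _; rewrite mulr_ge0.
have -> : \sum_(p <- (A1 `*` A2)%fset) g p.1 * h p.2 = (\sum_(i <- A1) g i) * (\sum_(j <- A2) h j).
  rewrite big_distrlr /= pair_big_dep_cond /=.
  congr (\sum_(p <- enum_fset _) _); apply/fsetP => -[i j]; rewrite in_fsetM /=.
  apply/andP/imfset2P => [[iA jA]|[i' + [j' + [-> ->]]]].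
    by exists i; rewrite ?inE ?iA //; exists j; rewrite ?inE ?jA.
  by rewrite !inE !andbT.
by apply: ler_pM; rewrite ?sumr_ge0.
Qed.

Lemma asum_prod (I J : choiceType) (f : I -> C) (g : J -> C) :
  asum f -> asum g -> asum (fun p : I * J => f p.1 * g p.2).
Proof.
move=> hf hg; apply: (asum_le _ (bsum_prod _ _ hf hg)) => [p|i|j]; rewrite ?cm_ge0 //.
by rewrite cmM.
Qed.

(** Fubini as regrouping along the first projection. *)
Lemma csum_prod (I J : choiceType) (f : I -> C) (g : J -> C) :
  asum f -> asum g -> csum (fun p : I * J => f p.1 * g p.2) = csum f * csum g.
Proof.
move=> hf hg; rewrite -(csum_fibre fst (asum_prod hf hg)) mulrC -csumZ //.
congr csum; apply/funext => i; rewrite mulrC -csumZ //.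
rewrite -(@csum_inj _ _ (pair i)) /=.
- by congr csum; apply/funext => j; rewrite eqxx.
- by move=> j j' [].
- apply: (asum_le _ (asum_prod hf hg)) => p.
  by case: ifP; rewrite // cm0 cm_ge0.
- move=> [i' j] h; case: eqP => //= E; by case: (h j); rewrite E.
Qed.

End Reindex.

(** * Comparison with limits, series and derivatives over the complex numbers *)

Section Bridge.
Context {R : realType}.
Local Notation C := R[i].

(** The norm on [R[i]] is complex valued, and a positive element of [R[i]] is a positive real, so
    real [e] suffice. *)
Lemma cm_cvg (T : Type) (F : set_system T) (FF : Filter F) (f : T -> C) (l : C) :
  (forall e : R, 0 < e -> \forall x \near F, cm (l - f x) < e) ->
  ((f x : C^o) @[x --> F] --> (l : C^o)).
Proof.
move=> h; apply/cvgrPdist_lt => -[e e'] e0.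
have [e'0 {}e0] : e' = 0 /\ 0 < e.
  by move: e0; rewrite ltcE /= => /andP[/eqP].
apply: filterS (h e e0) => x; rewrite e'0 => hx.
by have := cmE (l - f x); rewrite /= => ->; rewrite complexr0 ltcR.
Qed.

Lemma summability_sumE (I : choiceType) (f : I -> C) : asum f ->
  summability.sum (f : I -> C^o) = csum f.
Proof.
move=> hf; apply: (@cvg_lim C^o) => //; first exact: summability.totally_filter.
apply: (@cm_cvg _ _ (@filter_filter _ _ summability.totally_filter)) => e e0.
 have [A hA] := asum_hasum hf e0.
exists A => // B /= /hA; rewrite /summability.partial_sum.
by rewrite (big_seq_fsetE _ B predT f).
Qed.

Lemma series_csum (f : nat -> C) : asum f ->
  (series (fun n => f n : C^o) n @[n --> \oo] --> (csum f : C^o)).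
Proof.
move=> hf; apply: cm_cvg => e e0; have [A hA] := asum_hasum hf e0.
pose N := (\max_(i <- enum_fset A) i.+1)%N; exists N => // n /= Nn.
pose B := [fset i | i in iota 0 n]%fset.
have AB : (A `<=` B)%fset.
  apply/fsubsetP => i iA; apply/imfsetP; exists i => //=.
  rewrite mem_iota /= add0n; apply: leq_trans Nn.
  by rewrite /N (big_rem i iA) /= leq_max leqnn.
rewrite /series /=; have := hA _ AB.
rewrite big_imfset /=; last by move=> ? ? _ _.
by rewrite /index_iota subn0 undup_id // iota_uniq.
Qed.

(** A quadratic error in the first-order expansion bounds the difference quotient minus [d] by
    [K * cm h]. *)
Lemma derivable_cm (f : C -> C) (t d : C) (K r : R) : 0 < r ->
  (forall h, cm h < r -> cm (f (t + h) - f t - d * h) <= K * cm h ^+ 2) ->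
  derivable (f : C^o -> C^o) t 1.
Proof.
move=> r0 hK; apply: (cvgP (d : C^o)); apply: cm_cvg => e e0.
(* Below this radius [K * cm h < e]; the [+ 1] covers [K = 0]. *)
pose s := Num.min r (e / (`|K| + 1)).
have s0 : 0 < s.
  by rewrite lt_min r0 /= divr_gt0 // ltr_wpDl.
have sC : 0 < (s%:C%C : C) by rewrite ltcR.
near=> h.
have hn0 : h != 0 by near: h; exact: nbhs_dnbhs_neq.
have hs : cm h < s.
  have : `|h : C^o| < s%:C%C by near: h; exact: (@dnbhs0_lt C C^o).
  by have := cmE h; rewrite /= => ->; rewrite ltcR.
have hr : cm h < r by apply: lt_le_trans hs _; rewrite ge_min lexx.
have h2 : cm h < e / (`|K| + 1) by apply: lt_le_trans hs _; rewrite ge_min lexx orbT.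
have cm_gt0 : 0 < cm h by rewrite lt_def cm_eq0 hn0 cm_ge0.
have -> : d - h^-1 *: ((f \o shift t) (h *: (1 : C^o)) - f t) =
    - (h^-1 * (f (t + h) - f t - d * h)).
  rewrite /= /GRing.scale /= mulr1 (addrC h t); field.
  by rewrite hn0.
rewrite cmN cmM cmV mulrC ltr_pdivrMr //.
apply: le_lt_trans (hK _ hr) _; rewrite expr2 mulrA ltr_pM2r //.
move: h2; rewrite ltr_pdivlMr ?ltr_wpDl // => h2.
apply: le_lt_trans h2; rewrite mulrC ler_wpM2l ?ltW //.
by apply: le_lt_trans (ler_norm K) _; rewrite ltrDl.
Unshelve. all: by end_near.
Qed.

End Bridge.

(** * The complex exponential and Gaussians *)

Section ComplexExp.
Context {R : realType}.
Local Notation C := R[i].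
Implicit Types (x y z w : C).

Lemma complexP x y : complex.Re x = complex.Re y -> complex.Im x = complex.Im y -> x = y.
Proof. by case: x y => [a b] [c d] /= -> ->. Qed.

Lemma ReD x y : complex.Re (x + y) = complex.Re x + complex.Re y.
Proof. by case: x y => [a b] [c d]. Qed.
Lemma ImD x y : complex.Im (x + y) = complex.Im x + complex.Im y.
Proof. by case: x y => [a b] [c d]. Qed.
Lemma ReN x : complex.Re (- x) = - complex.Re x.
Proof. by case: x => [a b]. Qed.
Lemma ImN x : complex.Im (- x) = - complex.Im x.
Proof. by case: x => [a b]. Qed.
Lemma ReM x y : complex.Re (x * y) = complex.Re x * complex.Re y - complex.Im x * complex.Im y.
Proof. by case: x y => [a b] [c d]. Qed.
Lemma ImM x y : complex.Im (x * y) = complex.Re x * complex.Im y + complex.Im x * complex.Re y.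
Proof. by case: x y => [a b] [c d]. Qed.

Lemma cexpD z w : cexp (z + w) = cexp z * cexp w.
Proof.
apply: complexP; rewrite /cexp ?ReM ?ImM /= ReD ImD expRD ?cosD ?sinD; ring.
Qed.

Lemma cexp0 : cexp (0 : C) = 1.
Proof. by apply: complexP; rewrite /= expR0 ?cos0 ?sin0 mul1r. Qed.

Lemma cm_cexp z : cm (cexp z) = expR (complex.Re z).
Proof.
rewrite cm_def /= !exprMn -mulrDr cos2Dsin2 mulr1 sqrtr_sqr ger0_norm //.
Qed.

Lemma cexp_neq0 z : cexp z != 0.
Proof. by rewrite -cm_eq0 cm_cexp gt_eqF // expR_gt0. Qed.

Lemma cexpN z : cexp (- z) = (cexp z)^-1.
Proof.
by apply: (mulfI (cexp_neq0 z)); rewrite -cexpD subrr cexp0 divff ?cexp_neq0.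
Qed.

Lemma cexpMn n z : cexp (n%:R * z) = cexp z ^+ n.
Proof.
elim: n => [|n IH]; first by rewrite mul0r cexp0.
by rewrite -natr1 mulrDl mul1r cexpD IH exprSr.
Qed.

Lemma cexpMz (n : int) z : cexp (n%:~R * z) = cexp z ^ n.
Proof.
case: n => n; first exact: cexpMn.
by rewrite NegzE mulrNz mulNr cexpN cexpMn exprnN.
Qed.

Lemma cexp_real (a : R) : cexp (a%:C%C) = (expR a)%:C%C.
Proof. by apply: complexP; rewrite /= ?cos0 ?sin0 ?mulr1 ?mulr0. Qed.

Lemma sin_le_norm (y : R) : `|sin y| <= `|y|.
Proof.
wlog y0 : y / 0 <= y.
  move=> h; have [/h //|/ltW y0] := leP 0 y.
  by have := h (- y); rewrite sinN !normrN oppr_ge0; exact.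
have [|c _] := @MVT_segment R sin cos 0 y y0 (fun t _ => is_derive_sin t).
  exact/continuous_subspaceT/continuous_sin.
rewrite sin0 !subr0 => ->; rewrite normrM ler_piMl //.
by rewrite ler_norml cos_geN1 cos_le1.
Qed.

(** 1 - cos y = 2 sin(y/2)^2. *)
Lemma cos_near1 (y : R) : `|cos y - 1| <= y ^+ 2 / 2.
Proof.
have -> : cos y - 1 = - (sin (y / 2) ^+ 2 * 2).
  have := cos_mulr2n (y / 2); have -> : y / 2 *+ 2 = y by lra.
  move=> ->; have := cos2Dsin2 (y / 2); lra.
rewrite normrN normrM (ger0_norm (_ : 0 <= 2)) // normrX.
have h := sin_le_norm (y / 2); have h0 := normr_ge0 (sin (y / 2)).
have : `|sin (y / 2)| ^+ 2 <= `|y / 2| ^+ 2 by rewrite lerXn2r // nnegrE.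
rewrite -(normrX 2 (y / 2)) (ger0_norm (sqr_ge0 (y / 2))); lra.
Qed.

(** Mean value theorem for sin u - u, whose derivative is controlled by [cos_near1]. *)
Lemma sin_near (y : R) : `|sin y - y| <= `|y| * y ^+ 2 / 2.
Proof.
wlog y0 : y / 0 <= y.
  move=> h; have [/h //|/ltW y0] := leP 0 y.
  have := h (- y); rewrite sinN -opprD !normrN sqrrN oppr_ge0; exact.
have hd (t : R) : is_derive t 1 (fun u : R => sin u - u) (cos t - 1) by exact: is_deriveB.
have [|c] := @MVT_segment R (fun u => sin u - u) (fun u => cos u - 1) 0 y y0 (fun t _ => hd t).
  apply: continuous_subspaceT => x; apply: cvgB; [exact: continuous_sin|exact: cvg_id].
rewrite in_itv /= => /andP[c0 cy].
rewrite sin0 !subr0 => ->; rewrite normrM mulrC -mulrA ler_wpM2l //.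
apply: le_trans (cos_near1 c) _.
have : c ^+ 2 <= y ^+ 2 by rewrite lerXn2r // nnegrE.
lra.
Qed.

(** The lower bound is 1 + x <= e^x; the upper one is the same inequality at -x, in the form e^x (1
    - x) <= 1. *)
Lemma expR_near (x : R) : `|x| <= 2^-1 -> `|expR x - 1 - x| <= 2 * x ^+ 2.
Proof.
move=> hx; have := expR_ge1Dx x; have h2 := expR_ge1Dx (- x) => h1.
have [xl xu] : - 2^-1 <= x /\ x <= 2^-1 by move: hx; rewrite ler_norml => /andP.
have E : expR x * expR (- x) = 1 by rewrite -expRD subrr expR0.
rewrite ger0_norm; last by lra.
have : expR x * (1 - x) <= 1 by rewrite -[leRHS]E ler_wpM2l ?expR_ge0.
have := expR_ge0 x; nra.
Qed.

(** For |z| <= 1/2 this follows from the real expansions of exp, cos and sin; for larger z the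
    factor e^|z| swallows every term. The constant 8 is not optimised. *)
Lemma cexp_near z : cm (cexp z - 1 - z) <= 8 * cm z ^+ 2 * expR (cm z).
Proof.
have e0 := expR_gt0 (cm z); have z0 := cm_ge0 z.
have e1 := expR_ge1Dx (cm z).
have [zs|zl] := leP (cm z) 2^-1; last first.
  have h : cm (cexp z - 1 - z) <= expR (cm z) + 1 + cm z.
    apply: le_trans (cmB _ _) _; rewrite lerD2r.
    apply: le_trans (cmB _ _) _; rewrite cm1 lerD2r cm_cexp ler_expR.
    by apply: le_trans (cm_Re z); exact: ler_norm.
  have m2 : 2 <= 8 * cm z ^+ 2 by rewrite expr2; nra.
  apply: (@le_trans _ _ (2 * expR (cm z))); first lra.
  by rewrite ler_pM2r.
apply: (@le_trans _ _ (8 * cm z ^+ 2)); last by rewrite ler_peMr ?mulr_ge0 ?exprn_ge0 //; lra.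
have hx := le_trans (cm_Re z) zs; have hy := cm_Im z; have hx' := cm_Re z.
apply: le_trans (cm_ReIm _) _; rewrite !ReD !ImD !ReN !ImN /= oppr0 addr0.
set x := complex.Re z in hx hx' *; set y := complex.Im z in hy *.
set m := cm z in zs z0 hy hx' *.
have hE := expR_near hx; have hc := cos_near1 y; have hs := sin_near y.
have hs1 := sin_le_norm y.
have x2 : x ^+ 2 <= m ^+ 2 by rewrite -real_normK ?num_real // lerXn2r // nnegrE.
have y2 : y ^+ 2 <= m ^+ 2 by rewrite -real_normK ?num_real // lerXn2r // nnegrE.
have mm : m * m <= 2^-1 * m by rewrite ler_wpM2r.
have h1 : `|expR x * cos y - 1 - x| <= 2 * m ^+ 2 + m ^+ 2.
  have -> : expR x * cos y - 1 - x = (expR x - 1 - x) * cos y + (1 + x) * (cos y - 1) by ring.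
  apply: le_trans (ler_normD _ _) _; rewrite !normrM; apply: lerD.
    apply: (@le_trans _ _ (`|expR x - 1 - x|)); last by lra.
    by rewrite ler_piMr // ler_norml cos_geN1 cos_le1.
  have : `|1 + x| <= 2 by apply: le_trans (ler_normD _ _) _; rewrite normr1; lra.
  have := normr_ge0 (cos y - 1); have := normr_ge0 (1 + x); nra.
have h2 : `|expR x * sin y - y| <= 2 * m ^+ 2 + m ^+ 2.
  have -> : expR x * sin y - y = (expR x - 1 - x + x) * sin y + (sin y - y) by ring.
  apply: le_trans (ler_normD _ _) _; rewrite !normrM; apply: lerD.
    have hh : `|expR x - 1 - x + x| <= 2 * m.
      apply: le_trans (ler_normD _ _) _; nra.
    have := normr_ge0 (expR x - 1 - x + x); have := normr_ge0 (sin y); nra.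
  apply: le_trans hs _; have := normr_ge0 y; nra.
nra.
Qed.

End ComplexExp.

Ltac positivity := repeat first
  [ done | assumption | (apply: ltW; assumption) | exact: normr_ge0 | exact: cm_ge0
  | exact: expR_ge0 | exact: expR_gt0 | exact: pi_gt0 | exact: pi_ge0
  | apply: mulr_gt0 | apply: mulr_ge0 | apply: exprn_gt0 | apply: exprn_ge0
  | rewrite invr_gt0 | rewrite invr_ge0 | apply: addr_gt0 | apply: addr_ge0 ].

(** * Sums over the integers *)

Section IntSums.
Context {R : realType}.
Local Notation C := R[i].

Lemma sum_sub_seq (I : eqType) (h : I -> R) (s t : seq I) :
  (forall i, 0 <= h i) -> uniq s -> {subset s <= t} ->
  \sum_(i <- s) h i <= \sum_(i <- t) h i.
Proof.
move=> h0; elim: s t => [|x s IH] t; first by rewrite big_nil => _ _; exact: sumr_ge0.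
move=> /= /andP[xs us] st; rewrite big_cons [leRHS](big_rem x) /=; last by apply: st; rewrite mem_head.
rewrite lerD2l; apply: IH => // y ys.
have : y \in t by apply: st; rewrite inE ys orbT.
rewrite (perm_mem (perm_to_rem (st x (mem_head _ _)))) inE => /orP[/eqP E|//].
by rewrite -E ys in xs.
Qed.

Lemma bsum_by_int (h : int -> R) (B1 B2 : R) : (forall m, 0 <= h m) ->
  (forall M, \sum_(i < M) h (Posz i) <= B1) ->
  (forall M, \sum_(i < M) h (Negz i) <= B2) -> bsum_by h (B1 + B2).
Proof.
move=> h0 h1 h2 A; pose M := (\max_(i <- enum_fset A) (`|i|%N).+1)%N.
apply: (@le_trans _ _ (\sum_(i <- map Posz (iota 0 M) ++ map Negz (iota 0 M)) h i)).
  apply: sum_sub_seq => // i iA.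
  have : (`|i| < M)%N by rewrite /M (big_rem i iA) /= leq_max leqnn.
  rewrite mem_cat; case: i {iA} => n; rewrite /= => nM.
    by rewrite map_f // mem_iota.
  by rewrite [X in _ || X]map_f ?orbT // mem_iota /=; exact: ltnW.
rewrite big_cat !big_map -[M in iota 0 M]subn0 /= !big_mkord.
exact: lerD.
Qed.

(** Riemann weight of the integrable function (1 + |x|)^-2 on the mesh 1/N: its total mass is
    bounded independently of [N], which makes the later estimates uniform in the mesh. *)
Definition wt (N : R) (m : int) : R := N^-1 * (1 + `|m%:~R| / N) ^- 2.

Lemma wt_ge0 (N : R) m : 0 <= N -> 0 <= wt N m.
Proof. by move=> N0; rewrite mulr_ge0 ?invr_ge0 ?exprn_ge0 ?addr_ge0 ?divr_ge0. Qed.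

Lemma wt_sum (N : R) : 1 <= N -> bsum_by (wt N) 3.
Proof.
move=> N1; have N0 : 0 < N by lra.
(* Telescoping majorant: each term is at most N/(N + x) - N/(N + x + 1). *)
have tel M : \sum_(i < M) N^-1 * (1 + i.+1%:R / N) ^- 2 <= 1 - N / (N + M%:R).
  elim: M => [|M IH]; first by rewrite big_ord0 addr0 divff ?subrr // gt_eqF.
  rewrite big_ord_recr /=; apply: le_trans (lerD IH (lexx _)) _.
  have M0 : 0 <= M%:R :> R by [].
  set x : R := M%:R in M0 *; rewrite -natr1 -/x.
  have -> : N^-1 * (1 + (x + 1) / N) ^- 2 = N / (N + (x + 1)) ^+ 2.
    by field; rewrite !gt_eqF //; lra.
  have -> : N / (N + x) = N / (N + (x + 1)) + N / ((N + x) * (N + (x + 1))).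
    by field; rewrite !gt_eqF //; lra.
  have : N / (N + (x + 1)) ^+ 2 <= N / ((N + x) * (N + (x + 1))).
    rewrite ler_pM2l // lef_pV2 ?posrE ?exprn_gt0 ?mulr_gt0 //; try lra.
  lra.
have tel1 M : \sum_(i < M) N^-1 * (1 + i.+1%:R / N) ^- 2 <= 1.
  apply: le_trans (tel M) _; have : 0 <= N / (N + M%:R) by rewrite divr_ge0 ?addr_ge0 // ltW.
  lra.
(* The two half-lines contribute at most 1 each, and so does the term at 0. *)
have -> : 3 = 2 + 1 :> R by lra.
apply: bsum_by_int => [m|M|M].
- by apply: wt_ge0; lra.
- case: M => [|M]; first by rewrite big_ord0.
  rewrite big_ord_recl; have -> : 2 = 1 + 1 :> R by lra.
  apply: lerD.
    by rewrite /wt /= normr0 mul0r addr0 expr1n invr1 mulr1 invf_le1.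
  by apply: le_trans (tel1 M); apply: ler_sum => i _; rewrite /wt /= normr_nat.
- apply: le_trans (tel1 M); apply: ler_sum => i _.
  by rewrite /wt NegzE mulrNz normrN normr_nat.
Qed.

Lemma bsum_wt (N : R) : 1 <= N -> bsum (wt N).
Proof. by move=> N1; exists 3; exact: wt_sum. Qed.

Lemma csum_le_wt (f : int -> C) (c N : R) : 1 <= N -> 0 <= c ->
  (forall m, cm (f m) <= c * wt N m) -> asum f /\ cm (csum f) <= 3 * c.
Proof.
move=> N1 c0 hf; split; first by apply: (asum_le hf); apply: bsumZ => //; exact: bsum_wt.
apply: csum_norm => A; rewrite mulrC; apply: le_trans (ler_wpM2l c0 (wt_sum N1 A)).
by rewrite mulr_sumr; apply: ler_sum.
Qed.

Lemma csum_int (f : int -> C) : asum f ->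
  csum f = csum (fun n => f (Posz n)) + csum (fun n => f (Negz n)).
Proof.
move=> hf; pose P (m : int) := if m is Posz _ then true else false.
have h1 : asum (fun m => if P m then f m else 0).
  by apply: (asum_le _ hf) => m; case: ifP; rewrite // cm0 cm_ge0.
have h2 : asum (fun m => if P m then 0 else f m).
  by apply: (asum_le _ hf) => m; case: ifP; rewrite // cm0 cm_ge0.
have -> : csum f = csum (fun m => if P m then f m else 0) + csum (fun m => if P m then 0 else f m).
  by rewrite -csumD //; congr csum; apply/funext => m; case: ifP; rewrite ?addr0 ?add0r.
congr (_ + _); apply/esym.
  rewrite -(@csum_inj _ _ _ Posz (fun m => if P m then f m else 0)) //=.
    by move=> i j [].
  by case=> // n /(_ n).
rewrite -(@csum_inj _ _ _ Negz (fun m => if P m then 0 else f m)) //=.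
  by move=> i j [].
by case=> // n /(_ n).
Qed.

Lemma csum_shift (f : int -> C) (d : int) : asum f ->
  csum (fun m => f (m + d)) = csum f.
Proof.
by move=> hf; apply: (@csum_bij _ _ _ _ (fun m => m - d)) => // m; rewrite ?addrK ?subrK.
Qed.

Lemma asum_shift (f : int -> C) (d : int) : asum f -> asum (fun m => f (m + d)).
Proof. by apply: asum_inj; exact: addIr. Qed.

Lemma csum_ge (I : choiceType) (h : I -> R) (A : {fset I}) : (forall i, 0 <= h i) ->
  asum (fun i => (h i)%:C%C) -> \sum_(i <- A) h i <= complex.Re (csum (fun i => (h i)%:C%C)).
Proof.
move=> h0 hs; apply/ler_addgt0Pr => e e0; have [B hB] := asum_hasum hs e0.
have := hB _ (fsubsetUr A B); set D := (A `|` B)%fset.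
rewrite -rmorph_sum /= => /(le_lt_trans (cm_Re _)); rewrite ReD ReN /= ltr_norml => /andP[h1 _].
have : \sum_(i <- A) h i <= \sum_(i <- D) h i.
  by apply: sum_sub_seq => // i iA; rewrite /D in_fsetU iA.
lra.
Qed.

End IntSums.

(** * The Gaussian and its second-order Taylor bound *)

Section GaussBound.
Context {R : realType}.
Local Notation C := R[i].

Lemma le_sqr (x y : R) : 0 <= x -> x <= y -> x ^+ 2 <= y ^+ 2.
Proof. by move=> x0 xy; rewrite lerXn2r // nnegrE (le_trans x0). Qed.

(** Completing the square absorbs the linear term into half of the quadratic one. The remaining
    exp(-a X^2 / 2) is below (k X^2)^-n with n = p + 1, by 1 + y <= e^y raised to the power n. *)
Lemma gauss_bound (a B : R) (p : nat) : 0 < a ->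
  exists2 c : R, 0 < c & forall X : R, 1 <= X -> X ^+ p * expR (B - a * X ^+ 2 + B * X) <= c.
Proof.
move=> a0; pose n := p.+1; pose k := a / 2 / n%:R.
have n0 : 0 < n%:R :> R by rewrite ltr0n.
have k0 : 0 < k by rewrite !divr_gt0.
pose E := expR (B + B ^+ 2 / (2 * a)).
exists (E / k ^+ n); first by rewrite divr_gt0 ?exprn_gt0 ?expR_gt0.
move=> X X1; have X0 : 0 < X by lra.
have h1 : expR (B - a * X ^+ 2 + B * X) <= E * expR (- (a / 2) * X ^+ 2).
  rewrite -expRD ler_expR.
  have : 0 <= (B - a * X) ^+ 2 / (2 * a) by rewrite divr_ge0 ?sqr_ge0 // mulr_ge0 // ltW.
  have -> : (B - a * X) ^+ 2 / (2 * a) = B ^+ 2 / (2 * a) - B * X + a / 2 * X ^+ 2.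
    by field; rewrite gt_eqF.
  lra.
have h2 : expR (- (a / 2) * X ^+ 2) <= (k * X ^+ 2) ^- n.
  have -> : - (a / 2) * X ^+ 2 = - (n%:R * (k * X ^+ 2)).
    by rewrite /k; field; rewrite gt_eqF.
  rewrite expRN expRM_natl lef_pV2 ?posrE ?exprn_gt0 ?expR_gt0 ?mulr_gt0 ?exprn_gt0 ?invr_gt0 //.
  rewrite lerXn2r ?nnegrE ?expR_ge0 ?mulr_ge0 ?exprn_ge0 ?ltW ?invr_gt0 //.
  by apply: lt_le_trans (expR_ge1Dx _); rewrite ltrDr.
have h3 : X ^+ p <= (X ^+ 2) ^+ n.
  rewrite -exprM; apply: ler_weXn2l => //; rewrite /n; lia.
apply: (@le_trans _ _ ((X ^+ 2) ^+ n * (E * (k * X ^+ 2) ^- n))).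
  apply: ler_pM => //; rewrite ?expR_ge0 ?exprn_ge0 // ?(ltW X0) //.
  by apply: le_trans h1 _; rewrite ler_wpM2l ?expR_ge0.
rewrite [(k * _) ^+ n]exprMn; have : (X ^+ 2) ^+ n != 0 by rewrite gt_eqF ?exprn_gt0.
have : k ^+ n != 0 by rewrite gt_eqF ?exprn_gt0.
move: ((X ^+ 2) ^+ n) (k ^+ n) => u v u0 v0.
by rewrite le_eqVlt; apply/orP; left; apply/eqP; field; rewrite u0 v0.
Qed.

Definition phi (z : C) : C := cexp (- pi%:C%C * z ^+ 2).
Definition dphi (z : C) : C := - (2 * pi%:C%C) * z * phi z.

Lemma cm_pi : cm (pi%:C%C : C) = pi.
Proof. by rewrite cm_real ger0_norm // pi_ge0. Qed.

Lemma cm_phi (z : C) : cm (phi z) = expR (- pi * complex.Re (z ^+ 2)).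
Proof. by rewrite /phi cm_cexp ReM ReN /= oppr0 mul0r subr0. Qed.

(** [e] is the increment of the exponent, so [phi (z + h) = phi z * cexp e]. *)
Lemma phi_near_raw (z h e : C) : e = - pi%:C%C * (2 * z * h + h ^+ 2) ->
  cm (phi (z + h) - phi z - h * dphi z) <=
  cm (phi z) * (pi * cm h ^+ 2 + 8 * cm e ^+ 2 * expR (cm e)).
Proof.
move=> eE; have -> : phi (z + h) - phi z - h * dphi z =
    phi z * (- pi%:C%C * h ^+ 2 + (cexp e - 1 - e)).
  rewrite /dphi /phi (_ : - pi%:C%C * (z + h) ^+ 2 = - pi%:C%C * z ^+ 2 + e).
    by rewrite cexpD eE; ring.
  by rewrite eE; ring.
rewrite cmM ler_wpM2l ?cm_ge0 //; apply: le_trans (cmD _ _) _.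
rewrite cmM cmN cm_pi cmX lerD2l; exact: cexp_near.
Qed.

(** The hypotheses on [z] are those supplied by [cone_bound]; [k] will be a step in t or in x, and
    the error is quadratic in it while still decaying in [X]. *)
Lemma phi_near (a B D E : R) : 0 < a -> 0 < D -> 0 < E ->
  exists k0 c : R, [/\ 0 < k0, 0 < c & forall (k X : R) (z h : C),
    0 < k -> k <= k0 -> 1 <= X -> cm z <= D * X ->
    cm (phi z) <= expR (B - a * X ^+ 2 + B * X) -> cm h <= k * E * X ->
    cm (phi (z + h) - phi z - h * dphi z) <= k ^+ 2 * c * X ^- 3].
Proof.
(* With |z| <= D X, |h| <= k E X and k <= 1 the exponent changes by at most k G X^2; the choice of
   k0 keeps this below half of the Gaussian decay. *)
move=> a0 D0 E0; pose G : R := pi * (2 * D * E + E ^+ 2).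
have pi0 := pi_gt0 R.
have G0 : 0 < G by rewrite mulr_gt0 // addr_gt0 ?exprn_gt0 // !mulr_gt0.
have a2 : 0 < a / 2 by rewrite divr_gt0.
(* Exponent 7: the error grows like X^4 and a decay X^-3 is wanted. *)
have [c c0 hc] := gauss_bound B 7 a2.
have H0 : 0 < pi * E ^+ 2 + 8 * G ^+ 2.
  by apply: addr_gt0; apply: mulr_gt0 => //; exact: exprn_gt0.
exists (Num.min 1 (a / 2 / G)), ((pi * E ^+ 2 + 8 * G ^+ 2) * c); split.
- by rewrite lt_min ltr01 divr_gt0.
- exact: mulr_gt0.
move=> k X z h k_gt0; rewrite le_min => /andP[k1]; rewrite ler_pdivlMr // => kG X1 hz hphi hh.
have X0 : 0 < X by lra.
apply: le_trans (phi_near_raw erefl) _; set e := - _ * _.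
have z0 := cm_ge0 z; have h0 := cm_ge0 h.
have he : cm e <= k * G * X ^+ 2.
  rewrite cmM cmN cm_pi.
  have -> : k * G * X ^+ 2 = pi * (2 * (D * X) * (k * E * X) + k * E ^+ 2 * X ^+ 2) by rewrite /G; ring.
  rewrite ler_pM2l //; apply: le_trans (cmD _ _) _; rewrite !cmM cm_nat.
  apply: lerD.
    by apply: ler_pM => //; rewrite ?mulr_ge0 // ler_pM2l.
  rewrite -cmM -expr2 cmX; apply: (@le_trans _ _ ((k * E * X) ^+ 2)); first exact: le_sqr.
  rewrite !exprMn; do 2 (rewrite ler_pM2r ?exprn_gt0 //).
  by rewrite expr2 ger_pMl.
have e0 := cm_ge0 e.
have he2 := le_sqr e0 he.
have hh2 := le_sqr h0 hh.
have hX : X ^+ 2 <= X ^+ 4 by apply: ler_weXn2l.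
have hee : 1 <= expR (k * G * X ^+ 2).
  by rewrite -expR0 ler_expR; positivity.
have key : pi * cm h ^+ 2 + 8 * cm e ^+ 2 * expR (cm e) <=
    k ^+ 2 * (pi * E ^+ 2 + 8 * G ^+ 2) * X ^+ 4 * expR (k * G * X ^+ 2).
  have -> : k ^+ 2 * (pi * E ^+ 2 + 8 * G ^+ 2) * X ^+ 4 * expR (k * G * X ^+ 2) =
     pi * ((k * E) ^+ 2 * (X ^+ 4 * expR (k * G * X ^+ 2))) +
     8 * ((k * G * X ^+ 2) ^+ 2 * expR (k * G * X ^+ 2)) by ring.
  apply: lerD.
    rewrite ler_pM2l //; apply: le_trans hh2 _; rewrite exprMn ler_pM2l; last by positivity.
    by apply: le_trans hX _; rewrite ler_peMr; positivity.
  rewrite -mulrA ler_pM2l //; apply: ler_pM; rewrite ?ler_expR; by positivity.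
apply: (@le_trans _ _ (expR (B - a * X ^+ 2 + B * X) *
   (k ^+ 2 * (pi * E ^+ 2 + 8 * G ^+ 2) * X ^+ 4 * expR (k * G * X ^+ 2)))).
  by apply: ler_pM => //; positivity.
have : X ^+ 7 * expR (B - a * X ^+ 2 + B * X) * expR (k * G * X ^+ 2) <= c.
  apply: le_trans (hc X X1); rewrite -mulrA ler_pM2l; last by positivity.
  rewrite -expRD ler_expR.
  have : k * G * X ^+ 2 <= a / 2 * X ^+ 2 by rewrite ler_pM2r; positivity.
  lra.
move=> hfin.
have -> : expR (B - a * X ^+ 2 + B * X) *
   (k ^+ 2 * (pi * E ^+ 2 + 8 * G ^+ 2) * X ^+ 4 * expR (k * G * X ^+ 2)) =
   k ^+ 2 * (pi * E ^+ 2 + 8 * G ^+ 2) * (X ^+ 7 * expR (B - a * X ^+ 2 + B * X) * expR (k * G * X ^+ 2)) * X ^- 3.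
  by field; rewrite gt_eqF.
rewrite ler_pM2r; last by positivity.
by rewrite [leRHS]mulrA ler_pM2l //; positivity.
Qed.

End GaussBound.

(** * Poisson summation for Gaussians *)

Section RiemannSums.
Context {R : realType}.
Local Notation C := R[i].

(** Discrete mean value inequality: J equal steps give A + B / J, and J is arbitrary. *)
Lemma increment_bound (g : R -> C) (A B d0 : R) : 0 < d0 -> 0 <= B ->
  (forall t d, 0 <= t -> t + d <= 1 -> 0 < d -> d <= d0 ->
     cm (g (t + d) - g t) <= A * d + B * d ^+ 2) ->
  cm (g 1 - g 0) <= A.
Proof.
move=> d00 B0 h; apply/ler_addgt0Pr => e e0.
have [J [J0 J1 J2]] : exists J : nat, [/\ (0 < J)%N, J%:R^-1 <= d0 & B / J%:R <= e].
  pose J := (Num.truncn (d0^-1 + B / e)).+1.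
  have hJ : d0^-1 + B / e < J%:R by exact: truncnS_gt.
  have Be0 : 0 <= B / e by rewrite divr_ge0 // ltW.
  have d1 : 0 < d0^-1 by rewrite invr_gt0.
  have J0 : 0 < J%:R :> R by rewrite ltr0n.
  exists J; split => //.
    by rewrite -[leRHS]invrK lef_pV2 ?posrE //; lra.
  rewrite ler_pdivrMr // mulrC -ler_pdivrMr //; lra.
have Jn0 : (J%:R : R) != 0 by rewrite pnatr_eq0 -lt0n.
have JR : 0 < J%:R :> R by rewrite ltr0n.
have step n : (n <= J)%N -> cm (g (n%:R / J%:R) - g 0) <= n%:R * (A / J%:R + B / J%:R ^+ 2).
  elim: n => [|n IH] nJ; first by rewrite !mul0r subrr cm0.
  have -> : g (n.+1%:R / J%:R) - g 0 =
    (g (n%:R / J%:R + J%:R^-1) - g (n%:R / J%:R)) + (g (n%:R / J%:R) - g 0).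
    by rewrite -natr1 mulrDl mul1r; ring.
  apply: le_trans (cmD _ _) _; rewrite -natr1 mulrDl mul1r addrC.
  apply: lerD; first exact: IH (ltnW nJ).
  have -> : A / J%:R + B / J%:R ^+ 2 = A * J%:R^-1 + B * J%:R^-1 ^+ 2 by rewrite exprVn.
  apply: h; rewrite ?invr_gt0 ?divr_ge0 //.
  by rewrite -[X in _ + X]mul1r -mulrDl ler_pdivrMr // mul1r natr1 ler_nat.
have := step J (leqnn J); rewrite divff // => h1; apply: le_trans h1 _.
by rewrite mulrDr expr2 invfM mulrCA divff // mulr1 lerD2l mulrCA [X in _ * X]mulrA divff ?mul1r.
Qed.

(* The cone [Re (r^2) > 0], [Re r > 0]: the range of the branch [rr] of sqrt(-it) below. *)
Definition in_cone (r : C) := `|complex.Im r| < complex.Re r.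
Definition seg (r : C) (t : R) : C := 1 + t%:C%C * (r - 1).

(** The cone is convex and contains 1, so the whole segment keeps the margin [m] between the real
    part and the modulus of the imaginary part, whence Re(seg^2) >= m^2 and a Gaussian decay uniform
    in [t]. The shift by [w] only costs terms of lower degree in [X]. *)
Lemma cone_bound (r w : C) : in_cone r ->
  exists a B D : R, [/\ 0 < a, 0 < B, 1 <= D & forall t x : R, 0 <= t -> t <= 1 ->
    let X := 1 + `|x| in let z := seg r t * x%:C%C + t%:C%C * w in
    [/\ cm z <= D * X, cm (phi z) <= expR (B - a * X ^+ 2 + B * X),
        cm (seg r t) <= D, cm (r - 1) <= D & cm ((r - 1) * x%:C%C + w) <= D * X]].
Proof.
move=> hr; pose m := Num.min 1 (complex.Re r - `|complex.Im r|).
have m0 : 0 < m by rewrite lt_min ltr01 subr_gt0.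
pose D := 1 + cm r + cm w; have r0 := cm_ge0 r; have w0 := cm_ge0 w.
have D1 : 1 <= D by rewrite /D; lra.
have D0 : 0 <= D by lra.
have a0 : 0 < pi * m ^+ 2 :> R by positivity.
have p0 := pi_gt0 R.
exists (pi * m ^+ 2), (2 * (pi * m ^+ 2) + 2 * pi * D ^+ 2), D; split => //.
  by apply: ltr_wpDr; positivity.
move=> t x t0 t1 X z; have x0 := normr_ge0 x.
have sD : cm (seg r t) <= 1 + cm r.
  rewrite /seg (_ : 1 + _ = (1 - t)%:C%C + t%:C%C * r); last by rewrite rmorphB rmorph1; ring.
  by apply: le_trans (cmD _ _) _; rewrite cmM !cm_real !ger0_norm ?subr_ge0 //; nra.
have r1 : cm (r - 1) <= 1 + cm r by apply: le_trans (cmB _ _) _; rewrite cm1 addrC.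
have zb (s : C) : cm s <= 1 + cm r -> cm (s * x%:C%C) <= (1 + cm r) * `|x|.
  by move=> hs; rewrite cmM cm_real ler_wpM2r.
have tw : cm (t%:C%C * w) <= cm w by rewrite cmM cm_real ger0_norm // ler_piMl.
split; try (by rewrite /D; lra).
- apply: le_trans (cmD _ _) _; have := zb _ sD; have := mulr_ge0 w0 x0; rewrite /X /D; lra.
- rewrite cm_phi ler_expR.
  have Rz : m ^+ 2 * x ^+ 2 - 2 * D ^+ 2 * `|x| - D ^+ 2 <= complex.Re (z ^+ 2).
    have -> : z ^+ 2 = seg r t ^+ 2 * (x ^+ 2)%:C%C + (2 * (seg r t * x%:C%C) * (t%:C%C * w) + (t%:C%C * w) ^+ 2).
      by rewrite /z rmorphXn /=; ring.
    rewrite ReD ReM /= mulr0 subr0 -addrA; apply: lerD.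
      rewrite ler_wpM2r ?sqr_ge0 // expr2 [in leRHS]expr2 ReM.
      have mle : m <= complex.Re (seg r t) - `|complex.Im (seg r t)|.
        have m1 : m <= 1 by rewrite ge_min lexx.
        have m2 : m <= complex.Re r - `|complex.Im r| by rewrite ge_min lexx orbT.
        rewrite /seg !ReD !ImD !ReM !ImM /= !ReD !ImD !ReN !ImN /= !mul0r subr0 addr0 add0r oppr0 addr0.
        rewrite normrM ger0_norm //; nra.
      set p := complex.Re _ in mle *; set q' := complex.Im _ in mle *.
      have : `|q'| * `|q'| = q' * q' by rewrite -!expr2 real_normK ?num_real.
      have := normr_ge0 q'; nra.
    set u := (X in _ <= complex.Re X); have : - cm u <= complex.Re u.
      by have := cm_Re u; rewrite ler_norml => /andP[].
    have gen (b y : C) : cm b <= cm w -> cm y <= (1 + cm r) * `|x| ->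
        cm (2 * y * b + b ^+ 2) <= 2 * D ^+ 2 * `|x| + D ^+ 2.
      move=> hb hy; apply: le_trans (cmD _ _) _; rewrite cmX !cmM cm_nat; apply: lerD.
        have -> : 2 * D ^+ 2 * `|x| = 2 * (D * `|x|) * D by ring.
        apply: ler_pM; try by positivity.
          by rewrite ler_pM2l //; apply: le_trans hy _; rewrite ler_wpM2r // /D; lra.
        by apply: le_trans hb _; rewrite /D; lra.
      by apply: le_sqr; [positivity | apply: le_trans hb _; rewrite /D; lra].
    have := gen _ _ tw (zb _ sD); rewrite -/u.
    lra.
  have xX : x ^+ 2 = X ^+ 2 - 2 * X + 1.
    by rewrite -[x ^+ 2]real_normK ?num_real // /X; ring.
  have h1 : - pi * complex.Re (z ^+ 2) <= - pi * (m ^+ 2 * x ^+ 2 - 2 * D ^+ 2 * `|x| - D ^+ 2).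
    by rewrite !mulNr lerN2 ler_pM2l.
  apply: le_trans h1 _; rewrite xX (_ : `|x| = X - 1); last by rewrite /X; ring.
  have : 0 <= pi * D ^+ 2 by positivity.
  have -> : - pi * (m ^+ 2 * (X ^+ 2 - 2 * X + 1) - 2 * D ^+ 2 * (X - 1) - D ^+ 2) =
     - (pi * m ^+ 2) * X ^+ 2 + 2 * (pi * m ^+ 2) * X - (pi * m ^+ 2) + 2 * (pi * D ^+ 2) * X - pi * D ^+ 2 by ring.
  lra.
- apply: le_trans (cmD _ _) _; have := zb _ r1; have := mulr_ge0 w0 x0; rewrite /X /D; lra.
Qed.

(** Homotopy from [phi x] at t = 0 to [r * phi (r * x + w)] at t = 1; [Kseg] is the flux in x of its
    t-derivative. *)
Definition hseg (r w : C) (t x : R) : C := seg r t * phi (seg r t * x%:C%C + t%:C%C * w).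
Definition Kseg (r w : C) (t x : R) : C :=
  ((r - 1) * x%:C%C + w) * phi (seg r t * x%:C%C + t%:C%C * w).

(* [d/dt hseg = d/dx Kseg], in finite difference form. Summing over the mesh [x = m / N]
   kills the right-hand side, which replaces the rotation of the contour in the Gaussian
   integral. *)
Lemma hseg_step (r w : C) : in_cone r -> exists k0 c : R, [/\ 0 < k0, 0 < c &
  (forall t x : R, 0 <= t -> t <= 1 ->
     cm (hseg r w t x) <= c * (1 + `|x|) ^- 2 /\ cm (Kseg r w t x) <= c * (1 + `|x|) ^- 2) /\
  (forall d eta t x : R, 0 < d -> d <= k0 -> 0 < eta -> eta <= k0 -> 0 <= t -> t + d <= 1 ->
     cm (hseg r w (t + d) x - hseg r w t x -
         (d / eta)%:C%C * (Kseg r w t (x + eta) - Kseg r w t x)) <=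
     (d ^+ 2 + d * eta) * (c * (1 + `|x|) ^- 2))].
Proof.
move=> hr; have [a [B [D [a0 B0 D1 hD]]]] := cone_bound w hr.
have D0 : 0 < D by lra.
have [k0 [c1 [k00 c10 h1]]] := phi_near B a0 D0 D0.
have [c2 c20 h2] := gauss_bound B 4 a0.
have p0 := pi_gt0 R.
pose c := D * c2 + D ^+ 2 * (2 * pi * D * c2) + 2 * D * c1.
have c0 : 0 < c by rewrite /c; positivity.
exists (Num.min 1 k0), c; split => //; first by rewrite lt_min ltr01.
split.
  move=> t x t0 t1; have [hz hphi hs hr1 hv] := hD t x t0 t1; set X := 1 + `|x| in hz hphi hv *.
  have X1 : 1 <= X by rewrite /X; have := normr_ge0 x; lra.
  have X0 : 0 < X by lra.
  have hp : cm (phi (seg r t * x%:C%C + t%:C%C * w)) <= c2 * X ^- 4.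
    by rewrite ler_pdivlMr ?exprn_gt0 // mulrC; apply: le_trans (h2 X X1); rewrite ler_pM2l ?exprn_gt0.
  have cc : D * c2 <= c by rewrite /c -addrA lerDl; positivity.
  have hX : X ^- 3 <= X ^- 2 by rewrite lef_pV2 ?posrE ?exprn_gt0 //; apply: ler_weXn2l.
  have hX4 : X ^- 4 <= X ^- 3 by rewrite lef_pV2 ?posrE ?exprn_gt0 //; apply: ler_weXn2l.
  split; rewrite cmM.
    apply: (@le_trans _ _ (D * (c2 * X ^- 4))); first by apply: ler_pM; rewrite ?cm_ge0.
    by rewrite mulrA; apply: ler_pM; try positivity; apply: le_trans hX4 _.
  apply: (@le_trans _ _ (D * X * (c2 * X ^- 4))); first by apply: ler_pM; rewrite ?cm_ge0.
  have -> : D * X * (c2 * X ^- 4) = D * c2 * X ^- 3 by field; rewrite gt_eqF.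
  by apply: ler_pM; positivity.
move=> d eta t x d0; rewrite le_min => /andP[_ dk] e0; rewrite le_min => /andP[ek1 ek] t0 td.
have t1 : t <= 1 by lra.
have td0 : 0 <= t + d by lra.
have [hz hphi hs hr1 hv] := hD t x t0 t1.
have [_ _ hs' _ _] := hD (t + d) x td0 td.
rewrite /hseg /Kseg; set X := 1 + `|x| in hz hphi hv *.
have X1 : 1 <= X by rewrite /X; have := normr_ge0 x; lra.
have X0 : 0 < X by lra.
set z := _ + _ in hz hphi *; set v := _ + _ in hv *; set s := seg r t in hs z hz hphi *.
set s' := seg r (t + d) in hs' *.
have hX : X ^- 3 <= X ^- 2 by rewrite lef_pV2 ?posrE ?exprn_gt0 //; apply: ler_weXn2l.
have E1 : s' = s + d%:C%C * (r - 1) by rewrite /s' /s /seg rmorphD /=; ring.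
have E2 : s' * x%:C%C + (t + d)%:C%C * w = z + d%:C%C * v.
  by rewrite E1 /z /v rmorphD /=; ring.
have E3 : s * (x + eta)%:C%C + t%:C%C * w = z + eta%:C%C * s by rewrite /z rmorphD /=; ring.
have E4 : (r - 1) * (x + eta)%:C%C + w = v + eta%:C%C * (r - 1) by rewrite /v rmorphD /=; ring.
have b1 : cm (d%:C%C * v) <= d * D * X.
  by rewrite cmM cm_real gtr0_norm // -mulrA ler_pM2l.
have b2 : cm (eta%:C%C * s) <= eta * D * X.
  rewrite cmM cm_real gtr0_norm // -mulrA ler_pM2l //; apply: le_trans hs _; rewrite ler_peMr //; lra.
have n1 := h1 d X z _ d0 dk X1 hz hphi b1.
have n2 := h1 eta X z _ e0 ek X1 hz hphi b2.
have hp : X ^+ 3 * (X * cm (phi z)) <= c2.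
  rewrite mulrA -exprSr; apply: le_trans (h2 X X1); rewrite ler_pM2l ?exprn_gt0 //.
have hd : cm (dphi z) <= 2 * pi * D * c2 * X ^- 3.
  rewrite /dphi !cmM cmN cmM cm_nat cm_pi ler_pdivlMr ?exprn_gt0 //.
  have : 2 * pi * cm z * cm (phi z) <= 2 * pi * (D * X) * cm (phi z).
    by rewrite ler_wpM2r ?cm_ge0 // ler_pM2l // mulr_gt0.
  have := exprn_gt0 3 X0; set Y := X ^+ 3 in hp * => Y0 h3.
  apply: (@le_trans _ _ (2 * pi * (D * X) * cm (phi z) * Y)); first by rewrite ler_pM2r.
  have -> : 2 * pi * (D * X) * cm (phi z) * Y = 2 * pi * D * (Y * (X * cm (phi z))) by ring.
  by rewrite ler_pM2l //; positivity.
rewrite E2 E3 E4; set e1 := phi (z + d%:C%C * v) - phi z - _ in n1.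
set e2 := phi (z + eta%:C%C * s) - phi z - _ in n2.
have -> : phi (z + d%:C%C * v) = phi z + d%:C%C * v * dphi z + e1 by rewrite /e1; ring.
have -> : phi (z + eta%:C%C * s) = phi z + eta%:C%C * s * dphi z + e2 by rewrite /e2; ring.
have etaC : (eta%:C%C : C) != 0 by rewrite eq_complex /= negb_and gt_eqF.
(* The terms of order d cancel; what is left is of order d^2 or d eta. *)
have -> : s' * (phi z + d%:C%C * v * dphi z + e1) - s * phi z -
   (d / eta)%:C%C * ((v + eta%:C%C * (r - 1)) * (phi z + eta%:C%C * s * dphi z + e2) - v * phi z) =
   (d ^+ 2)%:C%C * ((r - 1) * v * dphi z) + s' * e1 -
   ((d * eta)%:C%C * ((r - 1) * s * dphi z) + (d / eta)%:C%C * ((v + eta%:C%C * (r - 1)) * e2)).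
  by rewrite E1 !rmorphM fmorphV /=; field.
have V3 : 0 < X ^- 3 by positivity.
have V2 : 0 < X ^- 2 by positivity.
have T1 : cm ((d ^+ 2)%:C%C * ((r - 1) * v * dphi z)) <= d ^+ 2 * (D ^+ 2 * (2 * pi * D * c2) * X ^- 2).
  rewrite cmM cm_real ger0_norm ?sqr_ge0 // ler_pM2l ?exprn_gt0 // cmM (cmM _ v).
  have -> : D ^+ 2 * (2 * pi * D * c2) * X ^- 2 = D * (D * X) * (2 * pi * D * c2 * X ^- 3).
    by field; rewrite gt_eqF.
  by apply: ler_pM; rewrite ?mulr_ge0 ?cm_ge0 //; apply: ler_pM; rewrite ?cm_ge0.
have T2 : cm (s' * e1) <= d ^+ 2 * (2 * D * c1 * X ^- 2).
  rewrite cmM; apply: (@le_trans _ _ (D * (d ^+ 2 * c1 * X ^- 3))); first by apply: ler_pM; rewrite ?cm_ge0.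
  have : d ^+ 2 * c1 * X ^- 3 <= d ^+ 2 * c1 * X ^- 2 by rewrite ler_pM2l //; positivity.
  have : 0 < d ^+ 2 * c1 * X ^- 2 by positivity.
  nra.
have T3 : cm ((d * eta)%:C%C * ((r - 1) * s * dphi z)) <= d * eta * (D ^+ 2 * (2 * pi * D * c2) * X ^- 2).
  rewrite cmM cm_real gtr0_norm ?mulr_gt0 // ler_pM2l ?mulr_gt0 // cmM (cmM _ s).
  rewrite -[leRHS]mulrA [D ^+ 2]expr2; apply: ler_pM; rewrite ?mulr_ge0 ?cm_ge0 //; first by apply: ler_pM; rewrite ?cm_ge0.
  by apply: le_trans hd _; rewrite ler_pM2l //; positivity.
have T4 : cm ((d / eta)%:C%C * ((v + eta%:C%C * (r - 1)) * e2)) <= d * eta * (2 * D * c1 * X ^- 2).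
  rewrite !cmM cm_real gtr0_norm ?divr_gt0 //.
  have hv2 : cm (v + eta%:C%C * (r - 1)) <= 2 * D * X.
    apply: le_trans (cmD _ _) _; rewrite cmM cm_real gtr0_norm //.
    have : eta * cm (r - 1) <= 1 * (D * X).
      by apply: ler_pM => //; rewrite ?(ltW e0) ?cm_ge0 //; apply: le_trans hr1 _; rewrite ler_peMr //; lra.
    lra.
  have -> : d * eta * (2 * D * c1 * X ^- 2) = d / eta * (2 * D * X * (eta ^+ 2 * c1 * X ^- 3)).
    by field; rewrite !gt_eqF.
  by rewrite ler_pM2l ?divr_gt0 //; apply: ler_pM; rewrite ?cm_ge0.
apply: le_trans (cmB _ _) _.
have -> : (d ^+ 2 + d * eta) * (c * X ^- 2) = d ^+ 2 * (D * c2 * X ^- 2) + d * eta * (D * c2 * X ^- 2) +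
  d ^+ 2 * (D ^+ 2 * (2 * pi * D * c2) * X ^- 2) + d ^+ 2 * (2 * D * c1 * X ^- 2) +
  d * eta * (D ^+ 2 * (2 * pi * D * c2) * X ^- 2) + d * eta * (2 * D * c1 * X ^- 2) by rewrite /c; ring.
have := cmD ((d ^+ 2)%:C%C * ((r - 1) * v * dphi z)) (s' * e1).
have := cmD ((d * eta)%:C%C * ((r - 1) * s * dphi z)) ((d / eta)%:C%C * ((v + eta%:C%C * (r - 1)) * e2)).
have : 0 < d ^+ 2 * (D * c2 * X ^- 2) by positivity.
have : 0 < d * eta * (D * c2 * X ^- 2) by positivity.
lra.
Qed.

End RiemannSums.

(** * Additive characters and roots of unity *)

Section RootsOfUnity.
Context {R : realType}.
Local Notation C := R[i].

Definition ee (x : R) : C := cexp (Complex 0 (2 * pi * x)).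

Lemma eeD x y : ee (x + y) = ee x * ee y.
Proof. by rewrite /ee -cexpD; congr cexp; apply: complexP => /=; ring. Qed.

Lemma ee0 : ee 0 = 1.
Proof. by rewrite /ee mulr0 cexp0. Qed.

Lemma cm_ee x : cm (ee x) = 1.
Proof. by rewrite cm_cexp /= expR0. Qed.

Lemma ee_neq0 x : ee x != 0.
Proof. exact: cexp_neq0. Qed.

Lemma ee_nat n : ee n%:R = 1.
Proof.
elim: n => [|n IH]; first exact: ee0.
rewrite -natr1 eeD IH mul1r; apply: complexP; rewrite /= mulr1 expR0 mul1r mulrC.
  by rewrite mulr_natr cos2pi.
by rewrite mulr_natr sin2pi.
Qed.

Lemma eeN x : ee (- x) = (ee x)^-1.
Proof. by apply: (mulfI (ee_neq0 x)); rewrite -eeD subrr ee0 divff ?ee_neq0. Qed.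

Lemma ee_int (n : int) : ee n%:~R = 1.
Proof. by case: n => n; rewrite ?ee_nat // NegzE mulrNz eeN ee_nat invr1. Qed.

Lemma eeMn n x : ee (n%:R * x) = ee x ^+ n.
Proof.
elim: n => [|n IH]; first by rewrite mul0r ee0.
by rewrite -natr1 mulrDl mul1r eeD IH exprSr.
Qed.

Lemma ee_neq1 (x : R) : 0 < x -> x < 1 -> ee x != 1.
Proof.
move=> x0 x1; apply/negP => /eqP h.
have p0 := pi_gt0 R.
have : cos (2 * pi * x) = 1 by have := congr1 (@complex.Re R) h; rewrite /= expR0 mul1r.
have -> : 2 * pi * x = (pi * x) *+ 2 by rewrite -mulr_natl; ring.
rewrite cos_mulr2n; have := cos2Dsin2 (pi * x).
have : 0 < sin (pi * x) by apply: sin_gt0_pi; rewrite ?mulr_gt0 // gtr_pMr.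
move=> s0; have := exprn_gt0 2 s0; lra.
Qed.

(** Orthogonality of the characters of Z/N, by the geometric sum. *)
Lemma ee_sum (N : nat) (m : int) : (0 < N)%N ->
  \sum_(j < N) ee ((j : nat)%:R * (m%:~R / N%:R)) = if (N %| m)%Z then N%:R else 0.
Proof.
move=> N0; have NR : (N%:R : R) != 0 by rewrite pnatr_eq0 -lt0n.
under eq_bigr do rewrite eeMn.
(* Reduction modulo N puts the argument strictly between 0 and 1, where [ee] avoids 1, unless N
   divides m. *)
have E1 : ee (m%:~R / N%:R) = ee (((m %% N)%Z)%:~R / N%:R).
  rewrite {1}(divz_eq m N) intrD mulrDl eeD intrM -mulrA divff // mulr1.
  by rewrite ee_int mul1r.
case: ifP => [/dvdzP[k ->]|hN].
  under eq_bigr do rewrite intrM -mulrA divff // mulr1 ee_int expr1n.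
  by rewrite sumr_const card_ord.
set u := ee _; have un : u ^+ N = 1 by rewrite -eeMn mulrC mulfVK // ee_int.
have u1 : u - 1 != 0.
  rewrite subr_eq0 /u E1.
  have m0 : (0 <= m %% N)%Z by apply: modz_ge0; rewrite -lt0n.
  have m1 : (m %% N < N)%Z by apply: ltz_pmod.
  apply: ee_neq1.
    rewrite divr_gt0 ?ltr0n // ltr0z lt_def m0 andbT.
    by apply/negP => /eqP/dvdz_mod0P; rewrite hN.
  by rewrite ltr_pdivrMr ?ltr0n // mul1r -[N%:R]/(N%:Z%:~R) ltr_int.
by apply: (mulfI u1); rewrite -subrX1 un subrr mulr0.
Qed.

(** Duplication formula, with cos at least 1/2 on [0, pi/4]. *)
Lemma sin_ge (y : R) : 0 <= y -> y <= pi / 2 -> y / 4 <= sin y.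
Proof.
move=> y0 y1; have p0 := pi_gt0 R.
have cge (c : R) : 0 <= c -> c <= pi / 4 -> 1 / 2 <= cos c.
  move=> c0 c1; have h1 : 0 <= cos c by apply: cos_ge0_pihalf; lra.
  have : 0 <= cos (c *+ 2) by apply: cos_ge0_pihalf; rewrite -mulr_natl; lra.
  rewrite cos_mulr2n => h2; nra.
have [|c] := @MVT_segment R sin cos 0 (y / 2) (divr_ge0 y0 (ler0n _ 2)) (fun t _ => is_derive_sin t).
  exact/continuous_subspaceT/continuous_sin.
rewrite in_itv /= => /andP[c0 c1]; rewrite sin0 !subr0 => hs.
have hc := cge c c0 _; have hy := cge (y / 2).
have {hc} : 1 / 2 <= cos c by apply: hc; lra.
have {hy} : 1 / 2 <= cos (y / 2) by apply: hy; lra.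
have -> : sin y = 2 * sin (y / 2) * cos (y / 2).
  by rewrite {1}(_ : y = y / 2 + y / 2) ?sinD; [ring | field].
rewrite hs => h1 h2.
have h3 : y / 4 <= cos c * (y / 2) by nra.
nra.
Qed.

(** The quantity is -4 sin(pi x)^2, an eigenvalue of the discrete Laplacian. *)
Lemma cm_eeD (x : R) : `|x| <= 1 / 2 -> x ^+ 2 <= cm (ee x + ee (- x) - 2).
Proof.
move=> hx; have p0 := pi_gt0 R; have p2 := pi_ge2 R.
have -> : ee x + ee (- x) - 2 = (- (4 * sin (pi * x) ^+ 2))%:C%C.
  apply: complexP; rewrite /= !expR0 !mul1r.
    rewrite mulrN cosN (_ : 2 * pi * x = (pi * x) *+ 2); last by rewrite -mulr_natl; ring.
    rewrite cos_mulr2n; have := cos2Dsin2 (pi * x); lra.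
  by rewrite mulrN sinN; lra.
rewrite cm_real normrN ger0_norm; last by apply: mulr_ge0 => //; exact: sqr_ge0.
have -> : sin (pi * x) ^+ 2 = sin (pi * `|x|) ^+ 2.
  by have [x0|x0] := leP 0 x; rewrite ?(ger0_norm x0) // (ltr0_norm x0) mulrN sinN sqrrN.
have y0 := normr_ge0 x; rewrite -[x ^+ 2]real_normK ?num_real //.
set y := `|x| in hx y0 *.
have h1 : y / 2 <= sin (pi * y).
  apply: (@le_trans _ _ (pi * y / 4)); first by nra.
  by apply: sin_ge; nra.
have := le_sqr (divr_ge0 y0 (ler0n _ 2)) h1; rewrite exprMn; lra.
Qed.

End RootsOfUnity.

(** * Fourier inversion on the mesh and passage to the limit *)

Section Poisson.
Context {R : realType}.
Local Notation C := R[i].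

Let X N (m : int) : R := m%:~R / N%:R.

Let wtE (N : nat) m : wt N%:R m = N%:R^-1 * (1 + `|X N m|) ^- 2 :> R.
Proof. by rewrite /wt /X normrM normfV normr_nat. Qed.

(** [increment_bound] along the homotopy [hseg] with space step 1/N: the [Kseg] differences are then
    those of neighbouring mesh points and sum to 0. *)
Lemma riemann_limit (r w : C) : in_cone r -> exists c N0, forall N : nat, (N0 <= N)%N ->
  cm (N%:R^-1 * csum (fun m => r * phi (r * (X N m)%:C%C + w)) -
      N%:R^-1 * csum (fun m => phi (X N m)%:C%C)) <= c / N%:R.
Proof.
move=> hr; have [k0 [c [k00 c0 [hb hs]]]] := hseg_step w hr.
exists (3 * c), (Num.truncn k0^-1).+1 => N hN.
have NR : 0 < N%:R :> R by rewrite ltr0n; apply: leq_trans hN.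
have N1 : 1 <= N%:R :> R by rewrite ler1n -(ltr0n R).
have Nk : N%:R^-1 <= k0.
  rewrite -[leRHS]invrK lef_pV2 ?posrE ?invr_gt0 //; apply/ltW.
  by apply: lt_le_trans (truncnS_gt _) _; rewrite ler_nat.
have N0 : (N%:R : C) != 0 by rewrite pnatr_eq0 -(pnatr_eq0 R) gt_eqF.
pose H t m := hseg r w t (X N m); pose K t m := Kseg r w t (X N m).
pose g t := N%:R^-1 * csum (H t).
have E1 : N%:R^-1 * csum (fun m => r * phi (r * (X N m)%:C%C + w)) = g 1.
  congr (_ * csum _); apply/funext => m; rewrite /H /hseg /seg rmorph1.
  by rewrite !mul1r (_ : 1 + (r - 1) = r) //; ring.
have E0 : N%:R^-1 * csum (fun m => phi (X N m)%:C%C) = g 0.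
  congr (_ * csum _); apply/funext => m; rewrite /H /hseg /seg rmorph0.
  by rewrite !mul0r !addr0 !mul1r.
have as_ (f : int -> C) : (forall m, cm (f m) <= c * (1 + `|X N m|) ^- 2) -> asum f.
  move=> hf; have Nc : 0 <= N%:R * c by positivity.
  have h m : cm (f m) <= N%:R * c * wt N%:R m.
    rewrite wtE (_ : N%:R * c * _ = c * (1 + `|X N m|) ^- 2) ?hf //.
    by rewrite mulrACA mulfV ?mul1r // gt_eqF.
  by have [] := csum_le_wt N1 Nc h.
have aH t : 0 <= t -> t <= 1 -> asum (H t) by move=> t0 t1; apply: as_ => m; case: (hb t (X N m) t0 t1).
have aK t : 0 <= t -> t <= 1 -> asum (K t) by move=> t0 t1; apply: as_ => m; case: (hb t (X N m) t0 t1).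
rewrite E1 E0; apply: (@increment_bound _ g _ (3 * c) k0) => //; first by positivity.
move=> t d t0 td d0 dk.
have t1 : t <= 1 by lra.
have td0 : 0 <= t + d by lra.
pose f m := N%:R^-1 * (H (t + d) m - H t m - (d / N%:R^-1)%:C%C * (K t (m + 1) - K t m)).
have aK1 := asum_shift 1 (aK t t0 t1).
have -> : g (t + d) - g t = csum f.
  rewrite /f csumZ; last first.
    by apply: asumB; [apply: asumB; exact: aH | apply/asumZ/asumB => //; exact: aK].
  rewrite csumB; [|apply: asumB; exact: aH | apply/asumZ/asumB => //; exact: aK].
  rewrite csumZ; last by apply: asumB => //; exact: aK.
  rewrite !csumB ?csum_shift; try (exact: aH); try (exact: aK); last by [].
  by rewrite subrr mulr0 subr0 /g -mulrBr.
have Nc : 0 <= (d ^+ 2 + d / N%:R) * c by positivity.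
have h m : cm (f m) <= (d ^+ 2 + d / N%:R) * c * wt N%:R m.
  rewrite cmM cmV cm_nat wtE mulrCA ler_pM2l ?invr_gt0 // -mulrA.
  have NV : 0 < N%:R^-1 :> R by rewrite invr_gt0.
  have := hs d N%:R^-1 t (X N m) d0 dk NV Nk t0 td.
  suff -> : X N m + N%:R^-1 = X N (m + 1) by [].
  by rewrite /X intrD mulrDl mul1r.
have [_ hc] := csum_le_wt N1 Nc h; apply: (le_trans hc).
by rewrite le_eqVlt; apply/orP; left; apply/eqP; ring.
Qed.

(** Riemann sum for a Fourier coefficient of the periodised Gaussian. *)
Let S (r : C) (al : R) N (k : int) : C :=
  N%:R^-1 * csum (fun m => phi (r * (X N m + al)%:C%C) * ee (k%:~R * X N m)).

Lemma phi_wt (r : C) (al : R) : in_cone r -> exists2 c, 0 < c &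
  forall N m, cm (phi (r * (X N m + al)%:C%C)) <= c * (1 + `|X N m|) ^- 2.
Proof.
move=> hr; have [a [B [D [a0 B0 D1 hD]]]] := cone_bound (r * al%:C%C) hr.
have [c c0 hc] := gauss_bound B 2 a0; exists c => // N m.
have [_ hp _ _ _] := hD 1 (X N m) ler01 (lexx 1).
set Y := 1 + `|_| in hp *.
have Y1 : 1 <= Y by rewrite /Y; have := normr_ge0 (X N m); lra.
rewrite ler_pdivlMr ?exprn_gt0 //; last by lra.
rewrite mulrC; apply: le_trans (hc _ Y1); rewrite ler_pM2l ?exprn_gt0 //; last by lra.
move: hp; rewrite /seg rmorph1 !mul1r (_ : 1 + (r - 1) = r); last by ring.
by rewrite -mulrDr -rmorphD.
Qed.

Lemma phi_asum (r : C) (al : R) (u : int -> C) N : in_cone r -> (0 < N)%N ->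
  (forall m, cm (u m) = 1) -> asum (fun m => phi (r * (X N m + al)%:C%C) * u m).
Proof.
move=> hr N0 hu; have [c c0 hc] := phi_wt al hr.
have N1 : 1 <= N%:R :> R by rewrite ler1n.
have Nc : 0 <= N%:R * c by positivity.
have [] // := csum_le_wt (f := fun m => phi (r * (X N m + al)%:C%C) * u m) N1 Nc.
move=> m; rewrite cmM hu mulr1 wtE (_ : N%:R * c * _ = c * (1 + `|X N m|) ^- 2) ?hc //.
by rewrite mulrACA mulfV ?mul1r // gt_eqF // ltr0n.
Qed.

(** Adding the Taylor bounds for the steps 1/N and -1/N cancels the first-order terms. *)
Lemma second_difference (r : C) (al : R) : in_cone r -> exists c N0, [/\ 0 <= c, (0 < N0)%N &
  forall N m, (N0 <= N)%N ->
   cm (phi (r * (X N (m + 1) + al)%:C%C) + phi (r * (X N (m - 1) + al)%:C%C)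
       - 2 * phi (r * (X N m + al)%:C%C)) <= N%:R ^- 2 * c * (1 + `|X N m|) ^- 2].
Proof.
move=> hr; have [a [B [D [a0 B0 D1 hD]]]] := cone_bound (r * al%:C%C) hr.
have D0 : 0 < D by lra.
have [k0 [c [k00 c0 h1]]] := phi_near B a0 D0 D0.
exists (2 * c), (Num.truncn k0^-1).+1; split => //; first by positivity.
move=> N m hN; have NR : 0 < N%:R :> R by rewrite ltr0n; apply: leq_trans hN.
have Nk : N%:R^-1 <= k0.
  rewrite -[leRHS]invrK lef_pV2 ?posrE ?invr_gt0 //; apply/ltW.
  by apply: lt_le_trans (truncnS_gt _) _; rewrite ler_nat.
have [] := hD 1 (X N m) ler01 (lexx 1).
rewrite /seg rmorph1 !mul1r (_ : 1 + (r - 1) = r); last by ring.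
rewrite -mulrDr -rmorphD => hz hp hrD _ _.
set Y := 1 + `|_| in hz hp *; set z := r * _ in hz hp *.
have Y1 : 1 <= Y by rewrite /Y; have := normr_ge0 (X N m); lra.
have NV : 0 < N%:R^-1 :> R by rewrite invr_gt0.
have hE (s : C) : cm s = N%:R^-1 -> cm (r * s) <= N%:R^-1 * D * Y.
  move=> hs; rewrite cmM hs mulrC -mulrA ler_pM2l //; apply: le_trans hrD _.
  by rewrite ler_peMr //; lra.
have e1 : cm (N%:R^-1%:C%C : C) = N%:R^-1 by rewrite cm_real gtr0_norm.
have e2 : cm (- N%:R^-1%:C%C : C) = N%:R^-1 by rewrite cmN.
have n1 := h1 _ Y z _ NV Nk Y1 hz hp (hE _ e1).
have n2 := h1 _ Y z _ NV Nk Y1 hz hp (hE _ e2).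
have -> : r * (X N (m + 1) + al)%:C%C = z + r * N%:R^-1%:C%C.
  by rewrite /z /X -mulrDr -rmorphD intrD mulrDl mul1r; congr (r * _%:C%C); ring.
have -> : r * (X N (m - 1) + al)%:C%C = z + r * - N%:R^-1%:C%C.
  by rewrite /z /X -rmorphN -mulrDr -rmorphD intrB mulrBl mul1r; congr (r * _%:C%C); ring.
set A := phi (z + r * N%:R^-1%:C%C) in n1 *.
set A' := phi (z + r * - N%:R^-1%:C%C) in n2 *.
have -> : A + A' - 2 * phi z = (A - phi z - r * N%:R^-1%:C%C * dphi z) +
   (A' - phi z - r * - N%:R^-1%:C%C * dphi z) by ring.
apply: le_trans (cmD _ _) _.
have hY : Y ^- 3 <= Y ^- 2 by rewrite lef_pV2 ?posrE ?exprn_gt0 //; [apply: ler_weXn2l | lra | lra].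
have : N%:R ^- 2 * c * Y ^- 3 <= N%:R ^- 2 * c * Y ^- 2 by rewrite ler_pM2l //; positivity.
move: n1 n2; rewrite exprVn; lra.
Qed.

(* Two discrete summations by parts give the decay k^-2 uniformly in the mesh. *)
Lemma S_bound (r : C) (al : R) : in_cone r -> exists c N0, [/\ 0 < c, (0 < N0)%N &
  forall (N : nat) (k : int), (N0 <= N)%N -> `|k%:~R| <= N%:R / 2 :> R ->
    cm (S r al N k) <= c * wt 1 k].
Proof.
move=> hr; have [c1 [N0 [c10 N00 h2]]] := second_difference al hr.
have [c2 c20 h0] := phi_wt al hr.
exists (24 * c1 + 3 * c2), N0; split => //; first by lra.
move=> N k NN0 kN.
have N0' : (0 < N)%N by apply: leq_trans NN0.
have NR : 0 < N%:R :> R by rewrite ltr0n.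
have N1 : 1 <= N%:R :> R by rewrite ler1n.
pose g m := phi (r * (X N m + al)%:C%C); pose u m := ee (k%:~R * X N m).
have agu : asum (fun m => g m * u m) by apply: phi_asum => // m; exact: cm_ee.
have SE : S r al N k = csum (fun m => N%:R^-1 * (g m * u m)) by rewrite csumZ.
have wt1 : wt 1 k = (1 + `|k%:~R|) ^- 2 :> R by rewrite /wt invr1 mul1r mulr1.
have [kE|k0] := eqVneq k 0.
  rewrite wt1 (_ : k%:~R = 0) ?kE ?mulr0z // -?kE normr0 addr0 expr1n invr1 mulr1.
  have h m : cm (N%:R^-1 * (g m * u m)) <= c2 * wt N%:R m.
    rewrite cmM cmV cm_nat cmM [cm (u m)]cm_ee mulr1 wtE mulrCA ler_pM2l ?invr_gt0 //; exact: h0.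
  have [_] := csum_le_wt N1 (ltW c20) h; rewrite -SE; lra.
pose G (m : int) : C := g (m + 1) + g (m - 1) - 2 * g m.
pose om : C := ee (k%:~R / N%:R); pose om' : C := ee (- (k%:~R / N%:R)).
have oo : om * om' = 1 by rewrite /om /om' -eeD subrr ee0.
have uS m : u (m + 1) = u m * om.
  by rewrite /u /om -eeD; congr ee; rewrite /X intrD; ring.
have uP m : u (m - 1) = u m * om'.
  by rewrite /u /om' -eeD; congr ee; rewrite /X intrB; ring.
(* Shifting the summation index moves the second difference from [g] to the character, where it is
   multiplication by om + om' - 2. *)
have E : csum (fun m => N%:R^-1 * (G m * u m)) = (om + om' - 2) * S r al N k.
  have h0' := asum_hasum agu.
  have h1 := asum_hasum (asum_shift 1 agu); have h2' := asum_hasum (asum_shift (-1) agu).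
  rewrite (csum_shift 1 agu) in h1; rewrite (csum_shift (-1) agu) in h2'.
  have := csumE (hasumZ N%:R^-1 (hasumD (hasumD (hasumZ om' h1) (hasumZ om h2')) (hasumZ (-2) h0'))).
  pose v := csum (fun m => g m * u m); rewrite -/v => E1; transitivity (N%:R^-1 * (om' * v + om * v + -2 * v)); last first.
    by rewrite (_ : S r al N k = N%:R^-1 * v) //; ring.
  rewrite -E1; congr csum; apply/funext => m; congr (_ * _); rewrite uS uP /G.
  have -> : om' * (g (m + 1) * (u m * om)) = om * om' * (g (m + 1) * u m) by ring.
  have -> : om * (g (m - 1) * (u m * om')) = om * om' * (g (m - 1) * u m) by ring.
  by rewrite oo; ring.
have h m : cm (N%:R^-1 * (G m * u m)) <= N%:R ^- 2 * c1 * wt N%:R m.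
  rewrite cmM cmV cm_nat cmM [cm (u m)]cm_ee mulr1 wtE mulrCA ler_pM2l ?invr_gt0 //; exact: h2.
have Nc : 0 <= N%:R ^- 2 * c1 by positivity.
have [_] := csum_le_wt N1 Nc h; rewrite E cmM => hE.
have kk : 1 <= `|k%:~R| :> R by rewrite -intr_norm ler1z -gtz0_ge1 normr_gt0.
(* Here |k| <= N/2 enters: beyond it the character would approach 1 again and the factor om + om' -
   2 degenerate. *)
have x12 : `|k%:~R / N%:R| <= 1 / 2 :> R.
  by rewrite normrM normfV normr_nat ler_pdivrMr // mulrC mulrA mulr1.
have := cm_eeD x12; rewrite -/om -/om' => ho.
have S0 := cm_ge0 (S r al N k).
have h3 : (k%:~R / N%:R) ^+ 2 * cm (S r al N k) <= 3 * (N%:R ^- 2 * c1).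
  by apply: le_trans hE; rewrite ler_wpM2r.
have h4 : `|k%:~R| ^+ 2 * cm (S r al N k) <= 3 * c1.
  rewrite real_normK ?num_real //.
  have := ler_wpM2l (exprn_ge0 2 (ltW NR)) h3.
  have -> : N%:R ^+ 2 * (3 * (N%:R ^- 2 * c1)) = 3 * c1 by field; rewrite gt_eqF.
  by have -> : N%:R ^+ 2 * ((k%:~R / N%:R) ^+ 2 * cm (S r al N k)) = k%:~R ^+ 2 * cm (S r al N k) by field; rewrite gt_eqF.
rewrite wt1 ler_pdivlMr; last by apply: exprn_gt0; lra.
set y := `|_| in kk h4 *; set s := cm _ in S0 h4 *.
have : s * (1 + y) ^+ 2 <= s * (4 * y ^+ 2) by rewrite ler_wpM2l //; nra.
nra.
Qed.

(** Summing over N consecutive frequencies leaves the mesh points with m divisible by N, that is the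
    integers: an exact identity, for any starting frequency. *)
Lemma finite_poisson (r : C) (al : R) (N : nat) (K : int) : in_cone r -> (0 < N)%N ->
  csum (fun n : int => phi (r * (n%:~R + al)%:C%C)) = \sum_(j < N) S r al N ((j : nat)%:Z - K).
Proof.
move=> hr N0; have NR : 0 < N%:R :> R by rewrite ltr0n.
have NC : (N%:R : C) != 0 by rewrite pnatr_eq0 -lt0n.
pose g m := phi (r * (X N m + al)%:C%C).
have ag : asum g.
  have := @phi_asum r al (fun=> 1) N hr N0 (fun=> cm1).
  by congr asum; apply/funext => m; rewrite mulr1.
pose F m := if (N %| m)%Z then g m else 0.
have -> : csum (fun n : int => phi (r * (n%:~R + al)%:C%C)) = csum F.
  rewrite -(@csum_inj _ _ _ (fun n : int => n * N%:Z) F).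
  - congr csum; apply/funext => n; rewrite /F dvdz_mull // /g /X intrM mulfK //.
    by rewrite gt_eqF.
  - by move=> i j /mulIf; apply; rewrite eqz_nat -lt0n.
  - by apply: (asum_le _ ag) => m; rewrite /F; case: ifP; rewrite // cm0 cm_ge0.
  - move=> m hm; rewrite /F; case: ifP => // /dvdzP[n mE]; by case: (hm n).
rewrite /S -mulr_sumr -csum_sum -?csumZ.
- congr csum; apply/funext => m; rewrite -mulr_sumr /F -/(g m).
  transitivity (N%:R^-1 * g m * (ee (- (K%:~R * X N m)) * \sum_(j < N) ee ((j : nat)%:R * (m%:~R / N%:R)))).
    rewrite ee_sum //; case: ifP => [/dvdzP[n mE]|_]; last by rewrite !mulr0.
    rewrite /X mE intrM mulfK ?gt_eqF // -intrM -mulrNz ee_int mul1r.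
    by rewrite mulrAC mulVf ?mul1r.
  rewrite -mulrA; congr (_ * (_ * _)); rewrite mulr_sumr; apply: eq_bigr => j _.
  rewrite -eeD; congr ee; rewrite intrB /X; ring.
- by apply: asum_sum => j; apply: phi_asum => // m; exact: cm_ee.
- by move=> j; apply: phi_asum => // m; exact: cm_ee.
Qed.

Let L N : C := N%:R^-1 * csum (fun m => phi (X N m)%:C%C).
Let coef (r : C) (al : R) (k : int) : C := phi (k%:~R / r) * ee (- (k%:~R * al)).

Lemma in_cone1 : in_cone (1 : C).
Proof. by rewrite /in_cone /= normr0. Qed.

Lemma in_coneV (r : C) : in_cone r -> in_cone r^-1.
Proof.
rewrite /in_cone; case: r => a b /= h; have a0 := le_lt_trans (normr_ge0 b) h.
have d0 : 0 < a ^+ 2 + b ^+ 2 by rewrite ltr_wpDr ?sqr_ge0 // exprn_gt0.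
by rewrite normrN normrM normfV (gtr0_norm d0) ltr_pM2r // invr_gt0.
Qed.

Lemma in_cone_neq0 (r : C) : in_cone r -> r != 0.
Proof. by apply: contraTneq => ->; rewrite /in_cone /= normr0 ltxx. Qed.

Lemma coef_asum (r : C) al : in_cone r -> asum (coef r al).
Proof.
move=> hr; have := @phi_asum r^-1 0 (fun k => ee (- (k%:~R * al))) 1 (in_coneV hr) isT (fun=> cm_ee _).
congr asum; apply/funext => k; congr (phi _ * _).
by rewrite addr0 /X divr1 rmorph_int mulrC.
Qed.

(** Completing the square: phi(r(x + al)) e(kx) is [coef] times the Gaussian shifted by r al - i k /
    r, to which [riemann_limit] applies. *)
Lemma S_coef (r : C) al N k : in_cone r ->
  r * S r al N k = coef r al k *
   (N%:R^-1 * csum (fun m => r * phi (r * (X N m)%:C%C + (r * al%:C%C - Complex 0 1 * k%:~R / r)))).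
Proof.
move=> hr; have r0 := in_cone_neq0 hr; have rr : in_cone r := hr.
have [->|N0] := posnP N; first by rewrite /S invr0 !mul0r !mulr0.
rewrite /S !(mulrCA _ N%:R^-1); congr (_ * _).
rewrite -!csumZ.
- congr csum; apply/funext => m; rewrite [RHS]mulrCA; congr (r * _).
  rewrite /coef /phi /ee -!cexpD; congr cexp.
  have e2 (x : R) : Complex 0 (2 * pi * x) = 2 * pi%:C%C * Complex 0 1 * x%:C%C :> C.
    by apply: complexP => /=; ring.
  have i2 : Complex 0 1 ^+ 2 = -1 :> C by apply: complexP => /=; ring.
  rewrite !e2; move: (pi%:C%C) => p.
  have -> : (X N m + al)%:C%C = (X N m)%:C%C + al%:C%C :> C by rewrite rmorphD.
  have -> : (- (k%:~R * al))%:C%C = - (k%:~R * al%:C%C) :> C by rewrite rmorphN rmorphM /= rmorph_int.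
  have -> : (k%:~R * X N m)%:C%C = k%:~R * (X N m)%:C%C :> C by rewrite rmorphM /= rmorph_int.
  move: i2; set i := Complex 0 1; move: ((X N m)%:C%C) (al%:C%C) (k%:~R : C) => x a n i2.
  have -> : - p * (r * x + (r * a - i * n / r)) ^+ 2 =
     - p * r ^+ 2 * (x + a) ^+ 2 + 2 * p * i * n * (x + a) - p * i ^+ 2 * (n / r) ^+ 2.
    by field.
  rewrite i2; ring.
- have [c c0 hc] := phi_wt 0 in_cone1.
  have [c1 [N1 _]] := riemann_limit (r * al%:C%C - Complex 0 1 * k%:~R / r) hr.
  have [k0 [c' [k00 c'0 [hb hs]]]] := hseg_step (r * al%:C%C - Complex 0 1 * k%:~R / r) hr.
  have Nn : 1 <= N%:R :> R by rewrite ler1n.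
  have Nc : 0 <= N%:R * c' by positivity.
  have [] // := csum_le_wt (f := fun m => r * phi (r * (X N m)%:C%C + (r * al%:C%C - Complex 0 1 * k%:~R / r))) Nn Nc.
  move=> m; have [h _] := hb 1 (X N m) ler01 (lexx 1).
  rewrite wtE (_ : N%:R * c' * _ = c' * (1 + `|X N m|) ^- 2); last first.
    by rewrite mulrACA mulfV ?mul1r // gt_eqF // ltr0n.
  apply: le_trans h; rewrite /hseg /seg rmorph1 !mul1r.
  by rewrite (_ : 1 + (r - 1) = r) //; ring.
- by apply: phi_asum => // m; exact: cm_ee.
Qed.

Lemma L_bound : exists2 c : R, 0 < c & forall N, (0 < N)%N -> cm (L N) <= c.
Proof.
have [c c0 hc] := phi_wt 0 in_cone1; exists (3 * c); first by positivity.
move=> N N0; have N1 : 1 <= N%:R :> R by rewrite ler1n.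
have NR : 0 < N%:R :> R by rewrite ltr0n.
have h m : cm (N%:R^-1 * phi (X N m)%:C%C) <= c * wt N%:R m.
  rewrite cmM cmV cm_nat wtE mulrCA ler_pM2l ?invr_gt0 //.
  by have := hc N m; rewrite mul1r addr0.
have [_] := csum_le_wt N1 (ltW c0) h; rewrite csumZ //.
have := @phi_asum 1 0 (fun=> 1) N in_cone1 N0 (fun=> cm1).
by congr asum; apply/funext => m; rewrite mulr1 mul1r addr0.
Qed.

(** Tannery's theorem in the frequency: each term converges by [S_coef] and [riemann_limit], and
    [S_bound] dominates. *)
Lemma poisson_L (r : C) (al : R) : in_cone r -> forall e : R, 0 < e ->
  exists N0, forall K, (N0 <= K)%N ->
  cm (r * csum (fun n : int => phi (r * (n%:~R + al)%:C%C)) - L (2 * K + 1) * csum (coef r al)) <= e.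
Proof.
move=> hr e e0; have [c [N0 [c0 N00 hS]]] := S_bound al hr.
have [cL cL0 hL] := L_bound; have ac := coef_asum al hr.
(* An odd mesh size makes the frequencies |k| <= N0 + n a window of exactly N values, all below
   N/2. *)
pose N n := (2 * (N0 + n) + 1)%N.
pose inr n (k : int) := (`|k|%N <= N0 + n)%N.
pose f n (k : int) : C := (if inr n k then r * S r al (N n) k else 0) - L (N n) * coef r al k.
have hN n : (N0 <= N n)%N by rewrite /N; lia.
have Nn0 n : (0 < N n)%N by rewrite /N addn1.
have inrP n k : inr n k -> `|k%:~R| <= (N n)%:R / 2 :> R.
  rewrite /inr /N => h; rewrite ler_pdivlMr // -intr_norm -[2]/(2%:~R) -intrM -[X in _ <= X]/(((2 * (N0 + n) + 1)%N%:Z)%:~R) ler_int; lia.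
have [n0 hn0] : exists n0, forall n, (n0 <= n)%N -> cm (csum (f n)) <= e.
  apply: (tannery (h := fun k => cm r * (c * wt 1 k) + cL * cm (coef r al k))) e0.
  - apply: bsumD; last exact: bsumZ (ltW cL0) ac.
    by apply: bsumZ (cm_ge0 r) _; apply: bsumZ (ltW c0) _; exact: bsum_wt.
  - move=> n k; apply: le_trans (cmB _ _) _; apply: lerD; last first.
      by rewrite cmM ler_wpM2r ?cm_ge0 // hL.
    case: ifP => [hk|_]; last by rewrite cm0; positivity; apply: wt_ge0.
    by rewrite cmM ler_wpM2l ?cm_ge0 // hS // inrP.
  - move=> k d d0; pose w := r * al%:C%C - Complex 0 1 * k%:~R / r.
    have [c1 [N1 h1]] := riemann_limit w hr.
    pose M := (Num.truncn (cm (coef r al k) * `|c1| / d)).+1.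
    exists (`|k|%N + N1 + M)%N => n hn.
    have hk : inr n k by rewrite /inr; lia.
    rewrite /f hk S_coef // -/w [L _ * _]mulrC -mulrBr cmM.
    have n1 : (N1 <= N n)%N by rewrite /N; lia.
    have n2 : (M <= N n)%N by rewrite /N; lia.
    apply: (le_trans (ler_wpM2l (cm_ge0 _) (h1 _ n1))).
    have NR : 0 < (N n)%:R :> R by rewrite ltr0n.
    apply: (@le_trans _ _ (cm (coef r al k) * `|c1| / (N n)%:R)).
      rewrite -[leRHS]mulrA ler_wpM2l ?cm_ge0 //.
      by rewrite ler_pM2r ?invr_gt0 // ler_norm.
    rewrite ler_pdivrMr // [leRHS]mulrC -ler_pdivrMr //; apply/ltW.
    by apply: lt_le_trans (truncnS_gt _) _; rewrite ler_nat.
exists (N0 + n0)%N => K hK; pose n := (K - N0)%N.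
have nE : (N0 + n)%N = K by rewrite /n; lia.
have := hn0 n; rewrite (_ : (n0 <= n)%N); last by rewrite /n; lia.
pose A : {fset int} := [fset (j%:Z - K%:Z) | j in iota 0 (2 * K + 1)]%fset.
have hA (i : int) : i \notin A -> (if inr n i then r * S r al (N n) i else 0) = 0.
  move=> iA; case: ifP => //; rewrite /inr nE => hi; case/negP: iA.
  apply/imfsetP; exists (absz (i + K%:Z)); first by rewrite /= mem_iota /=; lia.
  lia.
move=> /(_ isT); rewrite /f csumB; [|exact: asum_fin hA|exact: asumZ].
have K1 : (0 < 2 * K + 1)%N by rewrite addn1.
rewrite csumZ // (csum_fin hA) /N nE (@finite_poisson r al (2 * K + 1) K%:Z hr K1).
suff -> : \sum_(i <- A) (if inr n i then r * S r al (2 * K + 1) i else 0) =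
   r * \sum_(j < (2 * K + 1)%N) S r al (2 * K + 1) ((j : nat)%:Z - K%:Z) by [].
rewrite big_imfset /=; last by move=> ? ? _ _ /addIr[].
rewrite undup_id ?iota_uniq // mulr_sumr.
rewrite -[RHS](big_mkord xpredT (fun j => r * S r al (2 * K + 1) (j%:Z - K%:Z))).
rewrite /index_iota subn0; apply: eq_big_seq => j; rewrite mem_iota => /= jK.
by rewrite ifT // /inr nE; lia.
Qed.

(* [L N] is a Riemann sum of the Gaussian integral. That integral is never evaluated:
   [poisson_L] at [r = 1], [al = 0] forces the limit to be 1. *)
Lemma L_cvg (e : R) : 0 < e -> exists N0, forall K, (N0 <= K)%N -> cm (1 - L (2 * K + 1)) <= e.
Proof.
move=> e0; have E : csum (coef 1 0) = csum (fun n : int => phi (1 * (n%:~R + 0)%:C%C)).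
  congr csum; apply/funext => k; rewrite /coef mulr0 oppr0 ee0 mulr1 divr1 mul1r addr0.
  by rewrite rmorph_int.
pose h (k : int) : R := expR (- pi * k%:~R ^+ 2).
have hE : coef 1 0 = fun k => (h k)%:C%C.
  apply/funext => k; rewrite /coef mulr0 oppr0 ee0 mulr1 divr1 /phi -cexp_real; congr cexp.
  by rewrite rmorphM rmorphXn rmorphN /= rmorph_int.
have T1 : 1 <= cm (csum (coef 1 0)).
  apply: le_trans (cm_Re _); apply: le_trans (ler_norm _).
  rewrite hE; have := @csum_ge _ _ h [fset 0]%fset (fun k => expR_ge0 _).
  rewrite big_seq_fset1 /h expr0n mulr0 expR0; apply.
  by have := coef_asum 0 in_cone1; rewrite hE.
have [N0 hN] := poisson_L 0 in_cone1 e0; exists N0 => K /hN.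
rewrite -E mul1r -[X in X - _]mul1r -mulrBl cmM; apply: le_trans.
by rewrite ler_peMr ?cm_ge0.
Qed.

(** [L_cvg] replaces the mesh factor in [poisson_L] by 1; reflecting k to -k changes the sign in the
    character. *)
Lemma poisson (r : C) (al : R) : in_cone r ->
  r * csum (fun n : int => phi (r * (n%:~R + al)%:C%C)) =
  csum (fun k : int => phi (k%:~R / r) * ee (k%:~R * al)).
Proof.
move=> hr; have -> : csum (fun k : int => phi (k%:~R / r) * ee (k%:~R * al)) = csum (coef r al).
  rewrite -(@csum_bij _ _ _ (fun k : int => - k) (fun k => - k) (coef r al)) //; try exact: opprK.
  congr csum; apply/funext => k; rewrite /coef !mulrNz !mulNr opprK; congr (_ * _).
    by rewrite /phi sqrrN.
  exact: coef_asum.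
apply/eqP; rewrite -subr_eq0 -cm_eq0 eq_le cm_ge0 andbT.
apply/ler_addgt0Pr => e e0; rewrite add0r.
set P := _ * _; set Q := csum _.
have Q0 := cm_ge0 Q; have e2 : 0 < e / 2 by rewrite divr_gt0.
have [N1 h1] := poisson_L al hr e2.
have e3 : 0 < e / 2 / (1 + cm Q) by rewrite divr_gt0 // ltr_pwDl.
have [N2 h2] := L_cvg e3.
pose K := maxn N1 N2.
have {}h1 := h1 K (leq_maxl _ _); have {}h2 := h2 K (leq_maxr _ _).
have -> : P - Q = (P - L (2 * K + 1) * Q) - (1 - L (2 * K + 1)) * Q by ring.
apply: le_trans (cmB _ _) _; rewrite cmM.
have : cm (1 - L (2 * K + 1)) * (1 + cm Q) <= e / 2 by rewrite -ler_pdivlMr // ltr_pwDl.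
have := cm_ge0 (1 - L (2 * K + 1)); rewrite -/P -/Q in h1; lra.
Qed.

End Poisson.

(** * Theta functions *)

Section Theta.
Context {R : realType}.
Local Notation C := R[i].
Local Notation H := (@upper_half_plane R).
Local Notation i := (Complex 0 1 : C).

Definition pii : C := Complex 0 pi.

(** The characteristic [al] shifts the lattice in [Th] and twists by a character in [Ths]; inversion
    exchanges the two. *)
Definition Th (al : R) (t : C) : C :=
  csum (fun n : int => cexp (pii * t * (n%:~R + al%:C%C) ^+ 2)).
Definition Ths (al : R) (t : C) : C :=
  csum (fun n : int => cexp (pii * t * n%:~R ^+ 2) * ee (n%:~R * al)).

Definition rr (t : C) : C := sqrtc (Complex 0 (-1) * t).

Lemma HE t : H t = (0 < complex.Im t) :> Prop. Proof. by []. Qed.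

Lemma H_neq0 t : H t -> t != 0.
Proof. by apply: contraPneq => ->; rewrite HE ltxx. Qed.

Lemma H_inv t : H t -> H (- t^-1).
Proof.
rewrite !HE; case: t => a b /= b0; rewrite opprK divr_gt0 //.
by rewrite ltr_wpDl ?sqr_ge0 // exprn_gt0.
Qed.

Lemma H_scale (l : R) t : 0 < l -> H t -> H (l%:C%C * t).
Proof. by rewrite !HE => l0 t0; rewrite ImM /= mul0r addr0 mulr_gt0. Qed.

Lemma H_nat n t : (0 < n)%N -> H t -> H (n%:R * t).
Proof. by move=> n0 /(H_scale (l := n%:R)); rewrite rmorph_nat ltr0n; apply. Qed.

Lemma H_addR (x : R) t : H t -> H (t + x%:C%C).
Proof. by rewrite !HE ImD /= addr0. Qed.

Lemma H_add1 t : H t -> H (t + 1).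
Proof. by move/(H_addR 1); rewrite rmorph1. Qed.

Lemma i_sqr : i ^+ 2 = -1.
Proof. by apply: complexP => /=; ring. Qed.

Lemma rr_sqr t : rr t ^+ 2 = - i * t.
Proof. by rewrite sqr_sqrtc; congr (_ * _); apply: complexP; rewrite /= ?oppr0. Qed.

Lemma rr_cone t : H t -> in_cone (rr t).
Proof.
move=> ht; have Re_ge0 : 0 <= complex.Re (rr t).
  by rewrite /rr /sqrtc; case: (Complex 0 (-1) * t) => a b /=; exact: sqrtr_ge0.
have : complex.Re (rr t ^+ 2) = complex.Im t.
  by rewrite rr_sqr ReM ReN ImN /=; ring.
rewrite expr2 ReM /in_cone => hE; rewrite HE -hE in ht.
have : `|complex.Im (rr t)| * `|complex.Im (rr t)| = complex.Im (rr t) * complex.Im (rr t).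
  by rewrite -!expr2 real_normK ?num_real.
have := normr_ge0 (complex.Im (rr t)); nra.
Qed.

(** The cone contains at most one of two opposite numbers, so identities between values of [rr] may
    be checked on squares. *)
Lemma cone_inj (r s : C) : in_cone r -> in_cone s -> r ^+ 2 = s ^+ 2 -> r = s.
Proof.
move=> hr hs /eqP; rewrite eqf_sqr => /orP[/eqP //|/eqP E]; exfalso.
have := le_lt_trans (normr_ge0 _) hr; have := le_lt_trans (normr_ge0 _) hs.
rewrite E ReN; lra.
Qed.

Lemma rr_inv t : H t -> rr (- t^-1) = (rr t)^-1.
Proof.
move=> ht; apply: cone_inj; first exact/rr_cone/H_inv.
  exact/in_coneV/rr_cone.
have t0 := H_neq0 ht; have i0 : i != 0 by rewrite eq_complex /= oner_eq0 andbF.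
rewrite exprVn !rr_sqr; apply: (mulfI (_ : - i * t != 0)).
  by rewrite mulf_neq0 // oppr_eq0.
rewrite divff ?mulf_neq0 ?oppr_eq0 // mulrACA mulrNN -expr2 i_sqr mulrN divff //; ring.
Qed.

Lemma rr_scale (l : R) t : 0 < l -> H t -> rr (l%:C%C * t) = (Num.sqrt l)%:C%C * rr t.
Proof.
move=> l0 ht; have s0 : 0 < Num.sqrt l by rewrite sqrtr_gt0.
apply: cone_inj; first exact/rr_cone/H_scale.
  have := rr_cone ht; rewrite /in_cone ReM ImM /= !mul0r subr0 addr0 normrM gtr0_norm //.
  by rewrite ltr_pM2l.
by rewrite exprMn !rr_sqr -rmorphXn sqr_sqrtr ?ltW //=; ring.
Qed.

Lemma rr_neq0 t : H t -> rr t != 0.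
Proof. by move=> ht; exact/in_cone_neq0/rr_cone. Qed.

Lemma piiE : pii = pi%:C%C * i.
Proof. by apply: complexP => /=; ring. Qed.

Lemma theta_term t (x : C) : cexp (pii * t * x ^+ 2) = phi (rr t * x).
Proof. by rewrite /phi exprMn rr_sqr piiE; congr cexp; ring. Qed.

Lemma theta_asum t al (u : int -> C) : H t -> (forall n, cm (u n) = 1) ->
  asum (fun n : int => cexp (pii * t * (n%:~R + al%:C%C) ^+ 2) * u n).
Proof.
move=> ht hu; have := phi_asum al (rr_cone ht) isT hu (N := 1).
congr asum; apply/funext => n; rewrite theta_term; congr (phi (_ * _) * _).
by rewrite divr1 rmorphD /= rmorph_int.
Qed.

Lemma Th_asum t al : H t -> asum (fun n : int => cexp (pii * t * (n%:~R + al%:C%C) ^+ 2)).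
Proof.
move=> ht; have := @theta_asum t al (fun=> 1) ht (fun=> cm1).
by congr asum; apply/funext => n; rewrite mulr1.
Qed.

Lemma Ths_asum t al : H t -> asum (fun n : int => cexp (pii * t * n%:~R ^+ 2) * ee (n%:~R * al)).
Proof.
move=> ht; have := @theta_asum t 0 (fun n => ee (n%:~R * al)) ht (fun=> cm_ee _).
by congr asum; apply/funext => n; rewrite addr0.
Qed.

(** Poisson summation at [r = rr t], where r^2 = -it. *)
Lemma Th_inversion al t : H t -> rr t * Th al t = Ths al (- t^-1).
Proof.
move=> ht; have := poisson al (rr_cone ht); congr (_ * _ = _).
  congr csum; apply/funext => n; rewrite theta_term; congr (phi (_ * _)).
  by rewrite rmorphD /= rmorph_int.
congr csum; apply/funext => n; rewrite theta_term rr_inv //; congr (phi _ * _).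
by rewrite mulrC.
Qed.

Definition th2 := Th 2^-1.
Definition th3 := Th 0.
Definition th4 := Ths 2^-1.

Lemma th3E t : th3 t = Ths 0 t.
Proof.
by congr csum; apply/funext => n; rewrite addr0 mulr0 ee0 mulr1.
Qed.

Lemma th2_S t : H t -> th2 (- t^-1) = rr t * th4 t.
Proof.
move=> ht; have := Th_inversion 2^-1 (H_inv ht).
rewrite invrN opprK invrK rr_inv // /th4 => <-.
by rewrite mulrA mulfV ?mul1r //; exact: rr_neq0.
Qed.

Lemma th4_S t : H t -> th4 (- t^-1) = rr t * th2 t.
Proof. by move=> ht; rewrite Th_inversion. Qed.

Lemma th3_S t : H t -> th3 (- t^-1) = rr t * th3 t.
Proof. by move=> ht; rewrite Th_inversion // th3E. Qed.

Lemma cexp_ee (x : R) : cexp (pii * x%:C%C) = ee (x / 2).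
Proof.
by rewrite /ee; congr cexp; apply: complexP => /=; field.
Qed.

Lemma Th_translate al t (x y : R) :
  (forall n : int, ee ((n%:~R + al) ^+ 2 * x / 2) = ee y) -> H t ->
  Th al (t + x%:C%C) = ee y * Th al t.
Proof.
move=> hx ht; rewrite -csumZ; last exact: Th_asum.
congr csum; apply/funext => n; rewrite mulrDr mulrDl cexpD mulrC; congr (_ * _).
rewrite -(hx n) -cexp_ee; congr cexp.
by rewrite rmorphM rmorphXn rmorphD /= rmorph_int; ring.
Qed.

Lemma ee_addint (x : R) (n : int) : ee (x + n%:~R) = ee x.
Proof. by rewrite eeD ee_int mulr1. Qed.

Lemma even_succ (n : int) : exists m : int, n * (n + 1) = 2 * m.
Proof.
have [m [->|->]] : exists m : int, n = 2 * m \/ n = 2 * m + 1.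
- by exists (n %/ 2)%Z; lia.
- by exists (m * (2 * m + 1)); ring.
- by exists ((2 * m + 1) * (m + 1)); ring.
Qed.

(** (n + 1/2)^2 = n(n + 1) + 1/4 with n(n + 1) even. *)
Lemma th2_T t : H t -> th2 (t + 1) = ee 8^-1 * th2 t.
Proof.
move=> ht; have := @Th_translate 2^-1 t 1 8^-1 _ ht; rewrite rmorph1; apply=> n.
have [m hm] := even_succ n; rewrite -[RHS](ee_addint _ m); congr ee.
have : n%:~R * (n%:~R + 1) = 2 * m%:~R :> R.
  by rewrite -[1]/(1%:~R) -[2]/(2%:~R) -intrD -!intrM hm.
lra.
Qed.

Lemma ee_half_sqr (n : int) : ee (n%:~R ^+ 2 / 2 : R) = ee (n%:~R * 2^-1).
Proof.
have [m hm] := even_succ (n - 1); rewrite -[RHS](ee_addint _ m); congr ee.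
have : (n%:~R - 1) * n%:~R = 2 * m%:~R :> R.
  by rewrite -[X in _ - X]/(1%:~R) -[2]/(2%:~R) -intrB -!intrM -hm subrK.
lra.
Qed.

Lemma th3_T t : H t -> th3 (t + 1) = th4 t.
Proof.
move=> ht; congr csum; apply/funext => n; rewrite addr0 mulrDr mulrDl cexpD mulr1.
congr (_ * _); rewrite -ee_half_sqr -cexp_ee; congr cexp.
by rewrite rmorphXn /= rmorph_int.
Qed.

Lemma th4_T t : H t -> th4 (t + 1) = th3 t.
Proof.
move=> ht; congr csum; apply/funext => n; rewrite addr0 mulrDr mulrDl cexpD mulr1.
rewrite -[RHS]mulr1 -mulrA; congr (_ * _).
rewrite -ee_half_sqr (_ : n%:~R ^+ 2 = (n%:~R ^+ 2)%:C%C); last by rewrite rmorphXn /= rmorph_int.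
rewrite cexp_ee -eeD (_ : _ + _ = (n ^+ 2)%:~R) ?ee_int //.
by rewrite rmorphXn /=; lra.
Qed.

End Theta.

(** * Identities between [Psi], [calF] and theta constants *)

Section Identities.
Context {R : realType}.
Local Notation C := R[i].
Local Notation H := (@upper_half_plane R).

Lemma csum_mod (M : nat) (f : int -> C) : (0 < M)%N -> asum f ->
  csum f = \sum_(s < M) csum (fun j : int => f (j * M%:Z + (s : nat)%:Z)).
Proof.
move=> M0 hf.
have E n : f n = \sum_(s < M) if (M %| n - (s : nat)%:Z)%Z then f n else 0.
  have m0 : (0 <= n %% M)%Z by apply: modz_ge0; rewrite -lt0n.
  have m1 : (n %% M < M)%Z by apply: ltz_pmod.
  have s0 : (`|(n %% M)%Z| < M)%N by lia.
  rewrite (bigD1 (Ordinal s0)) //= big1 ?addr0.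
    by rewrite ifT // gez0_abs // {1}(divz_eq n M) addrK dvdz_mull.
  move=> s; rewrite -val_eqE /= => sn; case: ifP => // /dvdzP[k nk].
  case/negP: sn; apply/eqP.
  have -> : n = k * M%:Z + (s : nat)%:Z by rewrite -nk subrK.
  by rewrite modzMDl modz_small ?absz_nat // lez_nat ltz_nat ltn_ord.
rewrite {1}(_ : f = fun n => \sum_(s < M) if (M %| n - (s : nat)%:Z)%Z then f n else 0); last exact/funext.
rewrite csum_sum => [|s]; last by apply: (asum_le _ hf) => n; case: ifP; rewrite // cm0 cm_ge0.
apply: eq_bigr => s _; rewrite -(@csum_inj _ _ _ (fun j : int => j * M%:Z + (s : nat)%:Z)).
- by congr csum; apply/funext => j; rewrite addrK dvdz_mull.
- by move=> j k /addIr/mulIf; apply; rewrite eqz_nat -lt0n.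
- by apply: (asum_le _ hf) => n; case: ifP; rewrite // cm0 cm_ge0.
- move=> n hn; case: ifP => // /dvdzP[k nk]; case: (hn k); by rewrite -nk subrK.
Qed.

Lemma qE (t : C) : q t = cexp (2 * (pii * t)).
Proof.
rewrite /q (_ : Complex 0 (2 * pi) = 2 * pii) ?mulrA //.
by rewrite piiE; apply: complexP => /=; ring.
Qed.

Lemma q_T (t : C) : q (t + 1) = q t.
Proof.
rewrite (qE (t + 1)) (qE t).
have -> : 2 * (pii * (t + 1)) = 2 * (pii * t) + pii * 2%:C%C by rewrite rmorph_nat; ring.
by rewrite cexpD cexp_ee (_ : 2 / 2 = 1%:R) ?ee_nat ?mulr1 // divff.
Qed.

Lemma psi_term (t : C) (n : nat) :
  cexp (pii * t * ((n : int)%:~R + 2^-1%:C%C) ^+ 2) =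
  cexp (pii * t / 4) * q t ^+ ((n * n.+1)./2).
Proof.
rewrite qE -cexpMn -cexpD; congr cexp.
have hn : 2 * ((n * n.+1)./2)%:R = n%:R * (n%:R + 1) :> C.
  rewrite natr1 -!natrM; congr (_%:R); rewrite mul2n halfK oddM oddS.
  by case: (odd n); rewrite subn0.
have -> : (2^-1%:C%C : C) = 2^-1 by rewrite fmorphV rmorph_nat.
have -> : ((n : int)%:~R : C) = n%:R by [].
transitivity (pii * t * (2 * ((n * n.+1)./2)%:R + 1 / 4)); last by field.
by rewrite hn; field.
Qed.

Lemma psi_asum (t : C) : H t -> asum (fun n : nat => q t ^+ ((n * n.+1)./2)).
Proof.
move=> ht; have h := Th_asum 2^-1 ht.
have := asumZ (cexp (pii * t / 4))^-1 (asum_inj (h := Posz) (fun a b => _) h).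
move/(_ (fun a b : nat => fun E => congr1 absz E)); congr asum; apply/funext => n.
by rewrite psi_term mulrA mulVf ?mul1r // cexp_neq0.
Qed.

Lemma PsiE (t : C) : H t -> Psi t = csum (fun n : nat => q t ^+ ((n * n.+1)./2)).
Proof.
by move=> ht; apply: (@cvg_lim C^o) => //; apply: series_csum; exact: psi_asum.
Qed.

(** The indices n and -1 - n give equal terms, whence the factor 2. *)
Lemma th2_Psi (t : C) : H t -> th2 t = 2 * (cexp (pii * t / 4) * Psi t).
Proof.
move=> ht; rewrite PsiE // -csumZ; last exact: psi_asum.
rewrite /th2 /Th csum_int; last exact: Th_asum.
have E1 : (fun n => cexp (pii * t * ((Posz n)%:~R + 2^-1%:C%C) ^+ 2)) =
  fun n => cexp (pii * t / 4) * q t ^+ ((n * n.+1)./2).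
  by apply/funext => n; rewrite psi_term.
have E2 : (fun n => cexp (pii * t * ((Negz n)%:~R + 2^-1%:C%C) ^+ 2)) =
  fun n => cexp (pii * t / 4) * q t ^+ ((n * n.+1)./2).
  apply/funext => n; rewrite -psi_term; congr (cexp (_ * _)).
  rewrite -sqrrN; congr (_ ^+ 2); rewrite NegzE mulrNz opprD opprK.
  by rewrite -addn1 PoszD intrD fmorphV rmorph_nat; field.
by rewrite E1 E2; ring.
Qed.

Let Q (p : int * int) : int := p.1 ^+ 2 + p.1 * p.2 + p.2 ^+ 2.
Let f (t : C) (p : int * int) : C := q t ^ (Q p).

Let fE t p : f t p = cexp ((Q p)%:~R * (2 * (pii * t))).
Proof. by rewrite /f qE cexpMz. Qed.

Let QE (x y : int) : ((Q (x, y))%:~R : C) = x%:~R ^+ 2 + x%:~R * y%:~R + y%:~R ^+ 2.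
Proof. by rewrite /Q /= !rmorphD !rmorphXn /= rmorphM. Qed.

(** 2(x^2 + xy + y^2) >= x^2 + y^2, so a product of two theta series dominates. *)
Lemma calF_asum t : H t -> asum (f t).
Proof.
move=> ht; have h := Th_asum 0 ht.
apply: (asum_le _ (bsum_prod _ _ h h)) => [p|n|n]; rewrite ?cm_ge0 //.
rewrite fE !cm_cexp -expRD ler_expR.
have e1 (n : int) : complex.Re (pii * t * (n%:~R + 0%:C%C) ^+ 2) = - pi * complex.Im t * n%:~R ^+ 2.
  rewrite rmorph0 addr0 -(rmorph_int (real_complex R)) -rmorphXn ReM ReM ImM /=; ring.
rewrite !e1 -(rmorph_int (real_complex R)) ReM ReM ReM ImM /= /Q.
have -> : (p.1 ^+ 2 + p.1 * p.2 + p.2 ^+ 2)%:~R = p.1%:~R ^+ 2 + p.1%:~R * p.2%:~R + p.2%:~R ^+ 2 :> R.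
  by rewrite !rmorphD rmorphM !rmorphXn.
set x : R := p.1%:~R; set y : R := p.2%:~R.
have p0 : 0 < pi * complex.Im t by rewrite mulr_gt0 ?pi_gt0.
have := sqr_ge0 (x + y); nra.
Qed.

Lemma calFE t : H t -> calF t = csum (f t).
Proof. by move=> ht; apply: summability_sumE; exact: calF_asum. Qed.

Let part (P : pred (int * int)) t := csum (fun p => if P p then f t p else 0).

Let partD P t : H t -> asum (fun p => if P p then f t p else 0).
Proof.
move=> ht; apply: (asum_le _ (calF_asum ht)) => p.
by case: ifP; rewrite // cm0 cm_ge0.
Qed.

Let part_split (P1 P2 P : pred (int * int)) t : H t ->
  (forall p, P p = P1 p || P2 p) -> (forall p, ~~ (P1 p && P2 p)) ->
  part P t = part P1 t + part P2 t.
Proof.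
move=> ht hP h12; rewrite /part -csumD; try exact: partD.
congr csum; apply/funext => p; rewrite hP; have := h12 p.
by case: (P1 p); case: (P2 p); rewrite ?addr0 ?add0r.
Qed.

Let ev (x : int) := (2 %| x)%Z.

(** For y = 2Y the substitution x = X - Y diagonalises the form to X^2 + 3 Y^2; for odd y both
    variables become half-integral instead. *)
Let part_even t : H t -> part (fun p => ev p.2) t = th3 (2 * t) * th3 (6 * t).
Proof.
move=> ht; have h2 := H_nat (n := 2) isT ht; have h6 := H_nat (n := 6) isT ht.
rewrite /th3 /Th -csum_prod; try exact: Th_asum.
rewrite /part -(@csum_inj _ _ _ (fun p : int * int => (p.1 - p.2, 2 * p.2))); last first.
- move=> [x y] hn; rewrite /ev /=; case: ifP => // hy.
  by case: (hn (x + (y %/ 2)%Z, (y %/ 2)%Z)) => /=; congr pair; lia.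
- exact: partD.
- by move=> [a b] [c d] [] /=; move=> E1 E2; congr pair; lia.
congr csum; apply/funext => -[x y] /=; rewrite /ev dvdz_mulr // fE -cexpD; congr cexp.
rewrite QE rmorph0 !addr0 rmorphB rmorphM /=; ring.
Qed.

Let part_odd t : H t -> part (fun p => ~~ ev p.2) t = th2 (2 * t) * th2 (6 * t).
Proof.
move=> ht; have h2 := H_nat (n := 2) isT ht; have h6 := H_nat (n := 6) isT ht.
rewrite /th2 /Th -csum_prod; try exact: Th_asum.
rewrite /part -(@csum_inj _ _ _ (fun p : int * int => (p.1 - p.2, 2 * p.2 + 1))); last first.
- move=> [x y] hn; rewrite /ev /=; case: ifP => // hy.
  by case: (hn (x + (y %/ 2)%Z, (y %/ 2)%Z)) => /=; congr pair; lia.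
- exact: partD.
- by move=> [a b] [c d] [] /=; move=> E1 E2; congr pair; lia.
congr csum; apply/funext => -[x y] /=; rewrite /ev ifT; last by lia.
rewrite fE -cexpD; congr cexp.
rewrite QE fmorphV rmorph_nat rmorphB rmorphD rmorphM /=.
by move: (x%:~R : C) (y%:~R : C) => X Y; field.
Qed.

Lemma calF_theta t : H t -> calF t = th3 (2 * t) * th3 (6 * t) + th2 (2 * t) * th2 (6 * t).
Proof.
move=> ht; rewrite calFE // -part_even // -part_odd //.
rewrite -(@part_split _ _ predT) // => p; first by rewrite orbN.
by rewrite andbN.
Qed.

(** Automorphisms of the form permute the three nonzero classes of (x, y) modulo 2, which therefore
    contribute equally; the zero class gives [calF (4 * t)], and odd y covers two of the three. *)
Lemma calF_4 t : H t -> 3 * (th2 (2 * t) * th2 (6 * t)) = 2 * (calF t - calF (4 * t)).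
Proof.
move=> ht; have h4 := H_nat (n := 4) isT ht.
have e1 : calF t = part (fun p => ~~ ev p.2) t + part (fun p => ev p.2) t.
  by rewrite calFE // -(@part_split _ _ predT) // => p; rewrite ?orNb // andNb.
have e2 : part (fun p => ~~ ev p.2) t = part (fun p => ev p.1 && ~~ ev p.2) t + part (fun p => ~~ ev p.1 && ~~ ev p.2) t.
  by apply: part_split => // p; case: (ev p.1); case: (ev p.2).
have e3 : part (fun p => ev p.2) t = part (fun p => ev p.1 && ev p.2) t + part (fun p => ~~ ev p.1 && ev p.2) t.
  by apply: part_split => // p; case: (ev p.1); case: (ev p.2).
have e4 : part (fun p => ~~ ev p.1 && ev p.2) t = part (fun p => ev p.1 && ~~ ev p.2) t.
  rewrite /part -[RHS](@csum_bij _ _ _ (fun p : int * int => (p.2, p.1)) (fun p => (p.2, p.1))).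
  - congr csum; apply/funext => -[x y] /=; rewrite andbC; case: ifP => // _.
    by congr (_ ^ _); rewrite /Q /=; ring.
  - by case.
  - by case.
  - exact: partD.
(* The automorphism (x, y) -> (x + y, -y) of the form. *)
have e5 : part (fun p => ~~ ev p.1 && ~~ ev p.2) t = part (fun p => ev p.1 && ~~ ev p.2) t.
  rewrite /part -[RHS](@csum_bij _ _ _ (fun p : int * int => (p.1 + p.2, - p.2)) (fun p => (p.1 + p.2, - p.2))).
  - congr csum; apply/funext => -[x y] /=.
    have -> : ev (x + y) && ~~ ev (- y) = ~~ ev x && ~~ ev y by rewrite /ev; lia.
    by case: ifP => // _; congr (_ ^ _); rewrite /Q /=; ring.
  - by case=> x y /=; rewrite opprK addrK.
  - by case=> x y /=; rewrite opprK addrK.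
  - exact: partD.
have e6 : part (fun p => ev p.1 && ev p.2) t = calF (4 * t).
  rewrite calFE // /part -(@csum_inj _ _ _ (fun p : int * int => (2 * p.1, 2 * p.2))) /=.
  - congr csum; apply/funext => -[x y]; rewrite /ev !dvdz_mulr //= !fE; congr cexp.
    by rewrite !QE !rmorphM /=; ring.
  - by move=> [a b] [c d] [] /=; move=> E1 E2; congr pair; lia.
  - exact: partD.
  - move=> [x y] hn; rewrite /ev /=; case: ifP => // /andP[hx hy].
    by case: (hn ((x %/ 2)%Z, (y %/ 2)%Z)) => /=; congr pair; lia.
rewrite e1 -part_odd // e3 e4 e6 e2 e5; ring.
Qed.

Lemma calF_T t : H t -> calF (t + 1) = calF t.
Proof.
move=> ht; rewrite (calFE ht) (calFE (H_add1 ht)).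
have -> : f (t + 1) = f t; last by [].
by apply/funext => p; rewrite /f q_T.
Qed.

End Identities.

(** * Expansions in fractional powers of q, and holomorphy *)

Section Expansions.
Context {R : realType}.
Local Notation C := R[i].
Local Notation H := (@upper_half_plane R).

Definition qexpansion (r : nat) (g : C -> C) := exists b : nat -> C, forall t, H t ->
  asum (fun n => b n * q (t / r%:R) ^+ n) /\ csum (fun n => b n * q (t / r%:R) ^+ n) = g t.

Definition expandable (g : C -> C) := exists2 r, (0 < r)%N & qexpansion r g.

Lemma q_neq0 (t : C) : q t != 0.
Proof. exact: cexp_neq0. Qed.

(** Terms with equal exponents are collected along the fibres of [e], so an expansion may be indexed
    by any set. *)
Lemma qexpansion_family (I : choiceType) (e : I -> nat) (b : I -> C) r (g : C -> C) :
  (forall t, H t -> asum (fun i => b i * q (t / r%:R) ^+ e i) /\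
     csum (fun i => b i * q (t / r%:R) ^+ e i) = g t) -> qexpansion r g.
Proof.
move=> hb; exists (fun n => csum (fun i => if e i == n then b i else 0)) => t ht.
have [ab <-] := hb t ht.
have E n : csum (fun i => if e i == n then b i * q (t / r%:R) ^+ e i else 0) =
    csum (fun i => if e i == n then b i else 0) * q (t / r%:R) ^+ n.
  rewrite [RHS]mulrC -csumZ.
    by congr csum; apply/funext => i; case: eqP => [->|_]; rewrite ?mulr0 // mulrC.
  (* On a fibre the power of q is a constant nonzero factor, so it can be divided out. *)
  apply: (asum_le _ (asumZ (q (t / r%:R) ^- n) ab)) => i.
  case: eqP => [->|_]; last by rewrite cm0 cm_ge0.
  by rewrite mulrCA mulVf ?mulr1 // expf_neq0 // q_neq0.
rewrite -(csum_fibre e ab); split; last by congr csum; apply/funext => n.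
by have := asum_fibre e ab; congr asum; apply/funext => n.
Qed.

Lemma qexpansion_eq r (g g' : C -> C) : (forall t, H t -> g t = g' t) ->
  qexpansion r g -> qexpansion r g'.
Proof. by move=> E [b hb]; exists b => t ht; rewrite -E //; exact: hb. Qed.

Lemma expandable_eq (g g' : C -> C) : (forall t, H t -> g t = g' t) ->
  expandable g -> expandable g'.
Proof. by move=> E [r r0 h]; exists r => //; exact: qexpansion_eq h. Qed.

Lemma qexpansion_scale r m (g : C -> C) : (0 < r)%N -> (0 < m)%N ->
  qexpansion r g -> qexpansion (r * m) g.
Proof.
move=> r0 m0 [b hb]; apply: (@qexpansion_family _ (fun n => m * n)%N b) => t ht.
have E : (fun n => b n * q (t / (r * m)%:R) ^+ (m * n)) = fun n => b n * q (t / r%:R) ^+ n.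
  apply/funext => n; congr (_ * _); rewrite exprM; congr (_ ^+ _).
  rewrite (qE (t / (r * m)%:R)) (qE (t / r%:R)) -cexpMn; congr cexp.
  by rewrite natrM; field; rewrite !pnatr_eq0 -!lt0n r0 m0.
by rewrite E; exact: hb.
Qed.

Lemma expandable2 (g h : C -> C) : expandable g -> expandable h ->
  exists r, [/\ (0 < r)%N, qexpansion r g & qexpansion r h].
Proof.
move=> [r r0 hg] [s s0 hh]; exists (r * s)%N; split; first by rewrite muln_gt0 r0.
  exact: qexpansion_scale.
by rewrite mulnC; exact: qexpansion_scale.
Qed.

Lemma expandableD (g h : C -> C) : expandable g -> expandable h ->
  expandable (fun t => g t + h t).
Proof.
move=> /expandable2 /[apply] -[r [r0 [b hb] [c hc]]]; exists r => //.
exists (fun n => b n + c n) => t ht; have [ab <-] := hb t ht; have [ac <-] := hc t ht.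
rewrite -csumD //; split; first by have := asumD ab ac; congr asum; apply/funext => n; rewrite mulrDl.
by congr csum; apply/funext => n; rewrite mulrDl.
Qed.

Lemma expandableZ (a : C) (g : C -> C) : expandable g -> expandable (fun t => a * g t).
Proof.
move=> [r r0 [b hb]]; exists r => //; exists (fun n => a * b n) => t ht.
have [ab <-] := hb t ht; rewrite -csumZ //; split.
  by have := asumZ a ab; congr asum; apply/funext => n; rewrite mulrA.
by congr csum; apply/funext => n; rewrite mulrA.
Qed.

Lemma expandableM (g h : C -> C) : expandable g -> expandable h ->
  expandable (fun t => g t * h t).
Proof.
move=> /expandable2 /[apply] -[r [r0 [b hb] [c hc]]]; exists r => //.
apply: (@qexpansion_family _ (fun p : nat * nat => p.1 + p.2)%N (fun p => b p.1 * c p.2)) => t ht.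
have [ab <-] := hb t ht; have [ac <-] := hc t ht; rewrite -csum_prod //.
have E : (fun p : nat * nat => b p.1 * c p.2 * q (t / r%:R) ^+ (p.1 + p.2)) =
  fun p => (b p.1 * q (t / r%:R) ^+ p.1) * (c p.2 * q (t / r%:R) ^+ p.2).
  by apply/funext => p; rewrite exprD mulrACA.
rewrite E; split=> //; exact: (asum_prod ab ac).
Qed.

Lemma expandable_cst (a : C) : expandable (fun=> a).
Proof.
exists 1%N => //; exists (fun n => if n == 0%N then a else 0) => t ht; split.
  by apply: (@asum_fin _ _ _ [fset 0%N]%fset) => n; rewrite inE => /negbTE ->; rewrite mul0r.
rewrite (@csum_fin _ _ _ [fset 0%N]%fset) => [|n]; last by rewrite inE => /negbTE ->; rewrite mul0r.
by rewrite big_seq_fset1 eqxx expr0 mulr1.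
Qed.

Lemma expandable_sum (I : Type) (s : seq I) (g : I -> C -> C) :
  (forall i, expandable (g i)) -> expandable (fun t => \sum_(i <- s) g i t).
Proof.
move=> hg; elim: s => [|i s IH].
  by apply: expandable_eq (expandable_cst 0) => t _; rewrite big_nil.
by apply: expandable_eq (expandableD (hg i) IH) => t _; rewrite big_cons.
Qed.

Lemma expandable_at_infinity (g : C -> C) : expandable g -> holomorphic_at_infinity g.
Proof.
move=> [r r0 [b hb]]; exists r; split => //; exists b => t ht.
by have [ab <-] := hb t ht; exact: series_csum.
Qed.

(* For fixed even [M] the span of [vth M 0], ..., [vth M (M - 1)] is stable under
   t -> t + 1 and, up to the factor [rr t], under t -> -1/t. *)
Definition vth (M rho : nat) (t : C) : C := Th (rho%:R / M%:R) (M%:R * t).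

(** M(n + rho/M)^2 = (nM + rho)^2 / M, so the exponents of q are integers divided by 2M. *)
Lemma vth_expandable M rho : (0 < M)%N -> expandable (vth M rho).
Proof.
move=> M0; exists (2 * M)%N; first by rewrite muln_gt0.
have MC : (M%:R : C) != 0 by rewrite pnatr_eq0 -lt0n.
pose e (n : int) : nat := absz ((n * M%:Z + rho%:Z) ^+ 2).
have eE n : ((e n)%:R : C) = (n%:~R * M%:R + rho%:R) ^+ 2.
  rewrite -[LHS]/((e n : int)%:~R) gez0_abs ?sqr_ge0 // rmorphXn rmorphD rmorphM //.
apply: (@qexpansion_family _ e (fun=> 1)) => t ht.
have E : (fun n : int => 1 * q (t / (2 * M)%:R) ^+ e n) =
  fun n : int => cexp (pii * (M%:R * t) * (n%:~R + (rho%:R / M%:R)%:C%C) ^+ 2).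
  apply/funext => n; rewrite mul1r (qE (t / (2 * M)%:R)) -cexpMn eE; congr cexp.
  rewrite rmorphM fmorphV /= !rmorph_nat natrM; field.
  by rewrite MC.
rewrite E; split=> //; exact/Th_asum/H_nat.
Qed.

(** Evenness of [M] makes n^2 M / 2 an integer, so translation acts by a scalar. *)
Lemma vth_T M rho t : (0 < M)%N -> ~~ odd M -> H t ->
  vth M rho (t + 1) = ee (rho%:R ^+ 2 / (2 * M%:R)) * vth M rho t.
Proof.
move=> M0 Me ht; rewrite /vth mulrDr mulr1 -(rmorph_nat (real_complex R) M).
apply: Th_translate; last by rewrite rmorph_nat; exact: H_nat.
have MR : (M%:R : R) != 0 by rewrite pnatr_eq0 -lt0n.
move=> n; rewrite -[RHS](ee_addint _ (n ^+ 2 * M./2%:Z + n * rho%:Z)); congr ee.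
have E2 : (M%:R : R) = (M./2)%:R * 2 by rewrite -natrM muln2 even_halfK.
have hM : ((M./2)%:R : R) != 0 by move: MR; rewrite E2 mulf_eq0 negb_or => /andP[].
have -> : (n ^+ 2 * M./2%:Z + n * rho%:Z)%:~R = n%:~R ^+ 2 * (M./2)%:R + n%:~R * rho%:R :> R.
  by rewrite rmorphD (rmorphM _ (n ^+ 2)) rmorphXn rmorphM.
by rewrite E2; field; rewrite hM.
Qed.

(** After inversion the frequencies are sorted by residue modulo [M], which yields a finite Fourier
    transform. *)
Lemma vth_S M rho t : (0 < M)%N -> H t ->
  vth M rho (- t^-1) = rr t * \sum_(s < M)
    (ee ((s : nat)%:R * rho%:R / M%:R) / (Num.sqrt M%:R)%:C%C) * vth M s t.
Proof.
move=> M0 ht; have MC : (M%:R : C) != 0 by rewrite pnatr_eq0 -lt0n.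
have MR : (M%:R : R) != 0 by rewrite pnatr_eq0 -lt0n.
have M0R : 0 < M%:R :> R by rewrite ltr0n.
have t0 := H_neq0 ht; have ht' := H_inv ht.
have ht2 : H (M%:R * (- t^-1)) by exact: H_nat.
have ht3 : H (t / M%:R).
  have := H_scale (l := M%:R^-1) _ ht; rewrite invr_gt0 fmorphV rmorph_nat mulrC; exact.
have S0 : ((Num.sqrt M%:R)%:C%C : C) != 0 by rewrite eq_complex /= negb_and gt_eqF // sqrtr_gt0.
have E := Th_inversion (rho%:R / M%:R) ht2.
rewrite -/(vth M rho (- t^-1)) in E.
have rE : rr (M%:R * (- t^-1)) = (Num.sqrt M%:R)%:C%C / rr t.
  by rewrite -(rmorph_nat (real_complex R) M) rr_scale // rr_inv.
have tE : - (M%:R * (- t^-1))^-1 = t / M%:R by rewrite mulrN invrN opprK invfM invrK mulrC.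
rewrite rE tE in E.
have -> : vth M rho (- t^-1) = rr t / (Num.sqrt M%:R)%:C%C * Ths (rho%:R / M%:R) (t / M%:R).
  by rewrite -E; field; rewrite S0 rr_neq0.
rewrite /Ths (csum_mod M0 (Ths_asum _ ht3)) -mulrA; congr (_ * _).
rewrite mulr_sumr; apply: eq_bigr => s _; rewrite [_ / _ * vth _ _ _]mulrAC [RHS]mulrC; congr (_ * _).
rewrite -csumZ; last exact/Th_asum/H_nat.
congr csum; apply/funext => j; rewrite [LHS]mulrC; congr (_ * _).
  rewrite -[RHS](ee_addint _ (j * rho%:Z)); congr ee.
  rewrite !rmorphD !rmorphM /=.
  have -> : (M%:Z)%:~R = M%:R :> R by [].
  have -> : (rho%:Z)%:~R = rho%:R :> R by [].
  have -> : ((s : nat)%:Z)%:~R = (s : nat)%:R :> R by [].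
  by field.
congr cexp; rewrite !rmorphD !rmorphM fmorphV /= !rmorph_nat.
have -> : (M%:Z)%:~R = M%:R :> C by [].
have -> : ((s : nat)%:Z)%:~R = (s : nat)%:R :> C by [].
by field.
Qed.

Lemma vthE c k (x : R) t : (0 < c)%N -> k%:R = 4 * c%:R * x -> 
  vth (4 * c) k t = csum (fun j : int => cexp (pii * (c%:R * t) * (j%:~R * 2 + 2 * x%:C%C) ^+ 2)).
Proof.
move=> c0 hk; have cR : (c%:R : R) != 0 by rewrite pnatr_eq0 -lt0n.
rewrite /vth (_ : k%:R / (4 * c)%:R = x); last by rewrite hk natrM; field.
by congr csum; apply/funext => j; congr cexp; rewrite natrM; ring.
Qed.

(** Splitting by the parity of n turns the scale c into the even modulus 4c, with characteristics
    1/4 and 3/4. *)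
Lemma th2_vth c t : (0 < c)%N -> H t ->
  th2 (c%:R * t) = vth (4 * c) c t + vth (4 * c) (3 * c) t.
Proof.
move=> c0 ht; have hc := H_nat c0 ht.
rewrite (@vthE c c 4^-1) //; last by field.
rewrite (@vthE c (3 * c) (3 / 4)) //; last by rewrite natrM; field.
rewrite {1}/th2 /Th (csum_mod (isT : 0 < 2)%N (Th_asum _ hc)) big_ord_recr big_ord1 /=.
congr (_ + _); congr csum; apply/funext => j; congr (cexp (_ * _ ^+ 2)).
  by rewrite addr0 rmorphM !fmorphV !rmorph_nat /=; field.
by rewrite rmorphD !rmorphM !fmorphV !rmorph_nat /=; field.
Qed.

Lemma th3_vth c t : (0 < c)%N -> H t ->
  th3 (c%:R * t) = vth (4 * c) 0 t + vth (4 * c) (2 * c) t.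
Proof.
move=> c0 ht; have hc := H_nat c0 ht.
rewrite (@vthE c 0 0) //; last by rewrite mulr0.
rewrite (@vthE c (2 * c) 2^-1) //; last by rewrite natrM; field.
rewrite {1}/th3 /Th (csum_mod (isT : 0 < 2)%N (Th_asum _ hc)) big_ord_recr big_ord1 /=.
congr (_ + _); congr csum; apply/funext => j; congr (cexp (_ * _ ^+ 2)).
  by rewrite rmorph0 mulr0 !addr0 rmorphM.
by rewrite rmorphD !rmorphM !fmorphV !rmorph_nat rmorph0 /=; field.
Qed.

End Expansions.

(** * Holomorphy of theta series *)

Section Holomorphy.
Context {R : realType}.
Local Notation C := R[i].
Local Notation H := (@upper_half_plane R).

(** Term-by-term differentiation. For |h| < y/2 the remainder of exp(i l (t + h)) is at most 8 l^2
    |h|^2 exp(-l y/2); the factor l^2 costs a further exp(l y/4), and the theta series at height y/4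
    dominates. *)
Lemma Th_estimate al (t : C) : H t -> exists d : C, exists K r : R, 0 < r /\
  forall h, cm h < r -> cm (Th al (t + h) - Th al t - d * h) <= K * cm h ^+ 2.
Proof.
move=> ht; pose y := complex.Im t; have y0 : 0 < y by [].
pose l (n : int) : R := pi * (n%:~R + al) ^+ 2.
have l0 n : 0 <= l n by rewrite mulr_ge0 ?pi_ge0 ?sqr_ge0.
pose T t n : C := cexp (pii * t * (n%:~R + al%:C%C) ^+ 2).
have TE s n : T s n = cexp (Complex 0 (l n) * s).
  rewrite /T; congr cexp; rewrite piiE /l.
  have -> : Complex 0 (pi * (n%:~R + al) ^+ 2) = pi%:C%C * Complex 0 1 * (n%:~R + al%:C%C) ^+ 2 :> C.
    rewrite -(rmorph_int (real_complex R)) -rmorphD -rmorphXn; apply: complexP; rewrite /=; ring.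
  by ring.
have cT s n : cm (T s n) = expR (- l n * complex.Im s).
  by rewrite TE cm_cexp ReM /= mul0r sub0r mulNr.
pose s0 : C := Complex 0 (y / 4).
have Hs0 : H s0 by rewrite HE /= divr_gt0.
have [M hM] := Th_asum al Hs0; rewrite -/(T s0) in hM.
have cT0 n : cm (T s0 n) = expR (- l n * (y / 4)) by rewrite cT.
have dbound n : cm (Complex 0 (l n)) = l n.
  by rewrite cm_def /= expr0n add0r sqrtr_sqr ger0_norm.
have e1 n : l n * y / 8 <= expR (l n * y / 8).
  by apply: le_trans (expR_ge1Dx _); rewrite lerDr.
have ad : asum (fun n => Complex 0 (l n) * T t n).
  apply: (@asum_le _ _ _ (fun n => 8 / y * cm (T s0 n))) => [n|]; last first.
    by apply: bsumZ; [positivity | exists M].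
  rewrite cmM dbound cT cT0 -/y.
  have : l n <= 8 / y * expR (l n * y / 8).
    by rewrite -ler_pdivrMl ?divr_gt0 // invf_div mulrC mulrA.
  move=> /(ler_wpM2r (expR_ge0 (- l n * y))) /le_trans; apply.
  rewrite -[leLHS]mulrA ler_pM2l ?divr_gt0 // -expRD ler_expR.
  by have := mulr_ge0 (l0 n) (ltW y0); lra.
exists (csum (fun n => Complex 0 (l n) * T t n)), (8 * (64 / y ^+ 2) * M), (y / 2).
split => [|h hh]; first by rewrite divr_gt0.
have Hth : H (t + h).
  rewrite HE ImD; have := cm_Im h; rewrite ler_norml => /andP[h1 _].
  by rewrite -/y; lra.
have aT := Th_asum al ht; have aTh := Th_asum al Hth.
rewrite -/(T t) in aT; rewrite -/(T (t + h)) in aTh.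
have -> : Th al (t + h) - Th al t - csum (fun n => Complex 0 (l n) * T t n) * h =
    csum (fun n => T (t + h) n - T t n - h * (Complex 0 (l n) * T t n)).
  by rewrite csumB ?csumB ?csumZ //; [rewrite mulrC | exact: asumB | exact: asumZ].
apply: csum_norm => A.
apply: (@le_trans _ _ (\sum_(n <- A) 8 * (64 / y ^+ 2) * cm h ^+ 2 * cm (T s0 n))); last first.
  rewrite -mulr_sumr [leRHS]mulrAC; apply: ler_wpM2l (hM A).
  by rewrite !mulr_ge0 ?invr_ge0 ?exprn_ge0 ?cm_ge0 // ltW.
apply: ler_sum => n _.
have -> : T (t + h) n - T t n - h * (Complex 0 (l n) * T t n) =
   T t n * (cexp (Complex 0 (l n) * h) - 1 - Complex 0 (l n) * h).
  by rewrite !TE mulrDr cexpD; ring.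
rewrite cmM cT -/y cT0; set x := cm h in hh *; have x0 : 0 <= x := cm_ge0 h.
have := cexp_near (Complex 0 (l n) * h); rewrite cmM dbound -/x => h1.
apply: (le_trans (ler_wpM2l (expR_ge0 _) h1)).
have lb : l n ^+ 2 <= 64 / y ^+ 2 * expR (l n * y / 4).
  have l8 : 0 <= l n * y / 8 by positivity.
  have := le_sqr l8 (e1 n); rewrite -[expR _ ^+ 2]expRM_natl.
  have -> : 2%:R * (l n * y / 8) = l n * y / 4 by field.
  have -> : (l n * y / 8) ^+ 2 = l n ^+ 2 * (y ^+ 2 / 64) by field.
  have -> : 64 / y ^+ 2 = (y ^+ 2 / 64)^-1 by rewrite invf_div.
  by move=> h2; rewrite [leRHS]mulrC ler_pdivlMr // divr_gt0 // exprn_gt0.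
have -> : expR (- l n * y) * (8 * (l n * x) ^+ 2 * expR (l n * x)) =
   8 * x ^+ 2 * (l n ^+ 2 * (expR (- l n * y) * expR (l n * x))) by ring.
have -> : 8 * (64 / y ^+ 2) * x ^+ 2 * expR (- l n * (y / 4)) =
   8 * x ^+ 2 * (64 / y ^+ 2 * expR (- l n * (y / 4))) by ring.
apply: ler_wpM2l; first by positivity.
apply: (le_trans (ler_wpM2r _ lb)); first by positivity.
rewrite -[leLHS]mulrA ler_pM2l; last by positivity.
rewrite -!expRD ler_expR.
have : l n * x <= l n * (y / 2) by rewrite ler_wpM2l // ltW.
lra.
Qed.

Lemma Th_derivable al (a : nat) (t : C) : H t -> (0 < a)%N ->
  derivable (fun s : C^o => Th al (a%:R * s) : C^o) t 1.
Proof.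
move=> ht a0; have [d [K [r [r0 hK]]]] := Th_estimate al (H_nat a0 ht).
have aR : 0 < a%:R :> R by rewrite ltr0n.
apply: (@derivable_cm _ _ t (d * a%:R) (K * a%:R ^+ 2) (r / a%:R)) => [|h hh].
  by rewrite divr_gt0.
have := hK (a%:R * h); rewrite cmM cm_nat mulrC -ltr_pdivlMr // => /(_ hh).
have -> : K * a%:R ^+ 2 * cm h ^+ 2 = K * (cm h * a%:R) ^+ 2 by ring.
by rewrite mulrDr -[d * _ * _]mulrA.
Qed.

Lemma near_upper (t : C) : H t -> \forall s \near (t : C^o), H s.
Proof.
move=> ht; apply/nbhs_ballP; exists (complex.Im t)%:C%C => /=; first by rewrite ltcR.
move=> s; rewrite /ball /= => hs; rewrite HE.
have : cm (t - s) < complex.Im t by have := cmE (t - s); rewrite /= -ltcR => <-.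
by move=> /(le_lt_trans (cm_Im _)); rewrite ImD ImN ltr_norml => /andP[]; lra.
Qed.

Lemma derivable_upper_eq (f g : C -> C) (t : C) : H t -> (forall s, H s -> f s = g s) ->
  derivable (f : C^o -> C^o) t 1 -> derivable (g : C^o -> C^o) t 1.
Proof.
move=> ht fg; apply: near_eq_derivable; near=> s; apply: fg.
by near: s; exact: near_upper.
Unshelve. all: by end_near.
Qed.

Lemma derivable_mul (f g : C -> C) (t : C) :
  derivable (f : C^o -> C^o) t 1 -> derivable (g : C^o -> C^o) t 1 ->
  derivable ((fun x => f x * g x) : C^o -> C^o) t 1.
Proof. exact: (@derivableM C C^o f g t 1). Qed.

Lemma derivable_add (f g : C -> C) (t : C) :
  derivable (f : C^o -> C^o) t 1 -> derivable (g : C^o -> C^o) t 1 ->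
  derivable ((fun x => f x + g x) : C^o -> C^o) t 1.
Proof. exact: (@derivableD C C^o C^o f g t 1). Qed.

Lemma derivable_bigprod (I : Type) (s : seq I) (F : I -> C -> C) (t : C) :
  (forall i, derivable (F i : C^o -> C^o) t 1) ->
  derivable ((fun x => \prod_(i <- s) F i x) : C^o -> C^o) t 1.
Proof.
move=> hF; elim: s => [|i s IH].
  by rewrite (_ : (fun x => _) = cst 1) //; apply/funext => x; rewrite big_nil.
rewrite (_ : (fun x => _) = fun x => F i x * \prod_(j <- s) F j x).
  exact: (derivable_mul (hF i) IH).
by apply/funext => x; rewrite big_cons.
Qed.

End Holomorphy.

(** * Transformation laws under Gamma0(N) *)

Section Descent.

Lemma translate_ind (P : int -> int -> int -> int -> Prop) :
  (forall a b c d, a * d - b * c = 1 -> P a b c d -> P a (a + b) c (c + d)) ->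
  (forall a b c d, a * d - b * c = 1 -> P a b c d -> P a (b - a) c (d - c)) ->
  forall (n a b c d : int), a * d - b * c = 1 ->
    P a b c d -> P a (b + n * a) c (d + n * c).
Proof.
move=> hT hV n; elim/int_rect: n => [|n IH|n IH] a b c d hdet hP.
- by rewrite !mul0r !addr0.
- have -> : b + n.+1%:Z * a = a + (b + n%:Z * a) by rewrite -addn1 PoszD; ring.
  have -> : d + n.+1%:Z * c = c + (d + n%:Z * c) by rewrite -addn1 PoszD; ring.
  by apply: hT; [rewrite -hdet; ring | exact: IH].
- have -> : b + - n.+1%:Z * a = (b + - n%:Z * a) - a by rewrite -addn1 PoszD; ring.
  have -> : d + - n.+1%:Z * c = (d + - n%:Z * c) - c by rewrite -addn1 PoszD; ring.
  by apply: hV; [rewrite -hdet; ring | exact: IH].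
Qed.

Lemma unit_int (x y : int) : x * y = 1 -> x = 1 /\ y = 1 \/ x = -1 /\ y = -1.
Proof.
move=> h; have : `|x| * `|y| = 1 by rewrite -normrM h.
have [x1|[x1|x1]] : `|x| = 0 \/ `|x| = 1 \/ 2 <= `|x| by lia.
- by rewrite x1 mul0r.
- by rewrite x1 mul1r => y1; nia.
- have [y0|y1] : `|y| = 0 \/ 1 <= `|y| by lia.
    by rewrite y0 mulr0.
  move=> E; have : 2 * 1 <= `|x| * `|y| by apply: ler_pM.
  by rewrite E.
Qed.

(** Euclid's algorithm on the bottom row. The closure hypotheses are right multiplication by T, by
    its inverse and by S. *)
Lemma SL2_ind (P : int -> int -> int -> int -> Prop) : P 1 0 0 1 ->
  (forall a b c d, a * d - b * c = 1 -> P a b c d -> P a (a + b) c (c + d)) ->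
  (forall a b c d, a * d - b * c = 1 -> P a b c d -> P a (b - a) c (d - c)) ->
  (forall a b c d, a * d - b * c = 1 -> P a b c d -> P b (- a) d (- c)) ->
  forall a b c d, a * d - b * c = 1 -> P a b c d.
Proof.
move=> P1 hT hV hS; have hn := translate_ind hT hV.
(* -1 is the square of S; it is needed when the descent ends at d = -1. *)
have Pm1 : P (-1) 0 0 (-1).
  by have := hS _ _ _ _ _ (hS _ _ _ _ _ P1); rewrite oppr0; apply; ring.
move=> a b c d; move: {2}(absz c) (leqnn (absz c)) => m; elim: m a b c d => [|m IH] a b c d cm hdet.
  have c0 : c = 0 by lia.
  move: hdet; rewrite c0 mulr0 subr0 => had; have [[a1 d1]|[a1 d1]] := unit_int had.
    have := hn b 1 0 0 1 _ P1; rewrite a1 d1 !(mulr0, mulr1, add0r, addr0, mul0r, subr0); exact.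
  have := hn (- b) (-1) 0 0 (-1) _ Pm1.
  have e1 : 0 + - b * -1 = b by ring.
  have e2 : -1 + - b * 0 = -1 :> int by ring.
  by rewrite a1 d1 e1 e2; exact.
have [c0|c0] := eqVneq c 0; first by apply: IH => //; rewrite c0.
pose n := (d %/ c)%Z; have dE := divz_eq d c; rewrite -/n in dE.
have r0 := modz_ge0 d c0; have r1 := ltz_mod d c0; set r := (d %% c)%Z in dE r0 r1.
have hdet' : (- (b - n * a)) * c - a * (- r) = 1.
  by rewrite -hdet dE; ring.
have hP : P (- (b - n * a)) a (- r) c by apply: IH => //; lia.
have := hS _ _ _ _ hdet' hP; rewrite !opprK => hP2.
have := hn n _ _ _ _ _ hP2.
by rewrite (subrK (n * a)) [r + _]addrC -dE; apply; rewrite -hdet dE; ring.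
Qed.

Lemma balanced (d c : int) : c != 0 -> exists n : int, 2 * `|d + n * c| <= `|c|.
Proof.
move=> c0; have dE := divz_eq d c; have r0 := modz_ge0 d c0; have r1 := ltz_mod d c0.
set r := (d %% c)%Z in dE r0 r1; set k := (d %/ c)%Z in dE.
have [h|h] := leP (2 * r) `|c|.
  exists (- k); have -> : d + - k * c = r by rewrite dE; ring.
  lia.
have [cp|cn] := leP 0 c.
  exists (- k - 1); have -> : d + (- k - 1) * c = r - c by rewrite dE; ring.
  lia.
exists (- k + 1); have -> : d + (- k + 1) * c = r + c by rewrite dE; ring.
lia.
Qed.

(* Gamma0(N) is generated by T, -1 and (1 0; N 1) for 2 <= N <= 4: balanced remainders of
   [d] modulo [c], then of [c] modulo [N d], decrease |c|. For N = 4 the parity of [d]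
   makes the first step strict. *)
Lemma Gamma0_ind (N : int) (P : int -> int -> int -> int -> Prop) : 2 <= N -> N <= 4 ->
  P 1 0 0 1 -> P (-1) 0 0 (-1) ->
  (forall a b c d, a * d - b * c = 1 -> (N %| c)%Z -> P a b c d -> P a (a + b) c (c + d)) ->
  (forall a b c d, a * d - b * c = 1 -> (N %| c)%Z -> P a b c d -> P a (b - a) c (d - c)) ->
  (forall a b c d, a * d - b * c = 1 -> (N %| c)%Z -> P a b c d -> P (a + N * b) b (c + N * d) d) ->
  (forall a b c d, a * d - b * c = 1 -> (N %| c)%Z -> P a b c d -> P (a - N * b) b (c - N * d) d) ->
  forall a b c d, a * d - b * c = 1 -> (N %| c)%Z -> P a b c d.
Proof.
move=> N2 N4 P1 Pm1 hT hV hU hW.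
have hn (n a b c d : int) : a * d - b * c = 1 -> (N %| c)%Z -> P a b c d -> P a (b + n * a) c (d + n * c).
  move=> hdet hc hP; have := @translate_ind (fun a b c d => (N %| c)%Z -> P a b c d) _ _ n a b c d hdet (fun _ => hP) hc.
  by apply=> a' b' c' d' h1 h2 h3; [apply: hT => //; exact: h2 | apply: hV => //; exact: h2].
have hm (n a b c d : int) : a * d - b * c = 1 -> (N %| c)%Z -> P a b c d -> P (a + n * (N * b)) b (c + n * (N * d)) d.
  elim/int_rect: n a b c d => [|n IH|n IH] a b c d hdet hc hP.
  - by rewrite !mul0r !addr0.
  - have -> : a + n.+1%:Z * (N * b) = (a + n%:Z * (N * b)) + N * b by rewrite -addn1 PoszD; ring.
    have -> : c + n.+1%:Z * (N * d) = (c + n%:Z * (N * d)) + N * d by rewrite -addn1 PoszD; ring.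
    apply: hU; [by rewrite -hdet; ring | | exact: IH].
    by rewrite rpredD // mulrCA dvdz_mulr.
  - have -> : a + - n.+1%:Z * (N * b) = (a + - n%:Z * (N * b)) - N * b by rewrite -addn1 PoszD; ring.
    have -> : c + - n.+1%:Z * (N * d) = (c + - n%:Z * (N * d)) - N * d by rewrite -addn1 PoszD; ring.
    apply: hW; [by rewrite -hdet; ring | | exact: IH].
    by rewrite rpredD // mulrCA dvdz_mulr.
move=> a b c d; move: {2}(absz c) (leqnn (absz c)) => m; elim: m a b c d => [|m IH] a b c d cm hdet hc.
  have c0 : c = 0 by lia.
  move: hdet; rewrite c0 mulr0 subr0 => had; have [[a1 d1]|[a1 d1]] := unit_int had.
    have := hn b 1 0 0 1 _ _ P1; rewrite a1 d1 !(mulr0, mulr1, add0r, addr0, mul0r, subr0); exact.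
  have := hn (- b) (-1) 0 0 (-1) _ _ Pm1.
  have e1 : 0 + - b * -1 = b by ring.
  have e2 : -1 + - b * 0 = -1 :> int by ring.
  by rewrite a1 d1 e1 e2; exact.
have [c0|c0] := eqVneq c 0; first by apply: IH => //; rewrite c0.
have [n hd] := balanced d c0; set d' := d + n * c in hd.
have hdet' : a * d' - (b + n * a) * c = 1 by rewrite -hdet /d'; ring.
have [k ck] := dvdzP hc.
have d0 : d' != 0.
  apply/eqP => d0; move: hdet'; rewrite d0 mulr0 sub0r ck mulrA -mulNr => /unit_int; lia.
have Nd0 : N * d' != 0 by rewrite mulf_neq0 //; lia.
have [l hl] := balanced c Nd0; set c' := c + l * (N * d') in hl.
have c'k : c' = (k + l * d') * N by rewrite /c' ck; ring.
have hlt : `|c'| < `|c|.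
  have NN : `|N| = N by lia.
  rewrite c'k ck !normrM NN ltr_pM2r; last by lia.
  have h1 : 2 * `|k + l * d'| <= `|d'|.
    by move: hl; rewrite c'k !normrM NN mulrA [N * _]mulrC ler_pM2r //; lia.
  have h2 : 2 * `|d'| <= `|k| * N by move: hd; rewrite ck normrM NN.
  have k0 : k != 0 by apply: contraNneq c0 => k0; rewrite ck k0 mul0r.
  (* The two bounds give |c'| <= (N/4)|c|. At N = 4 equality would force |d'| = 2|k|, excluded since
     d' is odd. *)
  have [N3|N44] : N <= 3 \/ N = 4 by lia.
    have : `|k| * N <= `|k| * 3 by apply: ler_wpM2l.
    lia.
  have : ~~ (2 %| d')%Z.
    apply/negP => /dvdzP[e de]; move: hdet'; rewrite ck N44 de.
    have -> : a * (e * 2) - (b + n * a) * (k * 4) = 2 * (a * e - (b + n * a) * (k * 2)) by ring.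
    lia.
  rewrite N44 in h2; lia.
have hP : P (a + l * (N * (b + n * a))) (b + n * a) c' d'.
  apply: IH; first by lia.
    by rewrite -hdet' /c'; ring.
  by rewrite c'k dvdz_mull.
have hP1 := hm (- l) _ _ _ _ _ _ hP.
have {}hP1 : P a (b + n * a) c d'.
  have hd2 : (a + l * (N * (b + n * a))) * d' - (b + n * a) * c' = 1.
    by rewrite -hdet' /c'; ring.
  have hc2 : (N %| c')%Z by rewrite c'k dvdz_mull.
  by have := hP1 hd2 hc2; rewrite !mulNr !addrK.
have := hn (- n) _ _ _ _ hdet' hc hP1.
by rewrite /d' !mulNr !addrK.
Qed.

End Descent.

(** * Moebius action and behaviour of theta constants under SL2(Z) *)

Section Mobius.
Context {R : realType}.
Local Notation C := R[i].
Local Notation H := (@upper_half_plane R).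
Implicit Types (a b c d : int) (t : C).

Definition aut c d t : C := c%:~R * t + d%:~R.
Definition mob a b c d t : C := (a%:~R * t + b%:~R) / aut c d t.

Lemma aut_neq0 a b c d t : a * d - b * c = 1 -> H t -> aut c d t != 0.
Proof.
move=> hdet ht; apply/negP => /eqP h.
have hI : c%:~R * complex.Im t = 0 :> R.
  have := congr1 (@complex.Im R) h; rewrite /aut ImD -!(rmorph_int (real_complex R)) ImM /=.
  by rewrite mul0r !addr0.
move/eqP: hI; rewrite mulf_eq0 intr_eq0 (gt_eqF ht) orbF => /eqP c0.
move: h; rewrite /aut c0 mulr0z mul0r add0r => /eqP; rewrite intr_eq0 => /eqP d0.
by move: hdet; rewrite c0 d0 !mulr0 subr0.
Qed.

Lemma H_mob a b c d t : a * d - b * c = 1 -> H t -> H (mob a b c d t).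
Proof.
move=> hdet ht; have h0 := aut_neq0 hdet ht; rewrite HE.
have hR : a%:~R * d%:~R - b%:~R * c%:~R = 1 :> R by rewrite -!intrM -intrB hdet.
move: h0; rewrite /mob /aut -!(rmorph_int (real_complex R)).
case: t ht => x y; rewrite HE /= => y0.
rewrite eq_complex /= !mul0r !addr0 subr0 => h0.
set A := a%:~R; set B := b%:~R; set D := d%:~R in h0 hR *; set E := c%:~R in h0 hR *.
have n0 : 0 < (E * x + D) ^+ 2 + (E * y) ^+ 2.
  rewrite lt_def addr_ge0 ?sqr_ge0 // andbT; apply: contra h0.
  by rewrite paddr_eq0 ?sqr_ge0 // !sqrf_eq0.
have -> : (A * x - 0 + B) * - (E * y / ((E * x + D) ^+ 2 + (E * y) ^+ 2)) +
   A * y * ((E * x + D) / ((E * x + D) ^+ 2 + (E * y) ^+ 2)) =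
   (A * D - B * E) * y / ((E * x + D) ^+ 2 + (E * y) ^+ 2) by ring.
by rewrite hR mul1r divr_gt0.
Qed.

Lemma aut_T c d t : aut c (c + d) t = aut c d (t + 1).
Proof. by rewrite /aut intrD; ring. Qed.
Lemma mob_T a b c d t : mob a (a + b) c (c + d) t = mob a b c d (t + 1).
Proof. by rewrite /mob aut_T intrD; congr (_ / _); ring. Qed.
Lemma aut_V c d t : aut c (d - c) t = aut c d (t - 1).
Proof. by rewrite /aut intrB; ring. Qed.
Lemma mob_V a b c d t : mob a (b - a) c (d - c) t = mob a b c d (t - 1).
Proof. by rewrite /mob aut_V intrB; congr (_ / _); ring. Qed.
Lemma aut_S c d t : t != 0 -> aut d (- c) t = t * aut c d (- t^-1).
Proof. by move=> t0; rewrite /aut mulrNz; field. Qed.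
Lemma mob_S a b c d t : t != 0 -> mob b (- a) d (- c) t = mob a b c d (- t^-1).
Proof.
move=> t0; rewrite /mob aut_S // mulrNz.
have -> : b%:~R * t - a%:~R = t * (a%:~R * - t^-1 + b%:~R) by field.
by rewrite invfM mulrACA divff // mul1r.
Qed.

Lemma H_sub1 t : H t -> H (t - 1).
Proof. by move/(H_addR (-1)); rewrite rmorphN rmorph1. Qed.

(** [s] is chosen before [M] and [rho], so all theta constants share it, and only its square is
    pinned down: no branch of the root of ct + d has to be followed along the induction. *)
Lemma theta_slash a b c d : a * d - b * c = 1 ->
  exists s : C -> C, exists e : C, (forall t, H t -> s t ^+ 2 = e * aut c d t) /\
  forall M rho : nat, (rho < M)%N -> ~~ odd M -> exists A : nat -> C, forall t, H t ->
    vth M rho (mob a b c d t) = s t * \sum_(k < M) A k * vth M k t.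
Proof.
move: a b c d; apply: SL2_ind.
- exists (fun=> 1), 1; split=> [t _|M rho hr Me]; first by rewrite /aut mulr0z mul0r add0r expr1n mulr1.
  exists (fun k => if k == rho then 1 else 0) => t ht.
  rewrite (bigD1 (Ordinal hr)) //= eqxx mul1r big1 ?addr0 => [|k]; last first.
    by rewrite -val_eqE /= => /negbTE ->; rewrite mul0r.
  by rewrite mul1r /mob /aut mulr0z mul0r add0r mul1r addr0 divr1.
- move=> a b c d hdet [s [e [hs hA]]]; exists (fun t => s (t + 1)), e.
  split=> [t ht|M rho hr Me]; first by rewrite aut_T hs //; exact: H_add1.
  have M0 := leq_ltn_trans (leq0n rho) hr; have [A hAt] := hA M rho hr Me.
  exists (fun k => A k * ee (k%:R ^+ 2 / (2 * M%:R))) => t ht; rewrite mob_T hAt; last exact: H_add1.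
  congr (_ * _); apply: eq_bigr => k _.
  by rewrite (vth_T k M0 Me ht) mulrA.
- move=> a b c d hdet [s [e [hs hA]]]; exists (fun t => s (t - 1)), e.
  split=> [t ht|M rho hr Me]; first by rewrite aut_V hs //; exact: H_sub1.
  have M0 := leq_ltn_trans (leq0n rho) hr; have [A hAt] := hA M rho hr Me.
  exists (fun k => A k / ee (k%:R ^+ 2 / (2 * M%:R))) => t ht; rewrite mob_V hAt; last exact: H_sub1.
  congr (_ * _); apply: eq_bigr => k _.
  have {2}-> : t = (t - 1) + 1 by rewrite subrK.
  by rewrite (vth_T k M0 Me (H_sub1 ht)) mulrA mulfVK ?ee_neq0.
- move=> a b c d hdet [s [e [hs hA]]]; exists (fun t => s (- t^-1) * rr t), (- Complex 0 1 * e).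
  split=> [t ht|M rho hr Me].
    by rewrite exprMn hs ?rr_sqr ?aut_S ?H_neq0 //; [ring | exact: H_inv].
  have M0 := leq_ltn_trans (leq0n rho) hr; have [A hAt] := hA M rho hr Me.
  exists (fun k => \sum_(j < M) A j * (ee (k%:R * (j : nat)%:R / M%:R) / (Num.sqrt M%:R)%:C%C)) => t ht.
  rewrite mob_S ?H_neq0 // hAt; last exact: H_inv.
  rewrite -mulrA; congr (_ * _); rewrite mulr_sumr.
  under eq_bigr do rewrite vth_S // mulrCA mulr_sumr.
  rewrite -[LHS]mulr_sumr -[RHS]mulr_sumr; congr (_ * _).
  rewrite exchange_big /=; apply: eq_bigr => k _; rewrite mulr_suml.
  by apply: eq_bigr => j _; rewrite [LHS]mulrA.
Qed.

Lemma theta_slash_expand a b c d : a * d - b * c = 1 ->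
  exists s : C -> C, exists e : C, (forall t, H t -> s t ^+ 2 = e * aut c d t) /\
  forall n : nat, (0 < n)%N ->
   (exists2 E, expandable E & forall t, H t -> th2 (n%:R * mob a b c d t) = s t * E t) /\
   (exists2 E, expandable E & forall t, H t -> th3 (n%:R * mob a b c d t) = s t * E t).
Proof.
move=> hdet; have [s [e [hs hA]]] := theta_slash hdet; exists s, e; split => // n n0.
have M0 : (0 < 4 * n)%N by rewrite muln_gt0.
have Me : ~~ odd (4 * n) by rewrite oddM.
have hE (A : nat -> C) : expandable (fun t => \sum_(k < 4 * n) A k * vth (4 * n) k t).
  apply: expandable_sum => k; apply: expandableZ; exact: vth_expandable.
split.
  have m1 : (n < 4 * n)%N by lia.
  have m3 : (3 * n < 4 * n)%N by lia.
  have [A h1] := hA _ n m1 Me; have [B h2] := hA _ (3 * n)%N m3 Me.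
  exists (fun t => \sum_(k < 4 * n) A k * vth (4 * n) k t + \sum_(k < 4 * n) B k * vth (4 * n) k t).
    exact: expandableD.
  by move=> t ht; rewrite th2_vth ?h1 ?h2 ?mulrDr //; exact: H_mob.
have m2 : (2 * n < 4 * n)%N by lia.
have [A h1] := hA _ 0%N M0 Me; have [B h2] := hA _ (2 * n)%N m2 Me.
exists (fun t => \sum_(k < 4 * n) A k * vth (4 * n) k t + \sum_(k < 4 * n) B k * vth (4 * n) k t).
  exact: expandableD.
by move=> t ht; rewrite th3_vth ?h1 ?h2 ?mulrDr //; exact: H_mob.
Qed.

End Mobius.

(** * Weight one laws from generators; levels 2 and 4 *)

Section Laws.
Context {R : realType}.
Local Notation C := R[i].
Local Notation H := (@upper_half_plane R).
Implicit Types (a b c d : int) (t w : C).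

Definition transforms (N : int) (F : C -> C) (k : int -> int -> C) :=
  forall a b c d, a * d - b * c = 1 -> (N %| c)%Z -> forall t, H t ->
    F (mob a b c d t) = k b d * aut c d t * F t.

(* (1 0; N 1) is conjugate to t -> t - N by t -> -1/t, which takes F to G. *)
Lemma Fricke_law (F G : C -> C) (kap : C) (N : int) :
  (forall w, H w -> F (- w^-1) = kap * w * G w) ->
  (forall w, H w -> G (w + N%:~R) = G w) ->
  forall t, H t -> F (mob 1 0 N 1 t) = aut N 1 t * F t.
Proof.
move=> hF hG t ht; have hi := H_inv ht; have t0 := H_neq0 ht.
pose w := - t^-1 - N%:~R.
have hw : H w by move: (H_addR (- N%:~R) hi); rewrite rmorphN /= rmorph_int.
have w0 := H_neq0 hw.
have d0 : aut N 1 t != 0 by apply: (@aut_neq0 _ 1 0) => //; rewrite mul0r subr0 mulr1.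
have -> : mob 1 0 N 1 t = - w^-1.
  move: d0 w0; rewrite /w /mob /aut mulr1z mulr0z => d0 w0; field.
  rewrite t0 /=; apply/andP; split.
    by apply: contra d0 => /eqP h; apply/eqP; rewrite -[RHS]oppr0 -h; ring.
  by [].
rewrite (hF w hw) -(hG w hw) /w subrK.
have -> : F t = kap * (- t^-1) * G (- t^-1).
  by rewrite -hF // invrN opprK invrK.
by rewrite /aut mulr1z; field.
Qed.

(** Right multiplication by (1 0; N 1) preserves b and d, hence must act with multiplier 1; the
    cocycle condition on [k] is then only required for T. *)
Lemma Gamma0_law (N : int) (F : C -> C) (k : int -> int -> C) (kT : C) :
  2 <= N -> N <= 4 -> kT != 0 -> k 0 1 = 1 -> k 0 (-1) = -1 ->
  (forall a b c d, a * d - b * c = 1 -> (N %| c)%Z -> k (a + b) (c + d) = kT * k b d) ->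
  (forall t, H t -> F (t + 1) = kT * F t) ->
  (forall t, H t -> F (mob 1 0 N 1 t) = aut N 1 t * F t) ->
  (forall t, H t -> F (mob 1 0 (- N) 1 t) = aut (- N) 1 t * F t) ->
  transforms N F k.
Proof.
move=> N2 N4 kT0 k1 km1 hk hT hU hW.
have U0 (n : int) : 1 * 1 - 0 * n = 1 by rewrite mul0r subr0 mulr1.
have stepU (n a b c d : int) : a * d - b * c = 1 ->
   (forall t, H t -> F (mob 1 0 n 1 t) = aut n 1 t * F t) ->
   (forall t, H t -> F (mob a b c d t) = k b d * aut c d t * F t) ->
   forall t, H t -> F (mob (a + n * b) b (c + n * d) d t) = k b d * aut (c + n * d) d t * F t.
  move=> hdet hn hP t ht; have ht' := H_mob (U0 n) ht; have d0 := aut_neq0 (U0 n) ht.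
  have E1 : aut (c + n * d) d t = aut n 1 t * aut c d (mob 1 0 n 1 t).
    by move: d0; rewrite /aut /mob /aut intrD intrM mulr1z mulr0z => d0; field.
  have -> : mob (a + n * b) b (c + n * d) d t = mob a b c d (mob 1 0 n 1 t).
    rewrite {1}/mob E1 {1}/mob invfM mulrA; congr (_ / _).
    by move: d0; rewrite /mob /aut intrD intrM mulr1z mulr0z => d0; field.
  by rewrite hP // hn // E1; ring.
apply: Gamma0_ind => //.
- by move=> t ht; rewrite k1 /mob /aut mulr1z mulr0z !mul1r mul0r addr0 add0r divr1 mul1r.
- move=> t ht; rewrite km1 /mob /aut mulr0z mul0r addr0 add0r mulrNz mulr1z mulN1r.
  by rewrite invrN invr1 mulrNN !mulr1 mulN1r opprK mul1r.
- move=> a b c d hdet hc hP t ht; rewrite mob_T aut_T hP; last exact: H_add1.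
  by rewrite hT // (hk a b c d hdet hc); ring.
- move=> a b c d hdet hc hP t ht; rewrite mob_V aut_V hP; last exact: H_sub1.
  have := hT (t - 1) (H_sub1 ht); rewrite subrK => ->.
  have := hk a (b - a) c (d - c) _ hc; rewrite (addrC a) (addrC c) !subrK => ->; last by rewrite -hdet; ring.
  by ring.
- by move=> a b c d hdet hc hP t ht; apply: stepU.
- move=> a b c d hdet hc hP t ht; rewrite -!mulNr; exact: stepU.
Qed.

(** Conjugation by diag(m, 1) replaces b by mb and c by c/m. *)
Lemma transforms_scale (N : int) F k (m : int) : transforms N F k -> (0 < m)%R ->
  forall a b c d, a * d - b * c = 1 -> (m * N %| c)%Z -> forall t, H t ->
    F (m%:~R * mob a b c d t) = k (m * b) d * aut c d t * F (m%:~R * t).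
Proof.
move=> hF m0 a b c d hdet /dvdzP[e ce] t ht.
have mC : (m%:~R : C) != 0 by rewrite intr_eq0 gt_eqF.
have hm : H (m%:~R * t) by rewrite -(rmorph_int (real_complex R)); apply: H_scale; rewrite ?ltr0z.
have hdet' : a * d - (m * b) * (e * N) = 1 by rewrite -hdet ce; ring.
have := hF _ _ _ _ hdet' (dvdz_mull _ (dvdzz N)) _ hm.
have E1 : aut (e * N) d (m%:~R * t) = aut c d t by rewrite /aut ce !intrM; ring.
rewrite E1 => <-; congr F; rewrite /mob E1 intrM; ring.
Qed.

Lemma ee_cong (N : nat) (m n : int) : (0 < N)%N -> (N%:Z %| m - n)%Z ->
  ee (m%:~R / N%:R : R) = ee (n%:~R / N%:R).
Proof.
move=> N0 /dvdzP[j hj]; rewrite -[RHS](ee_addint _ j); congr ee.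
have NR : (N%:R : R) != 0 by rewrite pnatr_eq0 -lt0n.
have -> : m = n + j * N%:Z by rewrite -hj addrC subrK.
by rewrite intrD intrM -[(N%:Z)%:~R]/(N%:R); field.
Qed.

(** For odd d, [char11] and [char12] are e(bd/4) and e(3bd/8) times quadratic characters of d.
    Writing each as a single exponential reduces the cocycle condition to a congruence modulo 4 or
    16. *)
Definition char11 b d : C := ee ((b * d + d - 1)%:~R / 4%:R).
Definition char12 b d : C := ee ((6 * (b * d) + 4 * (d - 1) + d ^+ 2 - 1)%:~R / 16%:R).

Lemma ee_half : ee (2^-1 : R) = -1 :> C.
Proof.
by apply: complexP; rewrite /ee /cexp /= expR0 !mul1r mulrAC divff // mul1r ?cospi ?sinpi ?oppr0.
Qed.

Lemma ee_mhalf : ee (- 2^-1 : R) = -1 :> C.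
Proof. by rewrite eeN ee_half invrN invr1. Qed.

Lemma th4_T2 t : H t -> th4 (t + 2) = th4 t.
Proof.
move=> ht; have -> : t + 2 = (t + 1) + 1 by ring.
by rewrite th4_T ?th3_T //; exact: H_add1.
Qed.

Lemma th4_T2N t : H t -> th4 (t - 2) = th4 t.
Proof.
move=> ht; rewrite -th4_T2 ?subrK //.
by have := H_addR (- 2) ht; rewrite rmorphN rmorph_nat.
Qed.

Lemma odd_of_det a b c d : a * d - b * c = 1 -> (2 %| c)%Z ->
  exists a' d', a = 2 * a' + 1 /\ d = 2 * d' + 1.
Proof.
move=> hdet /dvdzP[c' cE]; exists ((a - 1) %/ 2)%Z, ((d - 1) %/ 2)%Z.
have oddprod : ~~ (2 %| a * d)%Z.
  have -> : a * d = 2 * (b * c') + 1.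
    have -> : a * d = b * c + 1 by rewrite -hdet addrC subrK.
    by rewrite cE; ring.
  lia.
have ha : ~~ (2 %| a)%Z by apply: contra oddprod => h; exact: dvdz_mulr.
have hd : ~~ (2 %| d)%Z by apply: contra oddprod => h; exact: dvdz_mull.
split; lia.
Qed.

Lemma law11 : transforms 2 (fun t => th2 t * th2 t) char11.
Proof.
have hF w : H w -> th2 (- w^-1) * th2 (- w^-1) = - Complex 0 1 * w * (th4 w * th4 w).
  by move=> hw; rewrite th2_S // -rr_sqr; ring.
apply: (@Gamma0_law 2 _ _ (ee ((1 : int)%:~R / 4%:R))) => //.
- exact: ee_neq0.
- by rewrite /char11 (_ : 0 * 1 + 1 - 1 = 0 :> int) // mulr0z mul0r ee0.
- rewrite /char11 (_ : 0 * -1 + -1 - 1 = - 2%:Z :> int) // mulrNz -[(2%:Z)%:~R]/(2%:R).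
  by rewrite (_ : _ / _ = - 2^-1) ?ee_mhalf //; field.
- move=> a b c d hdet hc; have [a' [d' [aE dE]]] := odd_of_det hdet hc.
  have [c' cE] := dvdzP hc; rewrite /char11 -eeD -mulrDl -intrD.
  (* By the determinant the defect is 2bc + c(a + 1), a multiple of 4 since c is even and a odd. *)
  apply: ee_cong => //; apply/dvdzP; exists (b * c' + c' * (a' + 1)).
  have -> : (a + b) * (c + d) + (c + d) - 1 - (1 + (b * d + d - 1)) = (a * d - b * c) - 1 + 2 * (b * c) + c * (a + 1) by ring.
  by rewrite hdet aE cE; ring.
- by move=> t ht; rewrite th2_T // mulrACA -eeD (_ : 8^-1 + 8^-1 = (1 : int)%:~R / 4%:R) // mulr1z; field.
- by apply: Fricke_law hF _ => w hw; rewrite th4_T2.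
- by apply: Fricke_law hF _ => w hw; rewrite mulrNz th4_T2N.
Qed.

(** The Fricke transform is th4(w) th4(w/2), which is invariant under w -> w + 4. *)
Lemma law12 : transforms 4 (fun t => th2 t * th2 (2 * t)) char12.
Proof.
have hF w : H w -> th2 (- w^-1) * th2 (2 * - w^-1) =
   - Complex 0 1 * (Num.sqrt 2^-1)%:C%C * w * (th4 w * th4 (w / 2)).
  move=> hw; have h2 : H (2^-1%:C%C * w) by apply: H_scale; rewrite ?invr_gt0.
  have e2 : w / 2 = 2^-1%:C%C * w by rewrite fmorphV rmorph_nat mulrC.
  have -> : 2 * - w^-1 = - (2^-1%:C%C * w)^-1 by rewrite -e2; field; exact: H_neq0.
  rewrite !th2_S // e2 rr_scale ?invr_gt0 //.
  have -> : - Complex 0 1 * (Num.sqrt 2^-1)%:C%C * w = (Num.sqrt 2^-1)%:C%C * (- Complex 0 1 * w) :> C by ring.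
  by rewrite -rr_sqr; ring.
have h2 w : H w -> H (w / 2).
  by move=> hw; have := @H_scale _ 2^-1 w; rewrite invr_gt0 fmorphV rmorph_nat mulrC; apply.
apply: (@Gamma0_law 4 _ _ (ee ((6%:Z)%:~R / 16%:R))) => //.
- exact: ee_neq0.
- by rewrite /char12 (_ : 6 * (0 * 1) + 4 * (1 - 1) + 1 ^+ 2 - 1 = 0 :> int) // mulr0z mul0r ee0.
- rewrite /char12 (_ : 6 * (0 * -1) + 4 * (-1 - 1) + (-1) ^+ 2 - 1 = - 8%:Z :> int) // mulrNz -[(8%:Z)%:~R]/(8%:R).
  by rewrite (_ : _ / _ = - 2^-1) ?ee_mhalf //; field.
- move=> a b c d hdet hc.
  have hc2 : (2 %| c)%Z by apply: dvdz_trans hc.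
  have [a' [d' [aE dE]]] := odd_of_det hdet hc2.
  have [c' cE] := dvdzP hc; rewrite /char12 -eeD -mulrDl -intrD.
  (* The defect is 12bc + 6ac + 4c + 2cd + c^2; with c = 4c' and a, d odd it is a multiple of 16. *)
  apply: ee_cong => //; apply/dvdzP; exists (3 * (b * c') + c' + c' ^+ 2 + c' * (3 * a' + d' + 2)).
  have -> : 6 * ((a + b) * (c + d)) + 4 * (c + d - 1) + (c + d) ^+ 2 - 1 - (6 + (6 * (b * d) + 4 * (d - 1) + d ^+ 2 - 1)) =
    6 * (a * d - b * c) - 6 + 12 * (b * c) + 6 * (a * c) + 4 * c + 2 * (d * c) + c ^+ 2 by ring.
  by rewrite hdet aE dE cE; ring.
- move=> t ht; rewrite th2_T // mulrDr mulr1.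
  have h2t : H (2 * t) by exact: (H_nat (n := 2)).
  have -> : 2 * t + 2 = (2 * t + 1) + 1 by ring.
  rewrite !th2_T //; last exact: H_add1.
  have -> : ee ((6%:Z)%:~R / 16%:R) = ee 8^-1 * (ee 8^-1 * ee 8^-1) :> C.
    by rewrite -!eeD -[(6%:Z)%:~R]/(6%:R); congr ee; field.
  by ring.
- apply: Fricke_law hF _ => w hw.
  have -> : (w + 4%:~R) / 2 = w / 2 + 2 by field.
  have -> : w + 4%:~R = (w + 2) + 2 by rewrite -[4%:~R]/(4%:R); ring.
  have hw2 : H (w + 2) by have := H_addR 2 hw; rewrite rmorph_nat.
  by rewrite !th4_T2 //; exact: h2.
- apply: Fricke_law hF _ => w hw; rewrite mulrNz.
  have -> : (w - 4%:~R) / 2 = w / 2 - 2 by field.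
  have -> : w - 4%:~R = (w - 2) - 2 by rewrite -[4%:~R]/(4%:R); ring.
  have hw2 : H (w - 2) by have := H_addR (- 2) hw; rewrite rmorphN rmorph_nat.
  by rewrite !th4_T2N //; exact: h2.
Qed.

End Laws.

(** * The hexagonal theta series and level 6 *)

Section HexLaw.
Context {R : realType}.
Local Notation C := R[i].
Local Notation H := (@upper_half_plane R).
Implicit Types (a b c d : int) (t w : C).

Definition chi3 (d : int) : int := if (d %% 3)%Z == 0 then 0 else if (d %% 3)%Z == 1 then 1 else -1.

Lemma th3_split t : H t -> th3 t = th3 (4 * t) + th2 (4 * t).
Proof.
move=> ht; rewrite {1}/th3 /Th (csum_mod (isT : 0 < 2)%N (Th_asum _ ht)) big_ord_recr big_ord1 /=.
congr (_ + _); congr csum; apply/funext => j; congr cexp.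
  by rewrite rmorph0 !addr0 intrM; ring.
by rewrite rmorph0 addr0 intrD intrM fmorphV rmorph_nat; field.
Qed.

Lemma th4_split t : H t -> th4 t = th3 (4 * t) - th2 (4 * t).
Proof.
move=> ht; rewrite -(th3_T ht) -[in RHS]mulN1r.
have h4 : H (4 * t) := H_nat (n := 4) isT ht.
rewrite th3_split; last exact: H_add1.
have -> : 4 * (t + 1) = 4 * t + 1 + 1 + 1 + 1 by ring.
have h41 := H_add1 h4; have h42 := H_add1 h41; have h43 := H_add1 h42.
rewrite (th3_T h43) (th4_T h42) (th3_T h41) (th4_T h4).
rewrite (th2_T h43) (th2_T h42) (th2_T h41) (th2_T h4); congr (_ + _).
by rewrite !mulrA -!eeD (_ : _ + _ = 2^-1) ?ee_half //; field.
Qed.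

Lemma H_div n t : (0 < n)%N -> H t -> H (t / n%:R).
Proof.
move=> n0 ht; have := @H_scale _ n%:R^-1 t; rewrite invr_gt0 ltr0n fmorphV rmorph_nat mulrC; apply=> //.
Qed.

(** Inversion sends th2 to th4. Splitting th3 and th4 by parity leaves (A + B)(C + D) + (A - B)(C -
    D) = 2(AC + BD), which is again of the shape of [calF], at w/3. *)
Lemma calF_S w : H w ->
  calF (- w^-1) = - Complex 0 1 * (Num.sqrt 2^-1 * Num.sqrt 6^-1)%:C%C * 2 * w * calF (w / 3%:R).
Proof.
move=> hw; have w0 := H_neq0 hw.
have h2 := H_div (n := 2) isT hw; have h6 := H_div (n := 6) isT hw; have h3 := H_div (n := 3) isT hw.
rewrite (calF_theta (H_inv hw)) (calF_theta h3).
have -> : 2 * - w^-1 = - (w / 2%:R)^-1 by field.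
have -> : 6 * - w^-1 = - (w / 6%:R)^-1 by field.
rewrite (th3_S h2) (th3_S h6) (th2_S h2) (th2_S h6) (th3_split h2) (th3_split h6) (th4_split h2) (th4_split h6).
have -> : 4 * (w / 2%:R) = 6 * (w / 3%:R) by field.
have -> : 4 * (w / 6%:R) = 2 * (w / 3%:R) by field.
have e (n : nat) : (0 < n)%N -> rr (w / n%:R) = (Num.sqrt n%:R^-1)%:C%C * rr w.
  move=> n0; have -> : w / n%:R = (n%:R^-1)%:C%C * w by rewrite fmorphV rmorph_nat mulrC.
  by rewrite rr_scale // invr_gt0 ltr0n.
rewrite !e // rmorphM /=.
have -> : - Complex 0 1 * ((Num.sqrt 2^-1)%:C%C * (Num.sqrt 6^-1)%:C%C) * 2 * w =
   (Num.sqrt 2^-1)%:C%C * (Num.sqrt 6^-1)%:C%C * 2 * (- Complex 0 1 * w) :> C by ring.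
rewrite -rr_sqr; ring.
Qed.

Lemma chi3D d c : (3 %| c)%Z -> chi3 (d + c) = chi3 d.
Proof. by move=> /dvdzP[k ->]; rewrite /chi3 addrC modzMDl. Qed.

(** The Fricke transform [calF (w / 3)] is invariant under w -> w + 3; translation acts trivially,
    so the multiplier depends on d alone. *)
Lemma calF_law : transforms 3 (@calF R) (fun _ d => (chi3 d)%:~R).
Proof.
have hT t : H t -> calF (t / 3%:R + 1) = calF (t / 3%:R).
  by move=> ht; apply: calF_T; exact: H_div.
apply: (@Gamma0_law _ 3 _ _ 1) => //.
- by move=> a b c d _ hc; rewrite mul1r addrC chi3D.
- by move=> t ht; rewrite calF_T // mul1r.
- apply: Fricke_law calF_S _ => w hw.
  have -> : (w + 3%:~R) / 3%:R = w / 3%:R + 1 by rewrite -[3%:~R]/(3%:R); field.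
  exact: hT.
- apply: Fricke_law calF_S _ => w hw; rewrite mulrNz -[3%:~R]/(3%:R).
  have h' : H (w - 3%:R) by have := H_addR (- 3%:R) hw; rewrite rmorphN rmorph_nat.
  rewrite -(hT _ h'); have -> // : (w - 3%:R) / 3%:R + 1 = w / 3%:R by field.
Qed.

Definition char13 b d : C := (if (2 %| b)%Z then 1 else -1) * (chi3 d)%:~R.

Lemma th2_th2_calF t : H t -> th2 t * th2 (3 * t) = 2 / 3 * (calF (t / 2%:R) - calF (2 * t)).
Proof.
move=> ht; have h2 := H_div (n := 2) isT ht; have := calF_4 h2.
have -> : 2 * (t / 2%:R) = t by field.
have -> : 6 * (t / 2%:R) = 3 * t by field.
have -> : 4 * (t / 2%:R) = 2 * t by field.
move: (th2 t * _) (calF _) (calF _) => x y z E.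
have -> : x = 3^-1 * (3 * x) by field.
by rewrite E; field.
Qed.

(* For even [b] both terms of [th2_th2_calF] transform by [calF_law]; the case of odd [b]
   is reduced to it by composing with t -> t + 1. *)
Lemma law13 : transforms 6 (fun t => th2 t * th2 (3 * t)) char13.
Proof.
have even_case a b c d t : a * d - b * c = 1 -> (6 %| c)%Z -> (2 %| b)%Z -> H t ->
    th2 (mob a b c d t) * th2 (3 * mob a b c d t) = (chi3 d)%:~R * aut c d t * (th2 t * th2 (3 * t)).
  move=> hdet /dvdzP[e ce] /dvdzP[f bf] ht; have hm := H_mob hdet ht.
  have h2 := H_div (n := 2) isT ht; have h2' : H (2 * t) := H_nat (n := 2) isT ht.
  have hd1 : a * d - f * (2 * c) = 1 by rewrite -[RHS]hdet bf; ring.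
  have hd2 : a * d - (2 * b) * (e * 3) = 1 by rewrite -[RHS]hdet ce; ring.
  have c3 : (3 %| 2 * c)%Z by rewrite ce; apply/dvdzP; exists (2 * e * 2); ring.
  have E1 : aut (2 * c) d (t / 2%:R) = aut c d t by rewrite /aut intrM; field.
  have E2 : aut (e * 3) d (2 * t) = aut c d t by rewrite /aut ce !intrM; ring.
  rewrite !th2_th2_calF //.
  have -> : mob a b c d t / 2%:R = mob a f (2 * c) d (t / 2%:R).
    rewrite /mob E1 mulrAC; congr (_ / _); by rewrite bf intrM; field.
  have -> : 2 * mob a b c d t = mob a (2 * b) (e * 3) d (2 * t).
    rewrite /mob E2 mulrA; congr (_ / _); rewrite intrM; ring.
  have := calF_law hd1 c3 h2; have := calF_law hd2 (dvdz_mull _ (dvdzz 3)) h2'.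
  rewrite E1 E2.
  move: (calF (mob a f _ d _)) (calF (mob a _ _ d (2 * t))) (calF (t / 2%:R)) (calF (2 * t)) => x y z v -> ->.
  by ring.
move=> a b c d hdet hc t ht; rewrite /char13; case: ifP => hb; first by rewrite even_case // mul1r.
have hc2 : (2 %| c)%Z by apply: dvdz_trans hc.
have hc3 : (3 %| c)%Z by apply: dvdz_trans hc.
have [a' [d' [aE dE]]] := odd_of_det hdet hc2.
have hdet' : a * (d - c) - (b - a) * c = 1 by rewrite -[RHS]hdet; ring.
have hb' : (2 %| b - a)%Z by lia.
have ht1 := H_add1 ht.
have := even_case _ _ _ _ _ hdet' hc hb' ht1; rewrite mob_V aut_V addrK => ->.
have h3 : H (3 * t) := H_nat (n := 3) isT ht.
(* Translation contributes e(1/8) and e(3/8), together the sign -1 attached to odd b. *)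
have -> : 3 * (t + 1) = 3 * t + 1 + 1 + 1 by ring.
have h31 := H_add1 h3; have h32 := H_add1 h31.
rewrite (th2_T h32) (th2_T h31) (th2_T h3) (th2_T ht).
have -> : chi3 (d - c) = chi3 d by rewrite chi3D // rpredN.
transitivity ((chi3 d)%:~R * aut c d t * (ee 8^-1 * ee 8^-1 * ee 8^-1 * ee 8^-1) * (th2 t * th2 (3 * t))); first by ring.
by rewrite -!eeD (_ : _ + _ = 2^-1) ?ee_half; [ring | field].
Qed.

End HexLaw.

(** * Nonvanishing of theta constants *)

Section Nonvanishing.
Context {R : realType}.
Local Notation C := R[i].
Local Notation H := (@upper_half_plane R).

Lemma geometric_bound (x : R) (M : nat) : 0 <= x -> x < 1 -> \sum_(i < M) x ^+ i.+1 <= x / (1 - x).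
Proof.
move=> x0 x1; have h : 0 < 1 - x by lra.
rewrite ler_pdivlMr // mulrC.
under eq_bigr do rewrite exprS.
rewrite -mulr_sumr mulrCA -opprB mulNr -subrX1 opprB ler_piMr // gerBl.
exact: exprn_ge0.
Qed.

Lemma csum_nat_bound (f : nat -> C) (x : R) : 0 <= x -> x < 1 ->
  (forall n, cm (f n) <= x ^+ n.+1) -> cm (csum f) <= x / (1 - x).
Proof.
move=> x0 x1 hf; apply: csum_norm => A.
pose M := (\max_(i <- enum_fset A) i.+1)%N.
apply: (@le_trans _ _ (\sum_(i <- iota 0 M) cm (f i))).
  apply: sum_sub_seq => // [i|i iA]; first exact: cm_ge0.
  by rewrite mem_iota /= /M (big_rem i iA) /= leq_max leqnn.
rewrite -[M in iota 0 M]subn0 big_mkord.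
by apply: le_trans (geometric_bound M x0 x1); apply: ler_sum => i _; exact: hf.
Qed.

Lemma csum_nat_near1 (f : nat -> C) (x : R) : asum f -> f 0%N = 1 -> 0 <= x -> x < 1 ->
  (forall n, cm (f n.+1) <= x ^+ n.+1) -> cm (csum f - 1) <= x / (1 - x).
Proof.
move=> af f0 x0 x1 hf; have aS : asum (fun n => if n == 0%N then 0 else f n).
  by apply: (asum_le _ af) => n; case: eqP; rewrite // cm0 cm_ge0.
have -> : csum f - 1 = csum (fun n => f n.+1).
  transitivity (csum (fun n => if n == 0%N then 0 else f n)).
    rewrite -f0 -[X in _ - X](csum_delta 0%N f) -csumB //.
      by congr csum; apply/funext => n; case: eqP; rewrite ?subr0 // subrr.
    by apply: (asum_le _ af) => n; case: eqP; rewrite // cm0 cm_ge0.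
  rewrite -(@csum_inj _ _ _ succn (fun n => if n == 0%N then 0 else f n)) //.
    exact: succn_inj.
  by case=> // n /(_ n).
exact: csum_nat_bound.
Qed.

(** Since n^2 >= |n|, each half of the series without its constant term is bounded by a geometric
    series. *)
Lemma Ths_near1 al (t : C) (x : R) : H t -> x = expR (- (pi * complex.Im t)) -> x < 1 ->
  cm (Ths al t - 1) <= 2 * (x / (1 - x)).
Proof.
move=> ht xE x1; have x0 : 0 <= x by rewrite xE expR_ge0.
have hT (n : int) : cm (cexp (pii * t * n%:~R ^+ 2) * ee (n%:~R * al)) = x ^+ (absz n ^ 2).
  rewrite cmM cm_ee mulr1 cm_cexp xE -expRM_natl; congr expR.
  rewrite -(rmorph_int (real_complex R)) -rmorphXn ReM ReM ImM /=.
  have -> : ((absz n ^ 2)%N%:R : R) = n%:~R ^+ 2.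
    by rewrite natrX -[(absz n)%:R]/((absz n)%:Z%:~R) abszE intr_norm real_normK ?num_real.
  ring.
have le1 n : x ^+ (n.+1 ^ 2) <= x ^+ n.+1.
  by apply: ler_wiXn2l => //; [exact: ltW | rewrite -mulnn; lia].
have ha := Ths_asum al ht.
rewrite /Ths csum_int // addrAC mulr_natl mulr2n; apply: le_trans (cmD _ _) _; apply: lerD.
  apply: csum_nat_near1 => //.
  - by apply: (asum_inj (h := Posz)) ha => i j [].
  - by rewrite /= mulr0z expr0n mulr0 mul0r cexp0 ee0 mulr1.
  - by move=> n; rewrite hT /=; exact: le1.
by apply: csum_nat_bound => // n; rewrite hT /=; exact: le1.
Qed.

Definition nonvan (t : C) := [/\ th2 t != 0, th3 t != 0 & th4 t != 0].

Lemma near1_neq0 (z : C) : cm (z - 1) < 1 -> z != 0.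
Proof. by apply: contraTneq => ->; rewrite sub0r cmN cm1 ltxx. Qed.

(** Here x = exp(-pi Im t) < 1/3, so 2x/(1 - x) < 1 and the constant term 1 dominates. *)
Lemma nonvan_large (t : C) : 8 / 10 <= complex.Im t -> nonvan t.
Proof.
move=> hy; have ht : H t by rewrite HE; lra.
have [x xE] : exists x, x = expR (- (pi * complex.Im t)) by exists (expR (- (pi * complex.Im t))).
have x0 : 0 < x by rewrite xE; exact: expR_gt0.
have x3 : x < 1 / 3.
  (* pi >= 2 and exp(0.4) >= 1.4 give exp(pi Im t) >= 1.4^4 > 3. *)
  have p2 := pi_ge2 R; have h4 : 4 * (4 / 10) <= pi * complex.Im t by nra.
  have e1 := expR_ge1Dx (4 / 10 : R).
  have e2 : (14 / 10) ^+ 4 <= expR (4 / 10 : R) ^+ 4 by rewrite lerXn2r ?nnegrE //; lra.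
  have e3 : 3 < expR (pi * complex.Im t).
    apply: (@lt_le_trans _ _ (expR (4 * (4 / 10)))); last by rewrite ler_expR.
    by rewrite expRM_natl; apply: lt_le_trans e2; lra.
  rewrite xE expRN -[X in _ < X]invrK ltf_pV2 ?posrE ?invr_gt0 ?expR_gt0 //; last by lra.
have x1 : x < 1 by lra.
have hx : x / (1 - x) < 1 / 2 by rewrite ltr_pdivrMr; lra.
have hal al : Ths al t != 0.
  by apply: near1_neq0; apply: le_lt_trans (Ths_near1 al ht xE x1) _; lra.
split.
- rewrite th2_Psi // !mulf_neq0 ?cexp_neq0 ?PsiE //.
  apply: near1_neq0; apply: (@le_lt_trans _ _ (x / (1 - x))); last by lra.
  apply: csum_nat_near1 => // [||n]; first exact: psi_asum.
  + exact: ltW.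
  have cq : cm (q t) <= x.
    rewrite (qE t) cm_cexp xE ler_expR piiE ReM ReM ImM ReM /=.
    have := mulr_gt0 (pi_gt0 R) ht; rewrite !(mul0r, mulr0, mulr1, subr0, sub0r, addr0, add0r); lra.
  rewrite cmX; apply: (@le_trans _ _ (cm (q t) ^+ n.+1)).
    apply: ler_wiXn2l; [exact: cm_ge0 | lra |].
    have := leq_pmulr (n.+1 * 2) (isT : 0 < 1)%N; lia.
  by rewrite lerXn2r ?nnegrE ?cm_ge0 // ltW.
- by rewrite th3E.
- exact: hal.
Qed.

Lemma nonvan_S (t : C) : H t -> nonvan (- t^-1) -> nonvan t.
Proof.
move=> ht [h2 h3 h4]; move: h2 h3 h4; rewrite th2_S // th3_S // th4_S // !mulf_eq0 !negb_or.
by move=> /andP[_ ?] /andP[_ ?] /andP[_ ?].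
Qed.

Lemma nonvan_T (t : C) : H t -> nonvan (t + 1) <-> nonvan t.
Proof.
move=> ht; rewrite /nonvan th2_T // th3_T // th4_T // mulf_eq0 negb_or ee_neq0 /=.
by split=> -[].
Qed.

Lemma nonvan_int (n : int) (t : C) : H t -> nonvan (t + n%:~R) -> nonvan t.
Proof.
have Hn (m : int) s : H s -> H (s + m%:~R).
  by move/(H_addR m%:~R); rewrite rmorph_int.
elim/int_rect: n t => [|n IH|n IH] t ht.
- by rewrite mulr0z addr0.
- rewrite intS intrD mulr1z [1 + _]addrC addrA => h; apply: IH => //.
  exact: (nonvan_T (Hn n t ht)).1 h.
- rewrite intS opprD intrD mulrN1z [-1 + _]addrC addrA => h; apply: IH => //.
  have hs : H (t + (- n%:Z)%:~R) := Hn (- n%:Z) t ht; move: (t + _) hs h => s hs h.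
  by have := (nonvan_T (H_sub1 hs)).2 h; rewrite subrK.
Qed.

(* If |Re s| <= 1/2 and Im s < 8/10 then |s|^2 < 9/10, so t -> -1/t increases Im s by a
   factor 10/9; 8/10 is below the height sqrt 3 / 2 of the fundamental domain. *)
Lemma nonvan_all (t : C) : H t -> nonvan t.
Proof.
suff hn n : forall s : C, H s -> 8 / 10 * (9 / 10) ^+ n <= complex.Im s -> nonvan s.
  move=> ht; rewrite HE in ht.
  have [n hnt] : exists n : nat, 8 / 10 * (9 / 10) ^+ n <= complex.Im t.
    (* Bernoulli's inequality bounds the number of inversions needed. *)
    have ber n : 1 + n%:R / 9 <= (10 / 9) ^+ n :> R.
      elim: n => [|n IH]; first by rewrite mul0r addr0 expr0.
      rewrite exprS -natr1; have := ler0n R n; nra.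
    pose n := Num.truncn (9 / complex.Im t); exists n.+1.
    have n1 : 9 / complex.Im t < n.+1%:R by exact: truncnS_gt.
    have h2 := ber n.+1; have e : (9 / 10) ^+ n.+1 * (10 / 9) ^+ n.+1 = 1 :> R.
      by rewrite -exprMn (_ : 9 / 10 * (10 / 9) = 1) ?expr1n //; field.
    have n2 : 9 < n.+1%:R * complex.Im t by rewrite -ltr_pdivrMr.
    have p0 : 0 < (9 / 10) ^+ n.+1 :> R by rewrite exprn_gt0 //; lra.
    have h3 : (9 / 10) ^+ n.+1 * (1 + n.+1%:R / 9) <= 1 :> R by rewrite -[leRHS]e ler_pM2l.
    move: p0 n2 h3 ht; move: (_ ^+ _) (n.+1%:R) (complex.Im t) => p N y p0 n2 h3 ht.
    have h4 : p * N <= 9 by nra.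
    have h5 : 0 <= y * (9 - p * N) by rewrite mulr_ge0; lra.
    have h6 : 0 < p * (N * y - 9) by rewrite mulr_gt0 //; lra.
    nra.
  exact: hn hnt.
elim: n => [|n IH] s hs hy; first by apply: nonvan_large; rewrite mulr1 in hy.
have [m hm] : exists m : int, `|complex.Re s + m%:~R| <= 1 / 2.
  exists (- Num.floor (complex.Re s + 1 / 2)).
  have := floor_itv (complex.Re s + 1 / 2); rewrite mulrNz intrD mulr1z => /andP[].
  rewrite ler_norml; lra.
have hs' : H (s + m%:~R) by move: (H_addR m%:~R hs); rewrite rmorph_int.
apply: (nonvan_int hs (n := m)).
have [big|small] := leP (8 / 10) (complex.Im (s + m%:~R)); first exact: nonvan_large.
apply: nonvan_S => //; apply: IH; first exact: H_inv.
have E : complex.Re (s + m%:~R) = complex.Re s + m%:~R.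
  by rewrite ReD -(rmorph_int (real_complex R)).
have E2 : complex.Im (s + m%:~R) = complex.Im s.
  by rewrite ImD -(rmorph_int (real_complex R)) /= addr0.
move: (s + m%:~R) hs' small E E2 => s' hs' small E E2.
rewrite -E in hm; rewrite -E2 in hy => {E E2 hs}.
case: s' hs' small hm hy => a b; rewrite HE /= => b0 small hm hy.
rewrite opprK; have n0 : 0 < a ^+ 2 + b ^+ 2 by rewrite ltr_wpDl ?sqr_ge0 // exprn_gt0.
rewrite ler_pdivlMr //.
have : a ^+ 2 <= 1 / 4 by move: hm; rewrite ler_norml => /andP[]; nra.
have : b ^+ 2 <= 64 / 100 by nra.
move: hy; rewrite exprS; have : 0 < (9 / 10) ^+ n :> R by rewrite exprn_gt0.
nra.
Qed.

End Nonvanishing.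

(** * Ratios of theta constants and their characters *)

Section Multiplier.
Context {R : realType}.
Local Notation C := R[i].
Local Notation H := (@upper_half_plane R).
Implicit Types (a b c d : int) (t : C).

Definition chi4 (d : int) : int :=
  if (d %% 4)%Z == 1 then 1 else if (d %% 4)%Z == 3 then -1 else 0.
Definition chi8 (d : int) : int :=
  if (2 %| d)%Z then 0 else if ((d %% 8)%Z == 1) || ((d %% 8)%Z == 7) then 1 else -1.

(** The quadratic symbol (n / d) for d prime to 6, spelled with the characters of conductor 3, 4 and
    8; trivial for the squares 1 and 4. *)
Definition psi_char (n : nat) (d : int) : int :=
  match n with 2 => chi8 d | 3 => chi3 d * chi4 d | 6 => chi8 d * (chi3 d * chi4 d) | _ => 1 end.

Lemma chi4_ee d : ~~ (2 %| d)%Z -> (chi4 d)%:~R = ee ((d - 1)%:~R / 4%:R : R).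
Proof.
move=> hd; have [hm|hm] : (d %% 4)%Z = 1 \/ (d %% 4)%Z = 3 by lia.
- rewrite /chi4 hm /= (@ee_cong _ 4 _ 0) ?mul0r ?ee0 //; lia.
- rewrite /chi4 hm /= (@ee_cong _ 4 _ 2) //; last by lia.
  by rewrite (_ : _ / _ = 2^-1) ?ee_half //; field.
Qed.

Lemma chi8_ee d : ~~ (2 %| d)%Z -> (chi8 d)%:~R = ee ((d ^+ 2 - 1)%:~R / 16%:R : R).
Proof.
move=> hd; have [e [r [dE hr]]] : exists e r : int, d = 8 * e + r /\ r \in [:: 1; 3; 5; 7].
  by exists (d %/ 8)%Z, (d %% 8)%Z; rewrite !inE; lia.
have hmod : (d %% 8)%Z = r by move: hr; rewrite !inE; lia.
rewrite (@ee_cong _ 16 _ (if (r == 1) || (r == 7) then 0 else 8)) //; last first.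
  rewrite dE; apply/dvdzP; move: hr; rewrite !inE => /or4P[] /eqP-> /=.
  - by exists (4 * e ^+ 2 + e); ring.
  - by exists (4 * e ^+ 2 + 3 * e); ring.
  - by exists (4 * e ^+ 2 + 5 * e + 1); ring.
  - by exists (4 * e ^+ 2 + 7 * e + 3); ring.
rewrite /chi8 (negbTE hd) hmod; case: ifP => _; first by rewrite mul0r ee0.
by rewrite (_ : _ / _ = 2^-1) ?ee_half //; field.
Qed.

Lemma chi4_sqr d : ~~ (2 %| d)%Z -> chi4 d * chi4 d = 1.
Proof. by rewrite /chi4 => hd; case: eqP => h1 //; case: eqP => // h3; lia. Qed.
Lemma chi8_sqr d : ~~ (2 %| d)%Z -> chi8 d * chi8 d = 1.
Proof. by rewrite /chi8 => /negbTE ->; case: ifP. Qed.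

(** [A] and [B] stand for th2 at the scales 1, m, n, at the transformed and at the original point.
    Dividing the law of (m, n) by that of (1, 1) cancels the weight one factor [J], and the ratio at
    m then gives the ratio at n. *)
Lemma ratio_step (K : fieldType) (A1 Am An B1 Bm Bn J c11 mu nu ka : K) :
  A1 != 0 -> Bm != 0 -> mu != 0 ->
  A1 * A1 = c11 * J * (B1 * B1) -> Am * B1 = mu * A1 * Bm -> Am * An = ka * J * (Bm * Bn) ->
  ka = mu * nu * c11 -> An * B1 = nu * A1 * Bn.
Proof.
move=> a0 b0 m0 h1 hm hn hk; apply: (mulfI (mulf_neq0 (mulf_neq0 m0 a0) b0)).
rewrite -{1}hm.
have -> : Am * B1 * (An * B1) = Am * An * (B1 * B1) by ring.
rewrite hn hk.
have -> : mu * nu * c11 * J * (Bm * Bn) * (B1 * B1) = mu * nu * (Bm * Bn) * (c11 * J * (B1 * B1)) by ring.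
by rewrite -h1; ring.
Qed.

(** Scales 2 and 3 are reached from 1 by [law12] and [law13], scales 4 and 6 from 2 by the same laws
    at 2t. The statement is cross-multiplied to avoid quotients. *)
Lemma th2_ratio n a b c d t : n \in [:: 1; 2; 3; 4; 6]%N -> a * d - b * c = 1 ->
  ((2 * n)%N%:Z %| c)%Z -> H t ->
  th2 (n%:R * mob a b c d t) * th2 t =
  ee ((n.-1%:Z * (b * d))%:~R / 8%:R) * (psi_char n d)%:~R * th2 (mob a b c d t) * th2 (n%:R * t).
Proof.
move=> hn hdet hc ht; have hm := H_mob hdet ht.
have n0 : (0 < n)%N by move: hn; rewrite !inE; lia.
have c2 : (2 %| c)%Z by apply: dvdz_trans hc; lia.
have dodd : ~~ (2 %| d)%Z by have [a' [d' [_ ->]]] := odd_of_det hdet c2; lia.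
have nz m s : (0 < m)%N -> H s -> th2 (m%:R * s) != 0.
  by move=> m0 hs; have [] := nonvan_all (H_nat m0 hs).
have A0 : th2 (mob a b c d t) != 0 by have [] := nonvan_all hm.
have B0 : th2 t != 0 by have [] := nonvan_all ht.
have h11 := law11 hdet c2 ht; rewrite /= in h11.
have chi4E := chi4_ee dodd; have chi8E := chi8_ee dodd.
have chi44 : (chi4 d)%:~R * (chi4 d)%:~R = 1 :> C by rewrite -intrM chi4_sqr.
have chi88 : (chi8 d)%:~R * (chi8 d)%:~R = 1 :> C by rewrite -intrM chi8_sqr.
have E11 : char11 b d = ee ((b * d)%:~R / 4%:R) * (chi4 d)%:~R :> C.
  by rewrite chi4E -eeD /char11; congr ee; rewrite !(intrD, intrB); field.
have E12 b' : char12 b' d = ee ((b' * d)%:~R * 3 / 8%:R) * ((chi4 d)%:~R * (chi8 d)%:~R) :> C.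
  by rewrite chi4E chi8E -!eeD /char12; congr ee; field.
have step m l nu ka : (0 < m)%N -> (0 < l)%N ->
    th2 (m%:R * mob a b c d t) * th2 t = ee ((m.-1%:Z * (b * d))%:~R / 8%:R) * (psi_char m d)%:~R * th2 (mob a b c d t) * th2 (m%:R * t) -> 
    (psi_char m d)%:~R != 0 :> C ->
    th2 (m%:R * mob a b c d t) * th2 (l%:R * mob a b c d t) = ka * aut c d t * (th2 (m%:R * t) * th2 (l%:R * t)) ->
    ka = ee ((m.-1%:Z * (b * d))%:~R / 8%:R) * (psi_char m d)%:~R * nu * char11 b d ->
    th2 (l%:R * mob a b c d t) * th2 t = nu * th2 (mob a b c d t) * th2 (l%:R * t).
  move=> m0 l0 hm1 p0 hl hk; apply: (ratio_step A0 (nz m t m0 ht) _ h11 hm1 hl hk).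
  by rewrite mulf_neq0 ?ee_neq0.
have h1 : th2 (1%:R * mob a b c d t) * th2 t = ee ((0%:Z * (b * d))%:~R / 8%:R) * 1 * th2 (mob a b c d t) * th2 (1%:R * t).
  by rewrite mul0r mul0r ee0 !mul1r mulrC.
have h2 : (4 %| c)%Z -> th2 (2%:R * mob a b c d t) * th2 t =
    ee ((1%:Z * (b * d))%:~R / 8%:R) * (chi8 d)%:~R * th2 (mob a b c d t) * th2 (2%:R * t).
  move=> c4; apply: (step 1%N 2%N _ (char12 b d) _ _ h1) => //; first exact: oner_neq0.
    by rewrite !mul1r; exact: (law12 hdet c4 ht).
  rewrite E12 E11 mul0r mul0r ee0 !mul1r.
  transitivity (ee ((b * d)%:~R / 8%:R) * ee ((b * d)%:~R / 4%:R) * ((chi4 d)%:~R * (chi8 d)%:~R) : C); last by ring.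
  by rewrite -eeD; congr (ee _ * _); field.
have p2 : (psi_char 2 d)%:~R != 0 :> C by apply: contraTneq isT => h; move: chi88; rewrite [(chi8 d)%:~R]h mul0r => /eqP; rewrite eq_sym oner_eq0.
move: hn hc; rewrite !inE => /or4P[/eqP->|/eqP->|/eqP->|/orP[]/eqP->] hc; rewrite /psi_char.
- exact: h1.
- exact: h2.
- apply: (step 1%N 3%N _ (char13 b d) _ _ h1) => //; first exact: oner_neq0.
    by rewrite !mul1r; exact: (law13 hdet hc ht).
  rewrite E11 mul0r mul0r ee0 !mul1r.
  transitivity (ee ((b * d)%:~R / 2%:R) * (chi3 d)%:~R : C).
    (* The sign (-1)^b is e(bd/2), as d is odd. *)
    rewrite /char13; congr (_ * _); rewrite (@ee_cong _ 2 _ (if (2 %| b)%Z then 0 else 1)) //.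
      by case: ifP => _; rewrite ?mul0r ?ee0 // mul1r ee_half.
    have [d' dE] : exists d', d = 2 * d' + 1 by exists (d %/ 2)%Z; lia.
    have [[b' bE]|[b' bE]] : (exists b', b = 2 * b') \/ exists b', b = 2 * b' + 1.
      by case hb : (2 %| b)%Z; [left|right]; exists (b %/ 2)%Z; lia.
    + have -> : (2 %| b)%Z by lia.
      by rewrite subr0 bE; apply/dvdzP; exists (b' * d); ring.
    + have -> : (2 %| b)%Z = false by lia.
      by rewrite bE dE; apply/dvdzP; exists (2 * b' * d' + b' + d'); ring.
  transitivity (ee ((2%:Z * (b * d))%:~R / 8%:R) * ee ((b * d)%:~R / 4%:R) * (chi3 d)%:~R * ((chi4 d)%:~R * (chi4 d)%:~R) : C); last by ring.
  by rewrite chi44 mulr1 -eeD; congr (ee _ * _); field.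
- have c4 : (4 %| c)%Z by apply: dvdz_trans hc.
  apply: (step 2%N 4%N _ (char12 (2 * b) d) _ _ (h2 c4)) => //.
    have := transforms_scale (m := 2) law12 isT hdet hc ht.
    have e s : 2 * (2 * s) = 4%:R * s :> C by ring.
    by rewrite /= !e.
  rewrite E12 E11 mulr1.
  transitivity (ee ((1%:Z * (b * d))%:~R / 8%:R) * ee ((3%:Z * (b * d))%:~R / 8%:R) * ee ((b * d)%:~R / 4%:R) * ((chi4 d)%:~R * (chi8 d)%:~R) : C); last by ring.
  by rewrite -!eeD; congr (ee _ * _); field.
- have c4 : (4 %| c)%Z by apply: dvdz_trans hc.
  apply: (step 2%N 6%N _ (char13 (2 * b) d) _ _ (h2 c4)) => //.
    have := transforms_scale (m := 2) law13 isT hdet hc ht.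
    have e s : 3 * (2 * s) = 6%:R * s :> C by ring.
    by rewrite /= !e.
  rewrite E11 /char13 dvdz_mulr // mul1r.
  transitivity (ee ((1%:Z * (b * d))%:~R / 8%:R) * ee ((5%:Z * (b * d))%:~R / 8%:R) * ee ((b * d)%:~R / 4%:R) * (chi3 d)%:~R * ((chi4 d)%:~R * (chi4 d)%:~R) * ((chi8 d)%:~R * (chi8 d)%:~R) : C); last by ring.
  (* The exponents add up to (1/8 + 5/8 + 1/4) bd = bd, an integer. *)
  by rewrite chi44 chi88 !mulr1 -!eeD -[LHS]mul1r -(ee_int (b * d)); congr (ee _ * _); field.
Qed.
End Multiplier.

(** * Transformation of the products in the form *)

Section Products.
Context {R : realType}.
Local Notation C := R[i].
Local Notation H := (@upper_half_plane R).
Implicit Types (t : C).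

Lemma th2_prod_mob (k : nat) (n : 'I_k -> nat) (a b c d : int) t : ~~ odd k ->
  (forall j, n j \in [:: 1; 2; 3; 4; 6]%N) -> (8 %| \sum_(j < k) n j)%N ->
  a * d - b * c = 1 -> (2 %| c)%Z -> (forall j, ((2 * n j)%N%:Z %| c)%Z) -> H t ->
  \prod_(j < k) th2 ((n j)%:R * mob a b c d t) =
  (chi4 d ^+ k./2 * \prod_(j < k) psi_char (n j) d)%:~R * aut c d t ^+ k./2 *
  \prod_(j < k) th2 ((n j)%:R * t).
Proof.
move=> ke hn h8 hdet c2 hc ht.
have B0 : th2 t != 0 by have [] := nonvan_all ht.
have dodd : ~~ (2 %| d)%Z by have [a' [d' [_ ->]]] := odd_of_det hdet c2; lia.
(* The factor th2(t)^k supplies each theta factor with the denominator that [th2_ratio] requires. *)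
apply: (mulIf (expf_neq0 k B0)).
have pow (x : C) : x ^+ k = \prod_(j < k) x by rewrite prodr_const card_ord.
have k2 : k = (2 * k./2)%N by rewrite mul2n even_halfK.
rewrite pow -big_split /=.
rewrite (eq_bigr (fun j => ee (((n j).-1%:Z * (b * d))%:~R / 8%:R) * (psi_char (n j) d)%:~R *
   th2 (mob a b c d t) * th2 ((n j)%:R * t))); last by move=> j _; exact: th2_ratio.
rewrite !big_split /= -!pow [in th2 (mob _ _ _ _ _) ^+ k]k2 exprM expr2 (law11 hdet c2 ht) /=.
have E11 : char11 b d = ee ((b * d)%:~R / 4%:R) * (chi4 d)%:~R :> C.
  by rewrite chi4_ee // -eeD /char11; congr ee; field.
have eep (x : 'I_k -> R) : \prod_(j < k) ee (x j) = ee (\sum_(j < k) x j) :> C.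
  by rewrite (big_morph _ (@eeD R) (@ee0 R)).
(* The coefficient of bd is (h - k)/8 from the ratios plus k/8 from [law11]: in total h/8, an
   integer. *)
have Eh : \prod_(j < k) ee (((n j).-1%:Z * (b * d))%:~R / 8%:R) * ee ((b * d)%:~R / 4%:R) ^+ k./2 = 1 :> C.
  rewrite eep -eeMn -eeD.
  have /dvdnP[e he] := h8; rewrite -(ee_int (e%:Z * (b * d))); congr ee.
  rewrite -mulr_suml -rmorph_sum /= -mulr_suml.
  have hs : \sum_(j < k) (n j).-1%:Z = e%:Z * 8 - k%:Z.
    have -> : e%:Z * 8 = (\sum_(j < k) n j)%N%:Z by rewrite he PoszM.
    rewrite (big_morph Posz PoszD erefl).
    have kz : k%:Z = \sum_(j < k) 1 by rewrite sumr_const card_ord natz.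
    rewrite [in RHS]kz -sumrB; apply: eq_bigr => j _.
    by have := hn j; rewrite !inE; lia.
  by rewrite hs {1}k2 PoszM; field.
have Bk : th2 t ^+ k./2 * th2 t ^+ k./2 = th2 t ^+ k by rewrite -exprD addnn even_halfK.
rewrite intrM rmorphXn /= rmorph_prod /= E11 !exprMn Bk.
transitivity (\prod_(j < k) ee (((n j).-1%:Z * (b * d))%:~R / 8%:R) * ee ((b * d)%:~R / 4%:R) ^+ k./2 *
   (\prod_(j < k) (psi_char (n j) d)%:~R * (chi4 d)%:~R ^+ k./2 * aut c d t ^+ k./2 * th2 t ^+ k * 
    \prod_(j < k) th2 ((n j)%:R * t))); first by ring.
by rewrite Eh mul1r; ring.
Qed.

Lemma calF_prod_mob (u : nat) (n : 'I_u -> nat) (a b c d : int) t :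
  (forall i, 0 < n i)%N -> a * d - b * c = 1 -> (forall i, ((3 * n i)%N%:Z %| c)%Z) -> H t ->
  \prod_(i < u) calF ((n i)%:R * mob a b c d t) =
  (chi3 d ^+ u)%:~R * aut c d t ^+ u * \prod_(i < u) calF ((n i)%:R * t).
Proof.
move=> n0 hdet hc ht.
have pow (x : C) : x ^+ u = \prod_(j < u) x by rewrite prodr_const card_ord.
rewrite rmorphXn /= !pow -!big_split /=; apply: eq_bigr => i _.
apply: (transforms_scale (m := (n i)%:Z) (@calF_law R) _ hdet) => //; first by have := n0 i; lia.
by have := hc i; rewrite PoszM mulrC.
Qed.

Lemma form_theta (u k : nat) (a : 'I_u -> nat) (n : 'I_k -> nat) t :
  (forall j, 0 < n j)%N -> (8 %| \sum_(j < k) n j)%N -> H t ->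
  q t ^+ ((\sum_(j < k) n j) %/ 8) * psi_lt a n t =
  2 ^- k * \prod_(i < u) calF ((a i)%:R * t) * \prod_(j < k) th2 ((n j)%:R * t).
Proof.
move=> n0 h8 ht.
rewrite [in RHS](eq_bigr (fun j => 2 * cexp (pii * ((n j)%:R * t) / 4) * Psi ((n j)%:R * t))); last first.
  by move=> j _; rewrite th2_Psi ?mulrA //; exact: H_nat.
rewrite !big_split /= prodr_const card_ord -(big_morph _ (@cexpD R) (@cexp0 R)).
have -> : \sum_(j < k) (pii * ((n j)%:R * t) / 4) = ((\sum_(j < k) n j) %/ 8)%:R * (2 * (pii * t)).
  have /dvdnP[e he] := h8; rewrite he mulnK //.
  by rewrite -mulr_suml -mulr_sumr -mulr_suml -natr_sum he natrM; field.
rewrite cexpMn -qE /psi_lt.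
have -> : forall x y z : C, 2 ^- k * x * (2 ^+ k * y * z) = y * (x * z); last by [].
have h2 : (2 ^+ k : C) != 0 by rewrite expf_neq0 // pnatr_eq0.
by move: h2; move: (2 ^+ k) => p h2 x y z; field.
Qed.
End Products.

(** * Quadratic characters *)

Section Legendre.
Variable p : nat.
Hypothesis p_prime : prime p.
Hypothesis p_gt2 : (2 < p)%N.
Local Notation F := 'F_p.
Local Notation h := (p./2).

Lemma prime_halfE : p = (h + h).+1.
Proof.
have : odd p by case: (even_prime p_prime) p_gt2 => [->|].
by move=> op; rewrite addnn -[LHS]odd_double_half op.
Qed.

Lemma Fp_int_eq0 (z : int) : (z%:~R == 0 :> F) = (p%:Z %| z)%Z.
Proof.
have hp n : (n%:R == 0 :> F) = (p %| n)%N by rewrite (dvdn_pcharf (pchar_Fp p_prime)).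
case: z => n; first by rewrite dvdzE -[n%:Z%:~R]/(n%:R) hp.
by rewrite NegzE mulrNz oppr_eq0 dvdzE abszN hp.
Qed.

(** Since p > 2, the values -1, 0, 1 stay distinct in F_p, so symbols may be compared there. *)
Lemma Fp_int_inj (a b : int) : `|a| <= 1 -> `|b| <= 1 -> a%:~R = b%:~R :> F -> a = b.
Proof.
move=> ha hb /eqP; rewrite -subr_eq0 -intrB Fp_int_eq0 => /dvdzP[e he].
have p3 : 3 <= p%:Z by [].
have e0 : e = 0 by nia.
by move: he; rewrite e0 mul0r => /eqP; rewrite subr_eq0 => /eqP.
Qed.

Lemma Fp_fermat (x : F) : x != 0 -> x ^+ (h + h) = 1.
Proof.
move=> x0; apply: (mulfI x0); rewrite -exprS -prime_halfE mulr1.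
by rewrite -{2}(finfield.expf_card x) card_Fp.
Qed.

(** The squares of 1, ..., h are h distinct roots of X^h - 1, so there is no room for another
    root. *)
Lemma Fp_euler (x : F) : x ^+ h = 1 -> exists n : nat, x = n%:R ^+ 2.
Proof.
move=> xh; pose s : seq F := [seq n.+1%:R ^+ 2 | n <- iota 0 h].
have h0 : (0 < h)%N by move: p_gt2; rewrite {1}prime_halfE; case: h.
have [xs|xs] := boolP (x \in s).
  by have /mapP[n _ ->] := xs; exists n.+1.
have nz n : (0 < n < p)%N -> n%:R != 0 :> F.
  move=> /andP[n0 np]; rewrite -(dvdn_pcharf (pchar_Fp p_prime)).
  by apply/negP => /(dvdn_leq n0); rewrite leqNgt np.
have us : uniq s.
  rewrite map_inj_in_uniq ?iota_uniq // => m n; rewrite !mem_iota /= !add0n => hm hn /eqP.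
  rewrite -subr_eq0 subr_sqr mulf_eq0 -natrD orbC (negbTE (nz _ _)) /=; last first.
    by have := prime_halfE; lia.
  rewrite subr_eq0; wlog mn : m n hm hn / (n <= m)%N => [H|].
    by have [/H|/ltnW /H H'] := leqP n m; [apply | rewrite eq_sym => /H' ->].
  rewrite -subr_eq0 -natrB // subSS => E; apply/eqP; rewrite eqn_leq mn andbT leqNgt.
  apply/negP => nm; move: E; apply/negP/nz; by rewrite subn_gt0 nm /=; have := prime_halfE; lia.
have P0 : 'X^h - 1 != 0 :> {poly F} by rewrite -size_poly_gt0 size_XnsubC.
have := max_poly_roots P0 (rs := x :: s); rewrite /= xs us size_XnsubC // size_map size_iota ltnn.
rewrite rootE !hornerE xh subrr eqxx /= => H; suff /H/(_ isT) : all (root ('X^h - 1)) s by [].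
apply/allP => y /mapP[n]; rewrite mem_iota add0n => /= hn ->.
rewrite rootE !hornerE -exprM mul2n -addnn Fp_fermat ?subrr // nz //; have := prime_halfE; lia.
Qed.

Lemma legendre_euler (m : int) : (legendre m p)%:~R = m%:~R ^+ h :> F.
Proof.
have h0 : (0 < h)%N by move: p_gt2; rewrite {1}prime_halfE; case: h.
rewrite /legendre; case: ifP => [|/negbT]; rewrite -Fp_int_eq0.
  by move=> /eqP ->; rewrite expr0n gtn_eqF.
move=> m0; case: existsP => [[x /eqP hx]|hx].
  have -> : m%:~R = (x : nat)%:R ^+ 2 :> F.
    apply/eqP; rewrite -[(x : nat)%:R]/((x : nat)%:Z%:~R) -rmorphXn -subr_eq0 -rmorphB /= Fp_int_eq0.
    by rewrite -eqz_mod_dvd; apply/eqP.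
  rewrite -exprM mul2n -addnn Fp_fermat //.
  apply: contraNneq m0 => x0; rewrite Fp_int_eq0; move: hx => /eqP.
  rewrite eq_sym eqz_mod_dvd => hd; rewrite -[m](subrK ((x : nat)%:Z ^+ 2)) rpredD //.
  by rewrite -Fp_int_eq0 rmorphXn /= [_%:~R]x0 expr0n.
have : (m%:~R ^+ h) ^+ 2 = 1 :> F by rewrite -exprM muln2 -addnn Fp_fermat.
move/eqP; rewrite sqrf_eq1 => /orP[/eqP /Fp_euler[n hn]|/eqP -> //].
case: hx; have p0 : (0 < p)%N by exact: prime_gt0.
exists (Ordinal (ltn_pmod n p0)) => /=.
rewrite eqz_mod_dvd -Fp_int_eq0 rmorphB rmorphXn /= hn -[_%:Z%:~R]/((n %% p)%:R).
by rewrite (Fp_nat_mod p_prime) subrr.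
Qed.

Lemma legendre_le1 (m : int) : `|legendre m p| <= 1.
Proof. by rewrite /legendre; do !case: ifP => _. Qed.

Lemma legendreM (m n : int) : legendre (m * n) p = legendre m p * legendre n p.
Proof.
apply: Fp_int_inj; first exact: legendre_le1.
  by rewrite normrM mulr_ile1 ?normr_ge0 ?legendre_le1.
by rewrite intrM !legendre_euler intrM exprMn.
Qed.

Lemma legendre_eq (m e : int) : `|e| <= 1 -> m%:~R ^+ h = e%:~R :> F -> legendre m p = e.
Proof. by move=> e1 he; apply: Fp_int_inj => //; rewrite ?legendre_le1 // legendre_euler. Qed.

Lemma legendreN1 : legendre (-1) p = chi4 p%:Z.
Proof.
apply: legendre_eq; first by rewrite /chi4; do !case: ifP => _.
rewrite mulrN1z -signr_odd; have := prime_halfE => hE; rewrite /chi4.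
have [oh|oh] := boolP (odd h).
  have -> : (p%:Z %% 4)%Z = 3 by rewrite modz_nat hE; lia.
  by rewrite /= expr1.
by have -> : (p%:Z %% 4)%Z = 1 by rewrite modz_nat hE; lia.
Qed.

(** Matrices over F_p stand for elements of a quadratic extension, whether or not -1 or -3 is a
    square modulo p. Generators with zero entry (0, 0) let that entry read off the scalar part of an
    identity. *)
Local Notation A := 'M[F]_2.

Lemma expr_prime (y : A) : y ^+ p = y * (y ^+ 2) ^+ h.
Proof. by rewrite -exprM mul2n -addnn -exprS; congr (_ ^+ _); exact: prime_halfE. Qed.

Lemma pchar_mx2 : p \in [pchar A].
Proof.
rewrite inE /= p_prime; apply/eqP/matrixP => i j; rewrite mulmxnE !mxE.
by case: eqP => _; rewrite ?mul0rn // pchar_Fp_0.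
Qed.

Lemma frobenius_comm (x y : A) : GRing.comm x y -> (x + y) ^+ p = x ^+ p + y ^+ p.
Proof. by move=> /(pFrobenius_autD_comm pchar_mx2); rewrite !pFrobenius_autE. Qed.

(* Frobenius applied to 1 + i, where (1 + i)^2 = 2i; the matrix [x] plays the role of i. *)
Lemma legendre2 : legendre 2 p = chi8 p%:Z.
Proof.
apply: legendre_eq; first by rewrite /chi8; do !case: ifP => _.
have [x [x00 xx]] : exists x : A, x 0 0 = 0 /\ x * x = -1.
  exists (\matrix_(i, j) if i == j then 0 else if (i : nat) == 0%N then -1 else 1); split; first by rewrite mxE.
  apply/matrixP => i j; rewrite !mxE !big_ord_recr big_ord0 /= !mxE.
  by case: i => [[|[|//]] ?]; case: j => [[|[|//]] ?]; rewrite /= ?(mulr0, mul0r, mulr1, mul1r, addr0, add0r, oppr0).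
have x4 : x ^+ 4 = 1 by rewrite -[4%N]/(2 * 2)%N exprM !expr2 xx mulN1r opprK.
have E : (2%:~R : F) ^+ h *: ((1 + x) * x ^+ h) = 1 + x ^+ p.
  rewrite -{2}(expr1n A p) -frobenius_comm; last by rewrite /GRing.comm mul1r mulr1.
  rewrite expr_prime scalerAr; congr (_ * _).
  have -> : (1 + x) ^+ 2 = x *+ 2.
    by rewrite expr2 mulrDl mul1r mulrDr mulr1 xx [1 + x]addrC -addrA [1 + (x - 1)]addrC subrK -mulr2n.
  by rewrite -[x *+ 2]scaler_nat exprZn.
(* As x^4 = 1, the residue of p modulo 8 fixes both x^h and x^p. *)
have [k [r [pE r8]]] : exists k r, p = (8 * k + r)%N /\ r \in [:: 1; 3; 5; 7]%N.
  by exists (p %/ 8)%N, (p %% 8)%N; rewrite !inE; have := prime_halfE; lia.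
have hk : h = (4 * k + r./2)%N by move: r8; rewrite !inE; lia.
have xk n m : x ^+ (4 * n + m) = x ^+ m by rewrite exprD exprM x4 expr1n mul1r.
have xh : x ^+ h = x ^+ r./2 by have /(congr1 (GRing.exp x)) := hk; rewrite xk.
have xp : x ^+ p = x ^+ r by have /(congr1 (GRing.exp x)) := pE; rewrite -[8%N]/(4 * 2)%N -mulnA xk.
have pmod : (p%:Z %% 8)%Z = r%:Z by rewrite [X in X%:Z]pE; move: r8; rewrite !inE; lia.
have p2 : (2 %| p%:Z)%Z = false by have := prime_halfE; lia.
rewrite /chi8 p2 pmod; move: E; rewrite xh xp; move: (_ ^+ h) => e.
have x3 : x ^+ 3 = - x by rewrite exprS expr2 xx mulrN1.
have x5 : x ^+ 5 = x by rewrite -[5%N]/(4 * 1 + 1)%N xk expr1.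
have x7 : x ^+ 7 = - x by rewrite -[7%N]/(4 * 1 + 3)%N xk.
move: r8; rewrite !inE => /or4P[] /eqP -> /=; rewrite ?expr0 ?expr1 ?x3 ?x5 ?x7 ?expr2 ?xx => /(congr1 (fun y : A => y 0 0)).
- by rewrite mulr1 !mxE x00 !addr0 mulr1.
- by rewrite mulrDl mul1r xx !mxE x00 add0r subr0 mulrN1 => E; rewrite -[e]opprK E.
- by rewrite mulrN1 !mxE x00 !addr0 mulrN1 => E; rewrite -[e]opprK E.
- by rewrite mulrN mulrDl mul1r xx !mxE x00 add0r subr0 opprK mulr1.
Qed.

(* Frobenius applied to 2w + 1 = sqrt(-3), where the matrix [w] is a cube root of unity. *)
Lemma legendreN3 : ~~ (3 %| p)%N -> legendre (-3) p = chi3 p%:Z.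
Proof.
move=> p3; apply: legendre_eq; first by rewrite /chi3; do !case: ifP => _.
have [w [w00 ww]] : exists w : A, w 0 0 = 0 /\ w * w = - (w + 1).
  exists (\matrix_(i, j) if (i : nat) == 0%N then (if i == j then 0 else -1) else (if i == j then -1 else 1)); split; first by rewrite mxE.
  apply/matrixP => i j; rewrite !mxE !big_ord_recr big_ord0 /= !mxE.
  by case: i => [[|[|//]] ?]; case: j => [[|[|//]] ?]; rewrite /= ?(mulr0, mul0r, mulr1, mul1r, addr0, add0r, oppr0, mulrN, opprK, subr0, addNr).
have w3 : w ^+ 3 = 1 by rewrite exprS expr2 ww mulrN mulrDr mulr1 ww opprD opprK addrAC subrr add0r.
have s2 : (w *+ 2 + 1) ^+ 2 = (-3)%:~R *: 1.
  have -> : (w *+ 2 + 1) ^+ 2 = ((w * w + w) *+ 2) *+ 2 + 1.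
    by rewrite expr2 mulrDl mulrnAl mul1r mulrDr mulr1 mulrnAr addrA -mulrnDl -[_ *+ 2 + w + w]addrA -[w + w]mulr2n -mulrnDl.
  have -> : w * w + w = -1 by rewrite ww opprD addrAC addNr add0r.
  by rewrite scaler_int -[RHS]/(- (1 *+ 3)) -mulrnA mulNrn -[(2 * 2)%N]/4%N [1 *+ 4]mulrSr opprD subrK.
have := expr_prime (w *+ 2 + 1); rewrite s2 exprZn expr1n -scalerAr mulr1.
rewrite mulr2n frobenius_comm ?frobenius_comm ?expr1n //; last by rewrite /GRing.comm mulr1 mul1r.
have [k [r [pE r3]]] : exists k r, p = (3 * k + r)%N /\ r \in [:: 1; 2]%N.
  by exists (p %/ 3)%N, (p %% 3)%N; rewrite !inE; lia.
have wp : w ^+ p = w ^+ r.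
  by have /(congr1 (GRing.exp w)) := pE; rewrite exprD exprM w3 expr1n mul1r.
have pmod : (p%:Z %% 3)%Z = r%:Z by rewrite [X in X%:Z]pE; move: r3; rewrite !inE; lia.
rewrite wp /chi3 pmod; move: (_ ^+ h) => e /(congr1 (fun y : A => y 0 0)).
move: r3; rewrite !inE => /orP[] /eqP -> /=; rewrite ?expr1 ?expr2 ?ww !mxE w00 !add0r mulr1 => <- //.
by rewrite eqxx addrNK.
Qed.
End Legendre.

(** * Multiplicativity and periodicity of the characters *)

Section Characters.
Implicit Types (d m n : int).

Lemma chi3M m n : chi3 (m * n) = chi3 m * chi3 n.
Proof.
rewrite /chi3 -modzMm.
have : (m %% 3)%Z \in [:: 0; 1; 2] by rewrite !inE; lia.
have : (n %% 3)%Z \in [:: 0; 1; 2] by rewrite !inE; lia.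
by move: (_ %% _)%Z (_ %% _)%Z => r s; rewrite !inE => /or3P[]/eqP-> /or3P[]/eqP->.
Qed.

Lemma chi4M m n : chi4 (m * n) = chi4 m * chi4 n.
Proof.
rewrite /chi4 -modzMm.
have : (m %% 4)%Z \in [:: 0; 1; 2; 3] by rewrite !inE; lia.
have : (n %% 4)%Z \in [:: 0; 1; 2; 3] by rewrite !inE; lia.
by move: (_ %% _)%Z (_ %% _)%Z => r s; rewrite !inE => /or4P[]/eqP-> /or4P[]/eqP->.
Qed.

Lemma chi8_mod d : chi8 d = if (2 %| (d %% 8))%Z then 0 else if ((d %% 8)%Z == 1) || ((d %% 8)%Z == 7) then 1 else -1.
Proof. by rewrite /chi8; congr (if _ then _ else _); lia. Qed.

Lemma chi8M m n : chi8 (m * n) = chi8 m * chi8 n.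
Proof.
rewrite !chi8_mod -modzMm.
have : (m %% 8)%Z \in [:: 0; 1; 2; 3; 4; 5; 6; 7] by rewrite !inE; lia.
have : (n %% 8)%Z \in [:: 0; 1; 2; 3; 4; 5; 6; 7] by rewrite !inE; lia.
move: (_ %% _)%Z (_ %% _)%Z => r s; rewrite !inE.
by move=> /or4P[| | |/or4P[| | |/orP[]]] /eqP-> /or4P[| | |/or4P[| | |/orP[]]] /eqP->.
Qed.

Lemma psi_charM j m n : psi_char j (m * n) = psi_char j m * psi_char j n.
Proof. by case: j => [|[|[|[|[|[|[|j]]]]]]] //=; rewrite ?chi8M ?chi3M ?chi4M //; ring. Qed.

(** The character as the theta laws produce it; complete multiplicativity is immediate here, factor
    by factor. *)
Definition theta_char (e k : nat) (c : 'I_k -> nat) d := chi4 d ^+ e * \prod_(j < k) psi_char (c j) d.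

Lemma theta_charM e k (c : 'I_k -> nat) m n :
  theta_char e c (m * n) = theta_char e c m * theta_char e c n.
Proof.
rewrite /theta_char chi4M exprMn (eq_bigr _ (fun j _ => psi_charM (c j) m n)) big_split /=; ring.
Qed.

Lemma theta_char1 e k (c : 'I_k -> nat) : theta_char e c 1 = 1.
Proof.
rewrite /theta_char expr1n big1 // => j _.
by case: (c j) => [|[|[|[|[|[|[|l]]]]]]].
Qed.

Lemma theta_charN1 e k (c : 'I_k -> nat) : theta_char e c (-1) = (-1) ^+ e.
Proof.
rewrite /theta_char big1 ?mulr1 // => j _.
by case: (c j) => [|[|[|[|[|[|[|l]]]]]]].
Qed.

(** The numerators reduce to -1, 2 and -3 through 3 = (-3)(-1); the factor 4 is a square. *)
Lemma legendre_theta_char p e k (c : 'I_k -> nat) : prime p -> (2 < p)%N -> ~~ (3 %| p)%N ->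
  (forall j, c j \in [:: 1; 2; 3; 4; 6]%N) ->
  legendre ((-1) ^+ e * 4 * (\prod_(j < k) c j)%N%:Z) p = theta_char e c p%:Z.
Proof.
move=> pp p2 p3 hc; have LM := legendreM pp p2.
have L1 : legendre 1 p = 1 by apply: (legendre_eq pp p2) => //; rewrite expr1n.
have L2 := legendre2 pp p2; have LN1 := legendreN1 pp p2.
have L3 : legendre 3 p = chi3 p%:Z * chi4 p%:Z.
  by transitivity (legendre (-3 * -1) p); [|rewrite LM LN1 (legendreN3 pp p2 p3)].
have c8 : chi8 p%:Z * chi8 p%:Z = 1 by apply: chi8_sqr; have := prime_halfE pp p2; lia.
have L4 : legendre 4 p = 1 by transitivity (legendre (2 * 2) p); [|rewrite LM L2].
rewrite !LM L4 mulr1 /theta_char; congr (_ * _).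
  by elim: e => [|e IH]; rewrite ?expr0 // !exprS LM IH LN1.
rewrite (big_morph Posz PoszM erefl) (big_morph _ LM L1); apply: eq_bigr => j _.
have := hc j; rewrite !inE => /or4P[|||/orP[]] /eqP -> //=.
by transitivity (legendre (2 * 3) p); [|rewrite LM L2 L3].
Qed.

(** Both sides are products over the sign and the prime factors of d, so agreement at -1 and at the
    primes not dividing 6 is enough. *)
Lemma kronecker_theta_char e k (c : 'I_k -> nat) d : ~~ (2 %| d)%Z -> ~~ (3 %| d)%Z ->
  (forall j, c j \in [:: 1; 2; 3; 4; 6]%N) ->
  kronecker ((-1) ^+ e * 4 * (\prod_(j < k) c j)%N%:Z) d = theta_char e c d.
Proof.
move=> d2 d3 hc; have d0 : d != 0 by apply: contraNneq d2 => ->.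
rewrite /kronecker (negbTE d0).
(* At -1 every [psi_char] is 1, so the sign is (-1)^e; this matches the Kronecker convention because
   the numerator is negative exactly for odd e. *)
have -> : theta_char e c d = (if (d < 0) && odd e then -1 else 1) * theta_char e c `|d|.
  case: (ltrP d 0) => hd /=.
    have -> : theta_char e c d = theta_char e c (-1 * - d) by rewrite mulN1r opprK.
    by rewrite ltr0_norm // theta_charM theta_charN1 -signr_odd; case: odd.
  by rewrite mul1r ger0_norm.
congr (_ * _).
  congr (if _ && _ then _ else _).
  have P0 : (0 < \prod_(j < k) c j)%N.
    by apply: prodn_gt0 => j; have := hc j; rewrite !inE; lia.
  rewrite -signr_odd; case: odd; rewrite ?expr0 ?expr1; lia.
rewrite -abszE; have ad0 : (0 < absz d)%N by rewrite absz_gt0.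
pose g (x : nat) := theta_char e c x%:Z.
have gM x y : g (x * y)%N = g x * g y by rewrite /g PoszM theta_charM.
have g1 : g 1%N = 1 by exact: theta_char1.
have gX x l : g (x ^ l)%N = g x ^+ l by elim: l => [|l IH]; rewrite ?expr0 // expnS exprS gM IH.
rewrite -[RHS]/(g (absz d)) [in RHS](prod_prime_decomp ad0) (big_morph g gM g1).
apply: eq_big_seq => -[p l] /mem_prime_decomp[pp l0 pd] /=; rewrite gX; congr (_ ^+ _).
have pdd : (p %| absz d)%N by apply: dvdn_trans pd; rewrite -{1}[p]expn1 dvdn_exp2l.
have p2 : p != 2%N by apply: contraNneq d2 => E; move: pdd; rewrite E; lia.
have p3 : ~~ (3 %| p)%N by apply: contra d3 => E; rewrite dvdzE; apply: dvdn_trans pdd.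
rewrite /kronecker_prime (negbTE p2) legendre_theta_char //.
by have := prime_gt1 pp; move: p2; lia.
Qed.

Lemma legendre_3 d : legendre d 3 = chi3 d.
Proof.
rewrite /legendre /chi3; have -> : (3%N%:Z %| d)%Z = ((d %% 3)%Z == 0) by lia.
case: ifP => // h0; have [h1|h1] := eqVneq (d %% 3)%Z 1.
  case: existsP => // -[]; exists (Ordinal (isT : 1 < 3)%N) => /=; apply/eqP; lia.
case: existsP => // -[[[|[|[|//]]] hx]] /= /eqP; lia.
Qed.

Lemma chi3_pow d u : ~~ (3 %| d)%Z -> chi3 d ^+ u = if odd u then chi3 d else 1.
Proof.
move=> d3; have h : chi3 d ^+ 2 = 1.
  have : (d %% 3)%Z \in [:: 1; 2] by rewrite !inE; lia.
  by rewrite /chi3 !inE => /orP[]/eqP->.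
by rewrite -[u in LHS]odd_double_half -mul2n exprD exprM h expr1n mulr1; case: odd.
Qed.

Lemma sqr1_pow (x : int) l : x * x = 1 -> ~~ odd l -> x ^+ l = 1.
Proof. by move=> x2 lo; rewrite -[l]even_halfK // -mul2n exprM expr2 x2 expr1n. Qed.

Lemma psi_charE j d : j \in [:: 1; 2; 3; 4; 6]%N ->
  psi_char j d = chi8 d ^+ ((j == 2%N) || (j == 6%N)) * (chi3 d * chi4 d) ^+ (3 %| j)%N.
Proof. by rewrite !inE => /or4P[|||/orP[]] /eqP -> /=; rewrite ?expr0 ?expr1 ?mulr1 ?mul1r. Qed.

(** [L] may fail to be divisible by the conductors 4 and 8 of the factors. When it does, 8 | h
    forces the offending character to occur to an even power. *)
Lemma theta_char_mod e k (c : 'I_k -> nat) (L : int) m n : k = (2 * e)%N ->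
  (forall j, c j \in [:: 1; 2; 3; 4; 6]%N) -> (8 %| \sum_(j < k) c j)%N ->
  (6 %| L)%Z -> (forall j, ((2 * c j)%N%:Z %| L)%Z) ->
  ~~ (2 %| m)%Z -> ~~ (2 %| n)%Z -> (L %| m - n)%Z ->
  theta_char e c m = theta_char e c n.
Proof.
move=> ke hc h8 hL cL m2 n2 hmn.
have sum_k : (\sum_(j < k) 1 = k)%N by rewrite sum1_card card_ord.
pose E2 := (\sum_(j < k) ((c j == 2) || (c j == 6)))%N.
pose E3 := (\sum_(j < k) (3 %| c j))%N.
have E d : theta_char e c d = chi4 d ^+ (e + E3) * chi8 d ^+ E2 * chi3 d ^+ E3.
  rewrite /theta_char (eq_bigr _ (fun j _ => psi_charE d (hc j))) big_split /= !prodrXr.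
  by rewrite exprMn exprD; ring.
have e3 : chi3 m = chi3 n.
  rewrite -[m](subrK n) addrC chi3D //; apply: dvdz_trans hmn; exact: dvdz_trans hL.
have e4 : chi4 m ^+ (e + E3) = chi4 n ^+ (e + E3).
  have [/existsP[j hj]|/existsPn hev] := boolP [exists j, (2 %| c j)%N].
    have L4 : (4 %| m - n)%Z.
      apply: dvdz_trans hmn; apply: dvdz_trans (cL j); rewrite dvdzE /= (@dvdn_pmul2l 2 2) //.
    by rewrite /chi4; have -> : (m %% 4)%Z = (n %% 4)%Z by lia.
  (* All c_j are odd here, so h = k + 2 E3 = 2(e + E3). *)
  have heven : ~~ odd (e + E3).
    have hs : (\sum_(j < k) c j = k + 2 * E3)%N.
      rewrite /E3 big_distrr /= -[X in _ = (X + _)%N]sum_k -big_split /=.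
      by apply: eq_bigr => j _; have := hev j; have := hc j; rewrite !inE => /or4P[|||/orP[]] /eqP ->.
    move: h8; rewrite hs ke; lia.
  by rewrite !sqr1_pow // chi4_sqr.
have e8 : chi8 m ^+ E2 = chi8 n ^+ E2.
  have [/existsP[j /eqP hj]|/existsPn h4] := boolP [exists j, c j == 4%N].
    have L8 : (8 %| m - n)%Z.
      by apply: dvdz_trans hmn; have := cL j; rewrite hj.
    by rewrite !chi8_mod; have -> : (m %% 8)%Z = (n %% 8)%Z by lia.
  (* No c_j equals 4 here, so h = k + E2 + 2 E3 + 2 E6, where h and k are even. *)
  have heven : ~~ odd E2.
    pose E6 := (\sum_(j < k) (c j == 6))%N.
    have hs : (\sum_(j < k) c j = k + E2 + 2 * E3 + 2 * E6)%N.
      rewrite /E3 /E6 !big_distrr /= -[X in _ = (X + _ + _ + _)%N]sum_k -!big_split /=.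
      by apply: eq_bigr => j _; have := h4 j; have := hc j; rewrite !inE => /or4P[|||/orP[]] /eqP ->.
    move: h8; rewrite hs ke; lia.
  by rewrite !sqr1_pow // chi8_sqr.
by rewrite !E e3 e4 e8.
Qed.
End Characters.

(** * The form *)

Section Assembly.
Context {R : realType}.
Local Notation C := R[i].
Local Notation H := (@upper_half_plane R).
Implicit Types (t : C).

Lemma det_mx2 (g : 'M[int]_2) : \det g = g 0 0 * g 1 1 - g 0 1 * g 1 0.
Proof.
rewrite (expand_det_row _ 0) !big_ord_recl big_ord0 /cofactor !det_mx11 !mxE /= addr0.
have -> : lift 0 0 = 1 :> 'I_2 by apply: val_inj.
have -> : lift 1 0 = 0 :> 'I_2 by apply: val_inj.
by rewrite expr0 expr1; ring.
Qed.

Lemma calF_nat (n : nat) t : (0 < n)%N -> H t ->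
  calF (n%:R * t) = th3 ((2 * n)%:R * t) * th3 ((6 * n)%:R * t) +
                    th2 ((2 * n)%:R * t) * th2 ((6 * n)%:R * t).
Proof. by move=> n0 ht; rewrite calF_theta ?(natrM _ _ n) -?mulrA //; exact: H_nat. Qed.

(** Each term of [calF_theta] has two theta factors, whence the square of [s]. *)
Lemma calF_slash a b c d (s : C -> C) (n : nat) : (0 < n)%N -> a * d - b * c = 1 ->
  (forall m : nat, (0 < m)%N ->
   (exists2 E, expandable E & forall t, H t -> th2 (m%:R * mob a b c d t) = s t * E t) /\
   (exists2 E, expandable E & forall t, H t -> th3 (m%:R * mob a b c d t) = s t * E t)) ->
  exists2 E, expandable E & forall t, H t -> calF (n%:R * mob a b c d t) = s t ^+ 2 * E t.
Proof.
move=> n0 hdet hs.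
have n2 : (0 < 2 * n)%N by rewrite muln_gt0.
have n6 : (0 < 6 * n)%N by rewrite muln_gt0.
have [[E2 e2 h2] [E3 e3 h3]] := hs _ n2; have [[E2' e2' h2'] [E3' e3' h3']] := hs _ n6.
exists (fun t => E3 t * E3' t + E2 t * E2' t).
  by apply: expandableD; apply: expandableM.
move=> t ht; rewrite (calF_nat n0 (H_mob hdet ht)) h2 // h3 // h2' // h3' //; ring.
Qed.

Lemma expandable_prod (n : nat) (F : 'I_n -> C -> C) (x : C -> C) :
  (forall i, exists2 E, expandable E & forall t, H t -> F i t = x t * E t) ->
  exists2 E, expandable E & forall t, H t -> \prod_(i < n) F i t = x t ^+ n * E t.
Proof.
elim: n F => [|n IH] F hF.
  by exists (fun=> 1); [exact: expandable_cst | move=> t _; rewrite big_ord0 expr0 mulr1].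
have [E e hE] := IH (fun i => F (widen_ord (leqnSn n) i)) (fun i => hF _).
have [E' e' hE'] := hF ord_max.
exists (fun t => E t * E' t); first exact: expandableM.
by move=> t ht; rewrite big_ord_recr /= hE // hE' // exprSr; ring.
Qed.

Section Form.
Variables (u k : nat) (a : 'I_u -> nat) (c : 'I_k -> nat).
Hypothesis k_even : ~~ odd k.
Hypothesis a_gt0 : forall i, (0 < a i)%N.
Hypothesis c_range : forall j, c j \in [:: 1; 2; 3; 4; 6]%N.
Hypothesis h_mul8 : (8 %| \sum_(j < k) c j)%N.

Local Notation f := (fun t : C => q t ^+ ((\sum_(j < k) c j) %/ 8) * psi_lt a c t).
Local Notation L := ((level a c)%:Z).

Let c_gt0 j : (0 < c j)%N.
Proof. by have := c_range j; rewrite !inE; lia. Qed.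

Let k2 : k = (2 * k./2)%N.
Proof. by rewrite mul2n even_halfK. Qed.

Lemma level_a i : ((3 * a i)%N%:Z %| L)%Z.
Proof.
rewrite dvdzE /level /=; apply: dvdn_trans (dvdn_lcml _ _).
by rewrite dvdn_pmul2l //; exact: (biglcmn_sup i).
Qed.

Lemma level_c j : ((2 * c j)%N%:Z %| L)%Z.
Proof.
rewrite dvdzE /level /=; apply: dvdn_trans (dvdn_lcmr _ _).
by rewrite dvdn_pmul2l //; exact: (biglcmn_sup j).
Qed.

Lemma level_6 : (6 %| L)%Z.
Proof.
rewrite dvdzE /= (@Gauss_dvd 2 3) // /level; apply/andP; split.
  by apply: dvdn_trans (dvdn_lcmr _ _); exact: dvdn_mulr.
by apply: dvdn_trans (dvdn_lcml _ _); exact: dvdn_mulr.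
Qed.

Lemma coprime_level d : coprimez d L -> ~~ (2 %| d)%Z /\ ~~ (3 %| d)%Z.
Proof.
move=> hd; have aux (p : nat) : (1 < p)%N -> (p %| 6)%N -> ~~ (p%:Z %| d)%Z.
  move=> p1 p6; apply/negP => hp.
  have hL : (p%:Z %| L)%Z by apply: dvdz_trans level_6; rewrite dvdzE.
  have : (p%:Z %| gcdz d L)%Z by rewrite dvdz_gcd hp hL.
  by rewrite (eqP hd) dvdzE dvdn1; lia.
by split; apply: (aux _).
Qed.

(** The primes 2 and 3 divide the level, so these hypotheses hold wherever the character matters. *)
Lemma chi'E d : ~~ (2 %| d)%Z -> ~~ (3 %| d)%Z ->
  chi' u c d = chi3 d ^+ u * theta_char k./2 c d.
Proof.
move=> d2 d3; rewrite /chi' /chi kronecker_theta_char // legendre_3 chi3_pow //.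
by case: odd; rewrite ?mul1r.
Qed.

Lemma chi'_dirichlet : dirichlet_character (level a c) (fun d : int => (chi' u c d)%:~R : C).
Proof.
split => [|m n|m n] //=.
- by rewrite chi'E // expr1n theta_char1.
- move=> /coprime_level[m2 m3] /coprime_level[n2 n3]; rewrite -intrM !chi'E //.
  + by rewrite chi3M theta_charM exprMn; congr intr; ring.
  + by rewrite dvdzE abszM Euclid_dvdM // negb_or -!dvdzE m2 n2.
  + by rewrite dvdzE abszM Euclid_dvdM // negb_or -!dvdzE m3 n3.
move=> /coprime_level[m2 m3] /coprime_level[n2 n3] /eqP; rewrite eqz_mod_dvd => hmn.
rewrite !chi'E // (theta_char_mod k2 c_range h_mul8 level_6 level_c m2 n2 hmn).
have h3 : (3 %| m - n)%Z by apply: dvdz_trans hmn; apply: dvdz_trans level_6.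
by rewrite -{1}[m](subrK n) addrC chi3D.
Qed.

(** On the upper half-plane the form is a polynomial in theta series, so [Th_derivable] suffices. *)
Lemma form_holomorphic : holomorphic_upper f.
Proof.
move=> t ht; apply: (@derivable_upper_eq _ (fun t => 2 ^- k *
   (\prod_(i < u) (th3 ((2 * a i)%:R * t) * th3 ((6 * a i)%:R * t) +
                   th2 ((2 * a i)%:R * t) * th2 ((6 * a i)%:R * t)) *
    \prod_(j < k) th2 ((c j)%:R * t)))) => //.
  move=> s hs; rewrite form_theta // -mulrA; congr (_ * (_ * _)); apply: eq_bigr => i _.
  by rewrite calF_nat.
apply: derivable_mul; first exact: derivable_cst.
apply: derivable_mul; apply: derivable_bigprod => i; last exact: Th_derivable.
by apply: derivable_add; apply: derivable_mul; apply: Th_derivable; rewrite ?muln_gt0 //= a_gt0.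
Qed.

Lemma form_mob (A B M D : int) t : A * D - B * M = 1 -> (L %| M)%Z -> H t ->
  f (mob A B M D t) = (chi' u c D)%:~R * aut M D t ^+ (u + k./2) * f t.
Proof.
move=> hdet hL ht.
have dv x : (x %| L)%Z -> (x %| M)%Z by move=> hx; exact: dvdz_trans hx hL.
have M2 : (2 %| M)%Z by apply: dv; apply: dvdz_trans level_6.
have M3 : (3 %| M)%Z by apply: dv; apply: dvdz_trans level_6.
have hm := H_mob hdet ht.
have D2 : ~~ (2 %| D)%Z by have [a' [d' [_ ->]]] := odd_of_det hdet M2; lia.
have D3 : ~~ (3 %| D)%Z.
  apply/negP => hd; have : (3 %| A * D - B * M)%Z by rewrite rpredB // dvdz_mull.
  by rewrite hdet.
have e1 := calF_prod_mob a_gt0 hdet (fun i => dv _ (level_a i)) ht.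
have e2 := th2_prod_mob k_even c_range h_mul8 hdet M2 (fun j => dv _ (level_c j)) ht.
rewrite (form_theta a c_gt0 h_mul8 hm) (form_theta a c_gt0 h_mul8 ht).
have alg (P P' Q Q' z x y w J J' K : C) : P' = x * J * P -> Q' = y * J' * Q -> w = x * y ->
    K = J * J' -> z * P' * Q' = w * K * (z * P * Q) by move=> -> -> -> ->; ring.
apply: (alg _ _ _ _ _ _ _ _ _ _ _ e1 e2); last exact: exprD.
by rewrite (chi'E D2 D3) -intrM.
Qed.

Lemma form_transforms (g : 'M[int]_2) t : Gamma0 (level a c) g -> H t ->
  f (mobius g t) = (chi' u c (g 1 1))%:~R * automorphy g t ^+ (u + k./2) * f t.
Proof. by move=> [hdet hL]; apply: form_mob => //; rewrite -det_mx2. Qed.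

(** The common factor s occurs 2u + k times, so s^2 = e (ct + d) turns it into a constant times the
    automorphy factor to the power u + k/2, which the slash operator removes. *)
Lemma form_cusps (g : 'M[int]_2) : SL2Z g -> holomorphic_at_infinity (slash (u + k./2) f g).
Proof.
move=> hdet; rewrite /SL2Z /= det_mx2 in hdet.
have [s [e [hs hE]]] := @theta_slash_expand R _ _ _ _ hdet.
have [E eE h2] := expandable_prod (fun j : 'I_k => proj1 (hE _ (c_gt0 j))).
have [E' eE' hF] := expandable_prod (fun i : 'I_u => calF_slash (a_gt0 i) hdet hE).
apply: expandable_at_infinity; apply: (@expandable_eq _ (fun t => (e ^+ (u + k./2) * 2 ^- k) * (E' t * E t))).
  move=> t ht; rewrite /slash -[mobius g t]/(mob (g 0 0) (g 0 1) (g 1 0) (g 1 1) t).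
  rewrite (form_theta a c_gt0 h_mul8 (H_mob hdet ht)).
  have h2t := h2 t ht; have hFt := hF t ht.
  have J0 := aut_neq0 hdet ht; have hst := hs t ht.
  have alg (J P P' Q Q' z : C) : J != 0 -> s t ^+ 2 = e * J -> P' = (s t ^+ 2) ^+ u * P -> Q' = s t ^+ k * Q ->
      e ^+ (u + k./2) * z * (P * Q) = J ^- (u + k./2) * (z * P' * Q').
    move=> {}J0 {}hst -> ->; rewrite [in s t ^+ k]k2 exprM hst.
    have p0 (n : nat) : J ^+ n != 0 by rewrite expf_neq0.
    rewrite !exprD !exprMn; move: (p0 u) (p0 k./2); move: (J ^+ u) (J ^+ k./2) (e ^+ u) (e ^+ k./2) => x y v w x0 y0.
    by field; rewrite x0 y0.
  exact: (alg _ _ _ _ _ _ J0 hst hFt h2t).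
by apply: expandableZ; exact: expandableM.
Qed.

End Form.
End Assembly.

Theorem theorem1p2 (R : realType) (u k : nat)
  (a : 'I_u -> nat) (c : 'I_k -> nat)
  (k_ge2 : (2 <= k)%N) (k_even : ~~ odd k)
  (a_range : forall i, a i \in [:: 1; 2; 4; 8]%N)
  (c_range : forall j, c j \in [:: 1; 2; 3; 4; 6]%N)
  (h_mul8 : (8 %| \sum_(j < k) c j)%N) :
  modular_forms (u + k./2) (level a c)
    (fun d : int => (chi' u c d)%:~R : R[i])
    (fun tau : R[i] => q tau ^+ ((\sum_(j < k) c j) %/ 8) * psi_lt a c tau).
Proof.
have a_gt0 i : (0 < a i)%N by have := a_range i; rewrite !inE; lia.
split.
- exact: chi'_dirichlet.
- exact: form_holomorphic.
- by move=> g hg tau htau; exact: form_transforms.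
- by move=> g hg; exact: form_cusps.
Qed.
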